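(* Let $\mathbb{A}$ be the disc algebra and let $B$ be a finite Blaschke product of degree $d \geq 2$. Let $w \in \mathbb{A}$, $w \not\equiv 0$, and let $T:\mathbb{A}\to\mathbb{A}$ be defined by $(Tf)(z) = w(z)f(B(z))$, $f \in \mathbb{A}$, $z \in \mathbb{D}$. Assume that (1) $B$ is either elliptic or doubly parabolic, and (2) $w$ has no zeros on the unit circle $\mathbb{T}$. Then the spectral radius $\rho(T)$ satisfies $\rho(T) > 0$, $\sigma(T) = \sigma_{lsf}(T) = \rho(T)\mathbb{D} = \{\lambda : |\lambda| \le \rho(T)\}$, and $\sigma_{usf}(T) = \rho(T)\mathbb{T} = \{\lambda : |\lambda| = \rho(T)\}$.
   Context: $\mathbb{U}$ is the open unit disc, $\mathbb{D}$ the closed unit disc, $\mathbb{T}=\partial\mathbb{D}$ the unit circle. The disc algebra $\mathbb{A}$ is the Banach algebra of functions analytic in $\mathbb{U}$ and continuous on $\mathbb{D}$, with the supremum norm. A finite Blaschke product of degree $d$ is $B(z)=e^{i\theta}\prod_{j=1}^d \frac{z-a_j}{1-\overline{a_j}z}$ with $|a_j|<1$. For such $B$ with $d>1$, the Wolff–Denjoy point $z_0\in\mathbb{D}$ is the unique point such that the iterates of $B$ converge to $z_0$ uniformly on compact subsets of $\mathbb{U}$. $B$ is called elliptic if $z_0\in\mathbb{U}$, and doubly parabolic if $z_0\in\mathbb{T}$, $|B'(z_0)|=1$ and $z_0$ is a fixed point of multiplicity 2. For a bounded operator $T$ on a Banach space $X$: $\sigma(T)$ is the spectrum; the approximate point spectrum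 $\sigma_{a.p.}(T)$ is the set of $\lambda$ for which there are $x_n\in X$ with $\|x_n\|=1$ and $Tx_n-\lambda x_n\to 0$; the upper semi-Fredholm spectrum $\sigma_{usf}(T)$ is the set of $\lambda\in\sigma_{a.p.}(T)$ for which such a sequence $x_n$ can be chosen singular (i.e. having no norm-convergent subsequence); the lower semi-Fredholm spectrum is $\sigma_{lsf}(T)=\sigma_{usf}(T')$, where $T'$ is the Banach adjoint of $T$. *)

(* Defs.v *)
From HB Require Import structures.
From mathcomp Require Import all_boot all_order all_algebra.
From mathcomp Require Import all_classical all_reals all_analysis.
From mathcomp Require Import complex.
Import Order.TTheory GRing.Theory Num.Theory.
Import numFieldNormedType.Exports.

Set Implicit Arguments.
Unset Strict Implicit.
Unset Printing Implicit Defensive.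
Set Warnings "-redundant-canonical-projection".

Local Open Scope classical_set_scope.
Local Open Scope ring_scope.
Local Open Scope complex_scope.

(* C = R[i] as a normed space over itself (so that limits, continuity,
   compactness and complex derivatives make sense on C). *)
HB.instance Definition _ (R : realType) := NormedModule.copy R[i] R[i]^o.

Section DiscAlgebra.
Variable R : realType.
Local Notation C := R[i].

Definition cabs (z : C) : R := Normc.normc z.

Definition cU : set C := [set z | cabs z < 1].
Definition cD : set C := [set z | cabs z <= 1].
Definition cT : set C := [set z | cabs z = 1].

(* The disc algebra A: functions analytic (complex differentiable) in U and
   continuous on D.  Only the values on D matter; we normalise elements to
   vanish outside D so that equality of elements of A is Leibniz equality. *)
Definition disc_alg : set (C -> C) :=
  [set f | (forall z, cU z -> derivable f z 1)
         /\ {within cD, continuous f}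
         /\ (forall z, ~ cD z -> f z = 0)].

Definition supnorm (f : C -> C) : R := sup [set cabs (f z) | z in cD].

Definition blaschke (d : nat) (theta : R) (a : 'I_d -> C) : C -> C :=
  fun z => (cos theta +i* sin theta) *
           \prod_(j < d) ((z - a j) / (1 - (a j)^* * z)).

Definition wolff_denjoy_point (B : C -> C) (z0 : C) : Prop :=
  cD z0 /\
  forall K : set C, compact K -> K `<=` cU ->
    forall e : R, 0 < e -> \forall n \near \oo,
      forall z, K z -> cabs (iter n B z - z0) < e.

Definition elliptic (B : C -> C) : Prop :=
  exists z0, wolff_denjoy_point B z0 /\ cU z0.

Definition doubly_parabolic (B : C -> C) : Prop :=
  exists z0, wolff_denjoy_point B z0 /\ cT z0 /\
    cabs (derive1 B z0) = 1 /\
    let g := fun z => B z - z in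
    [/\ g z0 = 0, derive1 g z0 = 0 & derive1n 2 g z0 != 0].

(* ---- generic spectral notions for an operator S on a normed space given
   as a subset P of an lmodType X over C with norm nrm. ---- *)
Section Spectra.
Variables (X : lmodType C) (P : set X) (nrm : X -> R).

Definition spectrum (S : X -> X) : set C :=
  [set lam | ~ exists Sinv : X -> X,
      [/\ (forall x, P x -> P (Sinv x)),
          (forall (c : C) x y, P x -> P y -> Sinv (c *: x + y) = c *: Sinv x + Sinv y),
          (exists M : R, forall x, P x -> nrm (Sinv x) <= M * nrm x),
          (forall x, P x -> Sinv (S x - lam *: x) = x) &
          (forall x, P x -> S (Sinv x) - lam *: Sinv x = x)]].

Definition spectral_radius (S : X -> X) : R :=
  sup [set cabs lam | lam in spectrum S].

Definition approx_eigseq (S : X -> X) (lam : C) (x : nat -> X) : Prop :=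
  [/\ forall n, P (x n), forall n, nrm (x n) = 1 &
      (fun n => nrm (S (x n) - lam *: x n)) @ \oo --> (0 : R)].

Definition singular_seq (x : nat -> X) : Prop :=
  ~ exists (phi : nat -> nat) (y : X),
      [/\ {homo phi : m n / (m < n)%N >-> (m < n)%N}, P y &
          (fun n => nrm (x (phi n) - y)) @ \oo --> (0 : R)].

Definition ap_spectrum (S : X -> X) : set C :=
  [set lam | exists x, approx_eigseq S lam x].

Definition usf_spectrum (S : X -> X) : set C :=
  [set lam | exists x, approx_eigseq S lam x /\ singular_seq x].

End Spectra.

Definition dual_space : set ((C -> C) -> C) :=
  [set phi | (forall (c : C) f g, disc_alg f -> disc_alg g ->
                 phi (c *: f + g) = c * phi f + phi g)
           /\ exists M : R, forall f, disc_alg f -> cabs (phi f) <= M * supnorm f].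

Definition dual_norm (phi : (C -> C) -> C) : R :=
  sup [set cabs (phi f) | f in [set f | disc_alg f /\ supnorm f <= 1]].

Definition adjoint (T : (C -> C) -> (C -> C)) : ((C -> C) -> C) -> ((C -> C) -> C) :=
  fun phi f => phi (T f).

Definition sigmaA (T : (C -> C) -> (C -> C)) := spectrum disc_alg supnorm T.
Definition rhoA (T : (C -> C) -> (C -> C)) := spectral_radius disc_alg supnorm T.
Definition sigma_usf (T : (C -> C) -> (C -> C)) := usf_spectrum disc_alg supnorm T.
Definition sigma_lsf (T : (C -> C) -> (C -> C)) :=
  usf_spectrum dual_space dual_norm (adjoint T).

Definition wcomp (w B : C -> C) : (C -> C) -> (C -> C) :=
  fun f z => if `[< cD z >] then w z * f (B z) else 0.

End DiscAlgebra.

(* Main.v *)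
(* Write [w_n] for the product of [w (B^k z)], [k < n], so that [T^n f = w_n f(B^n)].
   The elliptic or parabolic fixed point [z0] makes [B] expand a metric on the circle (lift
   of the Moebius factor of [z0], respectively the coordinate [cot(t/2)] seen from [z0]), and
   telescoping along inverse branches gives shadowing: for every [x, u] on the circle there is
   [z] with [B^n z = u] and [|w_n x| <= e^(n eps) |w_n z|] for large [n].  Hence the growth rate
   [rho] of [max |w_n|] on the circle is attained along backward orbits of any point.

   By the maximum principle [T - lam] is bounded below when [|lam| <> rho], and a Neumann
   series inverts it when [|lam| > rho].  For [|lam| <= rho], weighted sums of point masses
   along the backward orbits of the two preimages [u, v] of a point, combined with weights
   [1/w(u), -1/w(v)] so that the masses at the common image cancel, are approximate
   eigenvectors of the adjoint; placed at different depths in the backward tree of a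
   nonperiodic point they have disjoint supports, hence mutual distance at least 1.  For
   [|lam| = rho], the sums of [theta^|k-m| lam^-k T^k f_N], with [f_N] peaking at a
   nonperiodic point [p], are approximate eigenvectors of [T]: distinct preimages of [p] do
   not interact as [N] grows.  They tend to 0 inside the disc, so no subsequence converges. *)
Require Import Defs.
From HB Require Import structures.
From mathcomp Require Import all_boot all_order all_algebra.
From mathcomp Require Import all_classical all_reals all_analysis.
From mathcomp Require Import complex ring lra zify.
Import Order.TTheory GRing.Theory Num.Theory.
Import numFieldNormedType.Exports.
Set Implicit Arguments.
Unset Strict Implicit.
Unset Printing Implicit Defensive.
Local Open Scope classical_set_scope.
Local Open Scope ring_scope.
Local Open Scope complex_scope.
Local Notation "x ^*" := (Num.conj x) : complex_scope.

(** One inequality serves both types of fixed point. For [|z| = 1] the kernel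
    [(1 - B(z) conj(B(y))) / (1 - z conj(y))] is a sum of rank-one terms, one per Blaschke factor,
    and Cauchy-Schwarz bounds its square by [|B'(z)|] times its diagonal value at [y]. At an
    interior fixed point that value is 1 because [|B(y)| = |y|]; at a parabolic one it is
    [|B'(y)| = 1]. Two factors already make Cauchy-Schwarz strict, and so [d >= 2] yields expansion.
    As [w] is only continuous, the variation of [log |w|] along inverse branches need not be
    summable, and distortion may grow like [n * eps]: a pull-back step changes [log |w|] by little,
    or it uses up a fixed amount of metric length, which happens boundedly often. In the parabolic
    case the metric is infinite at [z0] and contraction degenerates there; but orbits that linger
    near [z0] all collect the same average, so a long stay is replaced by a backward orbit tending
    to [z0] from its repelling side. The lower semi-Fredholm spectrum lies in the spectrum, so the
    disc found for it, with the Neumann series outside, also determines [rhoA]. *)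

Ltac csplit := apply/eqP; rewrite eq_complex /=; apply/andP; split; apply/eqP.

(** * Complex numbers with epsilon-delta calculus *)

Section ComplexModulus.
Variable R : realType.
Local Notation C := R[i].
Implicit Types (x y z : C).

Lemma eq_ler (a b : R) : a = b -> a <= b.
Proof. by move=> ->. Qed.

Lemma normC_cabs z : `|z| = (cabs z)%:C.
Proof. by []. Qed.

Lemma cabs_ge0 z : 0 <= cabs z.
Proof. by case: z => a b; rewrite /cabs /= sqrtr_ge0. Qed.

Lemma cabs0 : cabs (0 : C) = 0.
Proof. exact: Normc.normc0. Qed.

Lemma cabs1 : cabs (1 : C) = 1.
Proof. exact: Normc.normc1. Qed.

Lemma cabs_eq0 z : cabs z = 0 -> z = 0.
Proof. exact: Normc.eq0_normc. Qed.

Lemma cabs_gt0 z : (0 < cabs z) = (z != 0).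
Proof.
rewrite lt_neqAle cabs_ge0 andbT eq_sym; congr (~~ _).
by apply/eqP/eqP => [/cabs_eq0|->] //; rewrite cabs0.
Qed.

Lemma cabsM x y : cabs (x * y) = cabs x * cabs y.
Proof. exact: Normc.normcM. Qed.

Lemma cabsV x : cabs x^-1 = (cabs x)^-1.
Proof. exact: Normc.normcV. Qed.

Lemma cabsN x : cabs (- x) = cabs x.
Proof. exact: normcN. Qed.

Lemma cabsB x y : cabs (x - y) = cabs (y - x).
Proof. by rewrite -cabsN opprB. Qed.

Lemma cabsD x y : cabs (x + y) <= cabs x + cabs y.
Proof. exact: le_normcD. Qed.

Lemma cabsD3 x y z : cabs (x + y + z) <= cabs x + cabs y + cabs z.
Proof. by apply: (le_trans (cabsD _ _)); rewrite lerD2r cabsD. Qed.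

Lemma cabs_subl x y z : cabs (x - z) <= cabs (x - y) + cabs (y - z).
Proof. have -> : x - z = (x - y) + (y - z) by ring. exact: cabsD. Qed.

Lemma cabs_sub_ge x y : cabs x - cabs y <= cabs (x - y).
Proof. by rewrite lerBlDr; have := cabsD (x - y) y; rewrite subrK. Qed.

Lemma cabsX x n : cabs (x ^+ n) = cabs x ^+ n.
Proof. by elim: n => [|n IH]; rewrite ?expr0 ?cabs1 // !exprS cabsM IH. Qed.

Lemma cabs_sum (I : Type) (r : seq I) (P : pred I) (F : I -> C) :
  cabs (\sum_(i <- r | P i) F i) <= \sum_(i <- r | P i) cabs (F i).
Proof.
elim/big_rec2 : _ => [|i y1 y2 _ h]; first by rewrite cabs0.
by apply: (le_trans (cabsD _ _)); rewrite lerD2l.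
Qed.

Lemma cabs_sqr z : cabs z ^+ 2 = complex.Re z ^+ 2 + complex.Im z ^+ 2.
Proof. by case: z => a b; rewrite /cabs /= sqr_sqrtr // addr_ge0 // sqr_ge0. Qed.

Lemma conjE (a b : R) : (a +i* b)^* = a -i* b.
Proof. by []. Qed.

Lemma sqr_cabsE z : (cabs z ^+ 2)%:C = z * z^*.
Proof.
by rewrite cabs_sqr; case: z => a b; rewrite conjE; csplit; ring.
Qed.

Lemma cabs_real (a : R) : cabs a%:C = `|a|.
Proof. by rewrite /cabs /= expr0n /= addr0 sqrtr_sqr. Qed.

Lemma cabs_Re z : `|complex.Re z| <= cabs z.
Proof.
rewrite -(ler_pXn2r (n := 2)) ?nnegrE ?cabs_ge0 //.
by rewrite cabs_sqr real_normK ?num_real // lerDl sqr_ge0.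
Qed.

Lemma cabs_Im z : `|complex.Im z| <= cabs z.
Proof.
rewrite -(ler_pXn2r (n := 2)) ?nnegrE ?cabs_ge0 //.
by rewrite cabs_sqr [`|_| ^+ 2]real_normK ?num_real // lerDr sqr_ge0.
Qed.

Lemma cabs_i (a : R) : cabs (0 +i* a) = `|a|.
Proof. by rewrite /cabs /= expr0n /= add0r sqrtr_sqr. Qed.

Lemma cabs_leReIm z : cabs z <= `|complex.Re z| + `|complex.Im z|.
Proof.
case: z => a b; rewrite [complex.Re _]/= [complex.Im _]/=.
have -> : a +i* b = a%:C + 0 +i* b by apply/eqP; rewrite eq_complex /= addr0 add0r !eqxx.
by apply: (le_trans (cabsD _ _)); rewrite cabs_real cabs_i.
Qed.

Lemma cabs_conj z : cabs z^* = cabs z.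
Proof. by case: z => a b; rewrite conjE /cabs /= sqrrN. Qed.

Lemma cconjM x y : (x * y)^* = x^* * y^*.
Proof. exact: rmorphM. Qed.

Lemma cconjB x y : (x - y)^* = x^* - y^*.
Proof. exact: rmorphB. Qed.

Lemma cconj1 : (1 : C)^* = 1.
Proof. exact: rmorph1. Qed.

Lemma cconjK x : x^*^* = x.
Proof. exact: conjCK. Qed.

Lemma cconjV x : x^-1^* = x^*^-1.
Proof. exact: fmorphV. Qed.

Lemma cconj_eq0 x : (x^* == 0) = (x == 0).
Proof. exact: fmorph_eq0. Qed.

Lemma sum_geo_le (q : R) n : 0 <= q < 1 -> \sum_(i < n) q ^+ i <= (1 - q)^-1.
Proof.
move=> /andP[q0 q1]; have p : 0 < 1 - q by rewrite subr_gt0.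
rewrite -[leRHS]mul1r ler_pdivlMr //.
have -> : (\sum_(i < n) q ^+ i) * (1 - q) = 1 - q ^+ n.
  by rewrite mulrC -[in RHS](expr1n _ n) subrXX; congr (_ * _);
     apply: eq_bigr => i _; rewrite expr1n mul1r.
by rewrite gerBl exprn_ge0.
Qed.

Lemma exprn_small (q : R) : 0 <= q < 1 -> forall e, 0 < e -> exists N, forall n, (N <= n)%N -> q ^+ n < e.
Proof.
move=> /andP[q0 q1] e e0.
have : (fun n => q ^+ n) @ \oo --> (0 : R) by apply: cvg_expr; rewrite ger0_norm.
move/cvgrPdist_lt => /(_ e e0) [N _ h]; exists N => n Nn.
by have := h n Nn; rewrite sub0r normrN ger0_norm // exprn_ge0.
Qed.
End ComplexModulus.

Section EpsilonDelta.
Variable R : realType.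
Local Notation C := R[i].
Implicit Types (x y z L M : C) (f g : C -> C).

(** The norm of [C] is [C]-valued; a real radius keeps the estimates below in the ordered field
    [R]. *)
Definition cnear z (P : C -> Prop) := exists d : R, 0 < d /\ forall y, cabs (y - z) < d -> P y.

Lemma cnear_and z (P Q : C -> Prop) : cnear z P -> cnear z Q -> cnear z (fun y => P y /\ Q y).
Proof.
move=> [d [d0 hd]] [e [e0 he]]; exists (Num.min d e); split; first by rewrite lt_min d0.
by move=> y; rewrite lt_min => /andP[h1 h2]; split; [exact: hd|exact: he].
Qed.

Lemma cnear_mono z (P Q : C -> Prop) : (forall y, P y -> Q y) -> cnear z P -> cnear z Q.
Proof. by move=> PQ [d [d0 hd]]; exists d; split=> // y /hd /PQ. Qed.

Lemma cnear_self z (P : C -> Prop) : cnear z P -> P z.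
Proof. by move=> [d [d0]]; apply; rewrite subrr cabs0. Qed.

Lemma cnear_ball z (d : R) : 0 < d -> cnear z (fun y => cabs (y - z) < d).
Proof. by move=> d0; exists d. Qed.

Lemma cnear_lt z (r : R) : cabs z < r -> cnear z (fun y => cabs y < r).
Proof.
move=> h; exists (r - cabs z); split; first by rewrite subr_gt0.
move=> y hy; have := cabsD (y - z) z; rewrite subrK; lra.
Qed.

Lemma cnear_gt z (r : R) : r < cabs z -> cnear z (fun y => r < cabs y).
Proof.
move=> h; exists (cabs z - r); split; first by rewrite subr_gt0.
move=> y; rewrite cabsB => hy; have := cabsD (z - y) y; rewrite subrK; lra.
Qed.

Lemma nbhs_cnear z (A : set C) : nbhs z A <-> cnear z A.
Proof.
split=> [/nbhs_normP [e /= e0 h]|[d [d0 h]]].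
  have eE : e = (complex.Re e)%:C by rewrite RRe_real // gtr0_real.
  exists (complex.Re e); split; first by rewrite -ltcR -eE.
  by move=> y hy; apply: h; rewrite /ball_ /= normC_cabs cabsB eE ltcR.
apply/nbhs_normP; exists d%:C => /=; first by rewrite ltcR.
by move=> y; rewrite /ball_ /= normC_cabs cabsB ltcR => /h.
Qed.

Definition ccont f z := forall e : R, 0 < e -> cnear z (fun y => cabs (f y - f z) < e).

(** Little-o form instead of a quotient: [y = z] needs no exception, and the bound is non-strict
    because both sides vanish there. *)
Definition cderiv f z L := forall e : R, 0 < e ->
  cnear z (fun y => cabs (f y - f z - L * (y - z)) <= e * cabs (y - z)).

Lemma cderiv_cont f z L : cderiv f z L -> ccont f z.
Proof.
move=> df e e0.
have k0 : 0 < 1 + cabs L by rewrite ltr_pwDl // cabs_ge0.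
have := cnear_and (df 1 ltr01) (cnear_ball z (divr_gt0 e0 k0)).
apply: cnear_mono => y [h1 h2].
have -> : f y - f z = (f y - f z - L * (y - z)) + L * (y - z) by ring.
apply: (le_lt_trans (cabsD _ _)); rewrite cabsM.
apply: (@le_lt_trans _ _ ((1 + cabs L) * cabs (y - z))); first by rewrite mulrDl lerD2r.
by rewrite mulrC -ltr_pdivlMr.
Qed.

Lemma cderiv_cst (c : C) z : cderiv (fun=> c) z 0.
Proof. by move=> e e0; exists 1; split=> // y _; rewrite subrr mul0r subr0 cabs0 mulr_ge0 ?cabs_ge0 ?ltW. Qed.

Lemma cderiv_id z : cderiv (fun y => y) z 1.
Proof. by move=> e e0; exists 1; split=> // y _; rewrite mul1r subrr cabs0 mulr_ge0 ?cabs_ge0 ?ltW. Qed.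

Lemma cderivD f g z L M : cderiv f z L -> cderiv g z M -> cderiv (fun y => f y + g y) z (L + M).
Proof.
move=> df dg e e0; have e2 : 0 < e / 2 by rewrite divr_gt0.
apply: cnear_mono (cnear_and (df _ e2) (dg _ e2)) => y [h1 h2].
have -> : f y + g y - (f z + g z) - (L + M) * (y - z)
  = (f y - f z - L * (y - z)) + (g y - g z - M * (y - z)) by ring.
apply: (le_trans (cabsD _ _)); have := lerD h1 h2; rewrite -mulrDl; congr (_ <= _ * _); lra.
Qed.

Lemma cderivM f g z L M : cderiv f z L -> cderiv g z M ->
  cderiv (fun y => f y * g y) z (L * g z + f z * M).
Proof.
move=> df dg e e0.
pose A := cabs (g z) + 1; pose B := cabs L + 1; pose D := cabs (f z) + 1.
have A0 : 0 < A by rewrite ltr_wpDl // cabs_ge0.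
have B0 : 0 < B by rewrite ltr_wpDl // cabs_ge0.
have D0 : 0 < D by rewrite ltr_wpDl // cabs_ge0.
have e3 : 0 < e / 3 by rewrite divr_gt0.
have h := cnear_and (cnear_and (df _ (divr_gt0 e3 A0)) (dg _ (divr_gt0 e3 D0)))
  (cnear_and (cderiv_cont dg (divr_gt0 e3 B0)) (cderiv_cont dg ltr01)).
apply: cnear_mono h => y [[h1 h2] [h3 h4]].
have -> : f y * g y - f z * g z - (L * g z + f z * M) * (y - z)
  = (f y - f z - L * (y - z)) * g y + L * (g y - g z) * (y - z) + f z * (g y - g z - M * (y - z)) by ring.
apply: (le_trans (cabsD3 _ _ _)); rewrite !cabsM.
set t := cabs (y - z) in h1 h2 *; have t0 : 0 <= t := cabs_ge0 _.
have gy : cabs (g y) <= A by have := cabsD (g y - g z) (g z); rewrite subrK /A; lra.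
have k1 : cabs (f y - f z - L * (y - z)) * cabs (g y) <= e / 3 * t.
  apply: (le_trans (ler_pM (cabs_ge0 _) (cabs_ge0 _) h1 gy)).
  by rewrite mulrAC divfK // gt_eqF.
have k2 : cabs L * cabs (g y - g z) * t <= e / 3 * t.
  apply: ler_wpM2r => //.
  apply: (@le_trans _ _ (B * (e / 3 / B))); last by rewrite mulrC divfK // gt_eqF.
  by apply: ler_pM; rewrite ?cabs_ge0 ?ltW // ltr_pwDr.
have k3 : cabs (f z) * cabs (g y - g z - M * (y - z)) <= e / 3 * t.
  apply: (@le_trans _ _ (D * (e / 3 / D * t))); last by rewrite mulrA (mulrC D) divfK // gt_eqF.
  by apply: ler_pM; rewrite ?cabs_ge0 // ltW // ltr_pwDr.
have -> : e * t = e / 3 * t + e / 3 * t + e / 3 * t by field.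
by rewrite !lerD.
Qed.

Lemma cderiv_comp f g z L M : cderiv g z L -> cderiv f (g z) M -> cderiv (fun y => f (g y)) z (M * L).
Proof.
move=> dg df e e0.
pose B := cabs L + 1; pose D := cabs M + 1.
have B0 : 0 < B by rewrite ltr_wpDl // cabs_ge0.
have D0 : 0 < D by rewrite ltr_wpDl // cabs_ge0.
have e2 : 0 < e / 2 by rewrite divr_gt0.
have [d [d0 hd]] := df _ (divr_gt0 e2 B0).
have h := cnear_and (cnear_and (dg _ (divr_gt0 e2 D0)) (dg _ ltr01)) (cderiv_cont dg d0).
apply: cnear_mono h => y [[h1 h2] /hd h3].
have -> : f (g y) - f (g z) - M * L * (y - z)
  = (f (g y) - f (g z) - M * (g y - g z)) + M * (g y - g z - L * (y - z)) by ring.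
apply: (le_trans (cabsD _ _)); rewrite cabsM.
set t := cabs (y - z) in h1 h2 *; have t0 : 0 <= t := cabs_ge0 _.
have hg : cabs (g y - g z) <= B * t.
  have -> : g y - g z = (g y - g z - L * (y - z)) + L * (y - z) by ring.
  by apply: (le_trans (cabsD _ _)); rewrite cabsM mulrDl addrC lerD2l.
have k1 : e / 2 / B * cabs (g y - g z) <= e / 2 * t.
  apply: (@le_trans _ _ (e / 2 / B * (B * t))).
    by apply: ler_wpM2l => //; rewrite ltW // divr_gt0.
  by rewrite mulrA divfK // gt_eqF.
have k2 : cabs M * cabs (g y - g z - L * (y - z)) <= e / 2 * t.
  apply: (@le_trans _ _ (D * (e / 2 / D * t))); last by rewrite mulrA (mulrC D) divfK // gt_eqF.
  by apply: ler_pM; rewrite ?cabs_ge0 // ltW // ltr_pwDr.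
have -> : e * t = e / 2 * t + e / 2 * t by field.
by rewrite lerD // (le_trans h3).
Qed.

Lemma cderiv_inv z : z != 0 -> cderiv (fun y => y^-1) z (- (z^-1 ^+ 2)).
Proof.
move=> z0 e e0; have m0 : 0 < cabs z by rewrite cabs_gt0.
have hh : cabs z / 2 < cabs z by lra.
have e1 : 0 < e * cabs z ^+ 3 / 2 by rewrite divr_gt0 // mulr_gt0 // exprn_gt0.
apply: cnear_mono (cnear_and (cnear_ball z e1) (cnear_gt hh)) => y [h1 h2].
have my : 0 < cabs y by lra.
have y0 : y != 0 by rewrite -cabs_gt0.
have -> : y^-1 - z^-1 - - (z^-1 ^+ 2) * (y - z) = (y - z) * ((y - z) * (z^-1 ^+ 2 * y^-1)).
  by field; rewrite y0 z0.
rewrite mulrC cabsM; apply: ler_wpM2r; first exact: cabs_ge0.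
rewrite cabsM (cabsM (_ ^+ _)) cabsX !cabsV.
apply: (@le_trans _ _ (e * cabs z ^+ 3 / 2 * ((cabs z)^-1 ^+ 2 * (cabs z / 2)^-1))).
  have v0 : 0 <= (cabs z)^-1 ^+ 2 by rewrite exprn_ge0 // invr_ge0 cabs_ge0.
  apply: ler_pM; [exact: cabs_ge0| |exact: ltW|]; first by rewrite mulr_ge0 // invr_ge0 cabs_ge0.
  by apply: ler_wpM2l => //; rewrite lef_pV2 ?posrE ?divr_gt0 // ltW.
have nz : cabs z != 0 by rewrite gt_eqF.
by apply: eq_ler; field.
Qed.

Lemma cderiv_near f g z L : cnear z (fun y => f y = g y) -> cderiv f z L -> cderiv g z L.
Proof.
move=> fg df e e0; have fz := cnear_self fg.
by apply: cnear_mono (cnear_and fg (df e e0)) => y [<-]; rewrite fz.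
Qed.

Lemma cderiv_ext f g z L : f =1 g -> cderiv f z L -> cderiv g z L.
Proof. by move=> fg; apply: cderiv_near; exists 1; split. Qed.

Lemma cderivZ (c : C) f z L : cderiv f z L -> cderiv (fun y => c * f y) z (c * L).
Proof. by move=> df; have := cderivM (cderiv_cst c z) df; rewrite mul0r add0r. Qed.

Lemma cderivB f g z L M : cderiv f z L -> cderiv g z M -> cderiv (fun y => f y - g y) z (L - M).
Proof.
move=> df dg; have := cderivD df (cderivZ (-1) dg); rewrite mulN1r.
by apply: cderiv_ext => y; rewrite mulN1r.
Qed.

Lemma cderiv_div f g z L M : cderiv f z L -> cderiv g z M -> g z != 0 ->
  cderiv (fun y => f y / g y) z ((L * g z - f z * M) / g z ^+ 2).
Proof.
move=> df dg g0; have := cderivM df (cderiv_comp dg (cderiv_inv g0)).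
congr (cderiv _ _ _); field; exact: g0.
Qed.

Lemma cderiv_prod (I : Type) (r : seq I) (F : I -> C -> C) z :
  (forall i, exists L, cderiv (F i) z L) -> exists M, cderiv (fun y => \prod_(i <- r) F i y) z M.
Proof.
move=> dF; elim: r => [|i r [M IH]].
  by exists 0; apply: cderiv_ext (cderiv_cst 1 z) => y; rewrite big_nil.
have [L dL] := dF i; eexists; apply: cderiv_ext (cderivM dL IH) => y.
by rewrite big_cons.
Qed.

Lemma cvg_quotient_cderiv f z L :
  (h^-1 *: (f (h + z) - f z) @[h --> 0^'] --> L) <-> cderiv f z L.
Proof.
split=> [/cvgrPdist_lt H e e0|H].
  have := H e%:C; rewrite ltcR => /(_ e0); rewrite near_withinE => /nbhs_cnear [d [d0 hd]].
  exists d; split=> // y hy; have [->|yz] := eqVneq y z.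
    by rewrite !subrr mulr0 subr0 cabs0 mulr0.
  have yz' : y - z != 0 by rewrite subr_eq0.
  have := hd (y - z); rewrite subr0 => /(_ hy yz').
  rewrite subrK normC_cabs ltcR => h.
  have -> : f y - f z - L * (y - z) = - ((L - (y - z)^-1 * (f y - f z)) * (y - z)) by field.
  by rewrite cabsN cabsM ler_wpM2r ?cabs_ge0 // ltW.
apply/cvgrPdist_lt => e e0.
have eE : e = (complex.Re e)%:C by rewrite RRe_real // gtr0_real.
have r0 : 0 < complex.Re e by rewrite -ltcR -eE.
have e2 : 0 < complex.Re e / 2 by rewrite divr_gt0.
have [d [d0 hd]] := H _ e2.
rewrite near_withinE; apply/nbhs_cnear; exists d; split=> // h; rewrite subr0 => hh h0.
rewrite normC_cabs eE ltcR.
have := hd (h + z); rewrite addrK => /(_ hh) k.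
have hp : 0 < cabs h by rewrite cabs_gt0.
have -> : L - h^-1 *: (f (h + z) - f z) = - (h^-1 * (f (h + z) - f z - L * h)).
  by rewrite /GRing.scale /=; field.
rewrite cabsN cabsM cabsV mulrC ltr_pdivrMr //; apply: (le_lt_trans k).
by rewrite ltr_pM2r //; lra.
Qed.

Lemma derivable_cderiv f z : derivable f z 1 <-> exists L, cderiv f z L.
Proof.
rewrite /derivable; have -> : (fun h : C => h^-1 *: ((f \o shift z) (h *: 1) - f z))
  = (fun h : C => h^-1 *: (f (h + z) - f z)).
  by apply/funext => h /=; rewrite /GRing.scale /= mulr1.
split=> [/cvg_ex [L /cvg_quotient_cderiv hL]|[L /cvg_quotient_cderiv hL]]; first by exists L.
by apply/cvg_ex; exists L.
Qed.

Lemma derive1_cderiv f z L : cderiv f z L -> derive1 f z = L.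
Proof. by move/cvg_quotient_cderiv => h; apply: cvg_lim. Qed.

Lemma within_continuousP (A : set C) f : {within A, continuous f} <->
  forall z, A z -> forall e : R, 0 < e -> cnear z (fun y => A y -> cabs (f y - f z) < e).
Proof.
split=> [/subspace_continuousP H z Az e e0|H].
  have /cvgrPdist_lt/(_ e%:C) := H z Az; rewrite ltcR => /(_ e0).
  rewrite near_withinE => /nbhs_cnear; apply: cnear_mono => y h Ay.
  by have := h Ay; rewrite normC_cabs ltcR cabsB.
apply/subspace_continuousP => z Az; apply/cvgrPdist_lt => e e0.
have eE : e = (complex.Re e)%:C by rewrite RRe_real // gtr0_real.
have r0 : 0 < complex.Re e by rewrite -ltcR -eE.
rewrite near_withinE; apply/nbhs_cnear; apply: cnear_mono (H z Az _ r0) => y h Ay.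
by rewrite normC_cabs eE ltcR cabsB; exact: h.
Qed.

Lemma disc_algP f : disc_alg f <->
  [/\ forall z, cabs z < 1 -> exists L, cderiv f z L,
      forall z, cabs z <= 1 -> forall e : R, 0 < e -> cnear z (fun y => cabs y <= 1 -> cabs (f y - f z) < e)
    & forall z, 1 < cabs z -> f z = 0].
Proof.
split=> [[h1 [/within_continuousP h2 h3]]|[h1 h2 h3]].
  split=> // [z hz|z hz]; first by apply/derivable_cderiv; exact: h1.
  by apply: h3; rewrite /cD /= => h; move: (lt_le_trans hz h); rewrite ltxx.
split=> [z hz|]; first by apply/derivable_cderiv; exact: h1.
split; first by apply/within_continuousP.
by move=> z hz; apply: h3; rewrite ltNge; apply/negP.
Qed.
End EpsilonDelta.

(** * Compactness by bisection *)

Section Cousin.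
Variable R : realType.

(** Cousin's lemma in the plane: if the property failed, repeated quartering would give nested
    failing rectangles shrinking to a point, against the local hypothesis there. It replaces finite
    subcovers in later uniformity arguments. *)
Lemma rect_bisection (P : R -> R -> R -> R -> Prop) (a b c d : R) :
  a <= b -> c <= d ->
  (forall a b c d, a <= b -> c <= d ->
     P a ((a + b) / 2) c ((c + d) / 2) -> P a ((a + b) / 2) ((c + d) / 2) d ->
     P ((a + b) / 2) b c ((c + d) / 2) -> P ((a + b) / 2) b ((c + d) / 2) d -> P a b c d) ->
  (forall x y, a <= x <= b -> c <= y <= d -> exists e : R, 0 < e /\
     forall a' b' c' d', a <= a' -> b' <= b -> c <= c' -> d' <= d ->
       a' <= x <= b' -> c' <= y <= d' ->
       b' - a' < e -> d' - c' < e -> P a' b' c' d') ->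
  P a b c d.
Proof.
move=> ab cd glue loc; apply: contrapT => nP.
pose bad (q : R * R * R * R) := let: (a1, b1, c1, d1) := q in ~ P a1 b1 c1 d1.
pose sub (q q' : R * R * R * R) := let: (a1, b1, c1, d1) := q in let: (a2, b2, c2, d2) := q' in
  [/\ a1 <= a2 <= b2 /\ b2 <= b1, c1 <= c2 <= d2 /\ d2 <= d1, b2 - a2 = (b1 - a1) / 2 & d2 - c2 = (d1 - c1) / 2].
pose wf (q : R * R * R * R) := let: (a1, b1, c1, d1) := q in a1 <= b1 /\ c1 <= d1.
(* The premises [bad q] and [wf q] sit inside the existential so that [choice] yields a total
   successor function. *)
have step q : exists q', bad q -> wf q -> [/\ bad q', wf q' & sub q q'].
  have [[bq wq]|h] := pselect (bad q /\ wf q); last first.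
    by exists q => b1 w1; exfalso; apply: h.
  case: q bq wq => [[[a1 b1] c1] d1] /= bq [h1 h2].
  apply: contrapT => H; apply: bq; apply: glue => //; apply: contrapT => nq; apply: H.
  - by exists (a1, (a1 + b1) / 2, c1, (c1 + d1) / 2) => _ _; split=> //=; split; try lra; split; lra.
  - by exists (a1, (a1 + b1) / 2, (c1 + d1) / 2, d1) => _ _; split=> //=; split; try lra; split; lra.
  - by exists ((a1 + b1) / 2, b1, c1, (c1 + d1) / 2) => _ _; split=> //=; split; try lra; split; lra.
  - by exists ((a1 + b1) / 2, b1, (c1 + d1) / 2, d1) => _ _; split=> //=; split; try lra; split; lra.
have [nx hnx] := choice step.
pose q n := iter n nx (a, b, c, d).
have qP n : bad (q n) /\ wf (q n).
  elim: n => [|n [IH1 IH2]]; first by [].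
  by rewrite /q iterS -/(q n); have [] := hnx _ IH1 IH2.
have qS n : sub (q n) (q n.+1).
  by rewrite /q iterS -/(q n); have [b1 w1] := qP n; have [] := hnx _ b1 w1.
pose A n := (q n).1.1.1; pose B n := (q n).1.1.2; pose G n := (q n).1.2; pose D n := (q n).2.
have qE n : q n = (A n, B n, G n, D n) by rewrite /A /B /G /D; case: (q n) => [[[]]].
have S n : [/\ A n <= A n.+1 <= B n.+1 /\ B n.+1 <= B n,
   G n <= G n.+1 <= D n.+1 /\ D n.+1 <= D n, B n.+1 - A n.+1 = (B n - A n) / 2 & D n.+1 - G n.+1 = (D n - G n) / 2].
  by have := qS n; rewrite !qE.
have W n : A n <= B n /\ G n <= D n by have [_] := qP n; rewrite qE.
have mon (u v : nat -> R) : (forall n, u n <= u n.+1 /\ v n.+1 <= v n) -> (forall n, u n <= v n) ->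
   exists x, forall n, u n <= x <= v n.
  move=> h1 h2.
  have um m n : (m <= n)%N -> u m <= u n.
    by move=> /subnK <-; elim: (n - m)%N => // k IH; rewrite addSn; apply: (le_trans IH); case: (h1 (k + m)%N).
  have vm m n : (m <= n)%N -> v n <= v m.
    by move=> /subnK <-; elim: (n - m)%N => // k IH; rewrite addSn; apply: (le_trans _ IH); case: (h1 (k + m)%N).
  have uv m n : u m <= v n.
    have /orP [h|h] := leq_total m n; first by apply: (le_trans (um _ _ h)).
    by apply: (le_trans (h2 m)); exact: vm.
  exists (sup (range u)) => n; apply/andP; split.
    apply: sup_ubound; last by exists n.
    by exists (v 0%N) => _ [m _ <-].
  by apply: ge_sup; [exists (u 0%N); exists 0%N | move=> _ [m _ <-]].
have [x hx] := mon A B (fun n => let: And4 (conj h1 h2) _ _ _ := S n in conj (andP h1).1 h2) (fun n => (W n).1).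
have [y hy] := mon G D (fun n => let: And4 _ (conj h1 h2) _ _ := S n in conj (andP h1).1 h2) (fun n => (W n).2).
have [e [e0 he]] := loc x y (hx 0%N) (hy 0%N).
have szB n : B n - A n = (b - a) * 2^-1 ^+ n.
  elim: n => [|n IH]; first by rewrite expr0 mulr1.
  by have [_ _ -> _] := S n; rewrite IH exprS; lra.
have szD n : D n - G n = (d - c) * 2^-1 ^+ n.
  elim: n => [|n IH]; first by rewrite expr0 mulr1.
  by have [_ _ _ ->] := S n; rewrite IH exprS; lra.
have bnd n : [/\ a <= A n, B n <= b, c <= G n & D n <= d].
  elim: n => [|n [i1 i2 i3 i4]]; first by split.
  have [[/andP[j1 j2] j3] [/andP[k1 k2] k3] _ _] := S n.
  by split; [apply: le_trans j1|apply: le_trans i2|apply: le_trans k1|apply: le_trans i4].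
have small (m : R) : 0 <= m -> exists N, m * 2^-1 ^+ N < e /\ forall n, (N <= n)%N -> m * 2^-1 ^+ n < e.
  move=> m0; have m1 : 0 < m + 1 by rewrite ltr_wpDl.
  have q1 : 0 <= (2^-1 : R) < 1 by lra.
  have [N hN] := exprn_small q1 (divr_gt0 e0 m1).
  have key n : (N <= n)%N -> m * 2^-1 ^+ n < e.
    move=> /hN h; apply: (@le_lt_trans _ _ ((m + 1) * 2^-1 ^+ n)).
      by apply: ler_wpM2r; rewrite ?exprn_ge0 // lerDl.
    by rewrite mulrC -ltr_pdivlMr.
  by exists N; split=> //; apply: key.
have ba : 0 <= b - a by rewrite subr_ge0.
have dc : 0 <= d - c by rewrite subr_ge0.
have [N1 [_ h1]] := small _ ba; have [N2 [_ h2]] := small _ dc.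
pose n := maxn N1 N2.
have [bq _] := qP n; move: bq; rewrite qE /=; apply.
have [i1 i2 i3 i4] := bnd n.
by apply: he; rewrite ?hx ?hy // ?szB ?szD; [apply: h1; exact: leq_maxl|apply: h2; exact: leq_maxr].
Qed.

Lemma itv_bisection (P : R -> R -> Prop) (a b : R) :
  a <= b ->
  (forall a b, a <= b -> P a ((a + b) / 2) -> P ((a + b) / 2) b -> P a b) ->
  (forall x, a <= x <= b -> exists e : R, 0 < e /\
     forall a' b', a <= a' -> b' <= b -> a' <= x <= b' -> b' - a' < e -> P a' b') ->
  P a b.
Proof.
move=> ab glue loc.
apply: (@rect_bisection (fun a b _ _ => P a b) a b 0 0) => //.
- by move=> a1 b1 c1 d1 h1 h2 k1 k2 k3 k4; exact: glue.
- by move=> x y hx hy; have [e [e0 he]] := loc x hx; exists e; split=> // *; exact: he.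
Qed.

(** Increments add over the two halves, so a local estimate suffices; a short interval is split at
    its tag [x]. *)
Lemma mean_value_ineq (E : R -> R[i]) (a b M : R) : a <= b ->
  (forall x, a <= x <= b -> forall e : R, 0 < e -> exists d : R, 0 < d /\
     forall y, a <= y <= b -> `|y - x| < d -> cabs (E y - E x) <= (M + e) * `|y - x|) ->
  cabs (E b - E a) <= M * (b - a).
Proof.
move=> ab h; apply/ler_addgt0Pr => e0 e00.
have k0 : 0 < b - a + 1 by rewrite ltr_wpDl // subr_ge0.
pose e := e0 / (b - a + 1); have ep : 0 < e by rewrite divr_gt0.
suff : cabs (E b - E a) <= (M + e) * (b - a).
  move=> h2; apply: (le_trans h2); rewrite mulrDl lerD2l /e mulrAC ler_pdivrMr // ler_wpM2l ?ltW //.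
  by rewrite ltrDl.
apply: (@itv_bisection (fun a b => cabs (E b - E a) <= (M + e) * (b - a))) => //.
- move=> a1 b1 ab1 h1 h2; apply: (le_trans (cabs_subl _ (E ((a1 + b1) / 2)) _)).
  by have := lerD h2 h1; rewrite -mulrDr; congr (_ <= _ * _); lra.
- move=> x hx; have [d [d0 hd]] := h x hx e ep; exists d; split=> // a1 b1 ha1 hb1 /andP[hx1 hx2] hs.
  apply: (le_trans (cabs_subl _ (E x) _)).
  have k1 : cabs (E b1 - E x) <= (M + e) * (b1 - x).
    have := hd b1; rewrite ger0_norm ?subr_ge0 //; apply; last by lra.
    by rewrite hb1 andbT; case/andP: hx => hx3 _; apply: (le_trans hx3).
  have k2 : cabs (E x - E a1) <= (M + e) * (x - a1).
    rewrite cabsB; have := hd a1; rewrite distrC ger0_norm ?subr_ge0 //; apply; last by lra.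
    by rewrite ha1 /=; case/andP: hx => _; apply: le_trans.
  by have := lerD k1 k2; rewrite -mulrDr; congr (_ <= _ * _); lra.
Qed.
End Cousin.

(** * Goursat and the maximum principle *)

Section Primitives.
Variable R : realType.
Local Notation C := R[i].

(** Increments [G b - G a] of such a primitive stand for line integrals of [g]; at the end points
    the derivative is one-sided. *)
Definition has_prim (g : R -> C) (a b : R) (G : R -> C) :=
  forall x, a <= x <= b -> forall e : R, 0 < e -> exists d : R, 0 < d /\
    forall y, a <= y <= b -> `|y - x| < d -> cabs (G y - G x - g x * (y - x)%:C) <= e * `|y - x|.

Lemma has_prim_sub g G (a b a' b' : R) : a <= a' -> b' <= b -> has_prim g a b G -> has_prim g a' b' G.
Proof.
move=> aa bb h x /andP[x1 x2] e e0.
have hx : a <= x <= b by rewrite (le_trans aa) // (le_trans x2).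
have [d [d0 hd]] := h x hx e e0; exists d; split=> // y /andP[y1 y2]; apply: hd.
by rewrite (le_trans aa) // (le_trans y2).
Qed.

Lemma has_primB g G p P (a b : R) : has_prim g a b G -> has_prim p a b P ->
  has_prim (fun x => g x - p x) a b (fun x => G x - P x).
Proof.
move=> h1 h2 x hx e e0; have e2 : 0 < e / 2 by rewrite divr_gt0.
have [d1 [d10 hd1]] := h1 x hx _ e2; have [d2 [d20 hd2]] := h2 x hx _ e2.
exists (Num.min d1 d2); split; first by rewrite lt_min d10.
move=> y hy; rewrite lt_min => /andP[k1 k2].
have -> : G y - P y - (G x - P x) - (g x - p x) * (y - x)%:C
  = (G y - G x - g x * (y - x)%:C) - (P y - P x - p x * (y - x)%:C) by ring.
apply: (le_trans (cabsD _ _)); rewrite cabsN.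
by have := lerD (hd1 y hy k1) (hd2 y hy k2); rewrite -mulrDl; congr (_ <= _ * _); lra.
Qed.

Lemma has_prim_le g G (a b M : R) : a <= b -> has_prim g a b G ->
  (forall x, a <= x <= b -> cabs (g x) <= M) -> cabs (G b - G a) <= M * (b - a).
Proof.
move=> ab h hM; apply: mean_value_ineq => // x hx e e0.
have [d [d0 hd]] := h x hx e e0; exists d; split=> // y hy yx.
have -> : G y - G x = (G y - G x - g x * (y - x)%:C) + g x * (y - x)%:C by ring.
apply: (le_trans (cabsD _ _)); rewrite cabsM cabs_real mulrDl addrC.
by rewrite lerD ?hd // ler_wpM2r ?hM.
Qed.

Lemma has_prim_dist g G p P (a b M : R) : a <= b -> has_prim g a b G -> has_prim p a b P ->
  (forall x, a <= x <= b -> cabs (g x - p x) <= M) ->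
  cabs ((G b - G a) - (P b - P a)) <= M * (b - a).
Proof.
move=> ab h1 h2 hM; have := has_prim_le ab (has_primB h1 h2) hM.
by congr (cabs _ <= _); ring.
Qed.

Lemma cderiv_prim_h (F : C -> C) (D : C -> C) (y a b : R) :
  (forall x, a <= x <= b -> cderiv F (x +i* y) (D (x +i* y))) ->
  has_prim (fun x => D (x +i* y)) a b (fun x => F (x +i* y)).
Proof.
move=> dF x hx e e0; have [d [d0 hd]] := dF x hx e e0; exists d; split=> // t ht tx.
have E : t +i* y - x +i* y = (t - x)%:C by apply/eqP; rewrite eq_complex /= subrr !eqxx.
by have := hd (t +i* y); rewrite E cabs_real => /(_ tx).
Qed.

(** Moving [y] multiplies the complex derivative by ['i], and the square of ['i] gives the sign. *)
Lemma cderiv_prim_v (F : C -> C) (D : C -> C) (x a b : R) :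
  (forall y, a <= y <= b -> cderiv F (x +i* y) ('i * D (x +i* y))) ->
  has_prim (fun y => - D (x +i* y)) a b (fun y => F (x +i* y)).
Proof.
move=> dF y hy e e0; have [d [d0 hd]] := dF y hy e e0; exists d; split=> // t ht tx.
have E : x +i* t - x +i* y = 'i * (t - y)%:C.
  by csplit; ring.
have := hd (x +i* t); rewrite E cabsM cabs_i normr1 mul1r cabs_real => /(_ tx).
congr (cabs _ <= _); have i2 : 'i * 'i = -1 :> C by rewrite -expr2 sqr_i.
rewrite mulrACA i2; ring.
Qed.

Lemma is_derive_eps (f : R -> R) (x l : R) : is_derive x 1 f l ->
  forall e : R, 0 < e -> exists d : R, 0 < d /\
    forall y, `|y - x| < d -> `|f y - f x - l * (y - x)| <= e * `|y - x|.
Proof.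
move=> [D E] e e0.
have : (h^-1 *: ((f \o shift x) (h *: 1) - f x) @[h --> 0^'] --> l) by rewrite -E; exact: D.
move/cvgrPdist_lt => /(_ e e0); rewrite near_withinE => /nbhs_normP [d /= d0 hd].
exists d; split=> // y hy; have [->|yx] := eqVneq y x.
  by rewrite !subrr mulr0 subr0 normr0 mulr0.
have yx' : y - x != 0 by rewrite subr_eq0.
have := hd (y - x); rewrite /ball_ /= sub0r normrN => /(_ hy yx').
rewrite /GRing.scale /= mulr1 subrK => h.
have -> : f y - f x - l * (y - x) = - ((l - (y - x)^-1 * (f y - f x)) * (y - x)) by field.
by rewrite normrN normrM ler_wpM2r // ltW.
Qed.

Lemma eps_continuous (f : R -> R) (x : R) :
  (forall e : R, 0 < e -> exists d : R, 0 < d /\ forall y, `|y - x| < d -> `|f y - f x| < e) ->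
  {for x, continuous f}.
Proof.
move=> h; apply/cvgrPdist_lt => e e0; have [d [d0 hd]] := h e e0.
apply/nbhs_normP; exists d => // y; rewrite /ball_ /= distrC => /hd.
by rewrite distrC.
Qed.

Lemma continuous_eps (f : R -> R) (x : R) : {for x, continuous f} ->
  forall e : R, 0 < e -> exists d : R, 0 < d /\ forall y, `|y - x| < d -> `|f y - f x| < e.
Proof.
move=> /cvgrPdist_lt h e e0; have /nbhs_normP [d /= d0 hd] := h e e0.
by exists d; split=> // y hy; rewrite distrC; apply: hd; rewrite /ball_ /= distrC.
Qed.

Lemma ex_real_prim (g : R -> R) (a b : R) : a <= b ->
  (forall x, a <= x <= b -> forall e : R, 0 < e -> exists d : R, 0 < d /\
     forall y, a <= y <= b -> `|y - x| < d -> `|g y - g x| < e) ->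
  exists G : R -> R, forall x, a <= x <= b -> is_derive x 1 G (g x).
Proof.
(* Clamping to [[a, b]] extends [g] continuously to the whole line. *)
move=> ab cg; pose cl x : R := Num.max a (Num.min x b).
have clab x : a <= cl x <= b by rewrite /cl le_max lexx ge_max ab ge_min lexx orbT.
have clip x y : `|cl y - cl x| <= `|y - x|.
  have E t : [\/ t <= a /\ cl t = a, (a <= t) && (t <= b) /\ cl t = t | b <= t /\ cl t = b].
    rewrite /cl; case: (leP t b) => h1; last by rewrite (max_idPr ab); constructor 3; split=> //; exact: ltW.
    by case: (leP a t) => h2; [constructor 2|constructor 1; split=> //; exact: ltW].
  wlog xy : x y / x <= y => [H|].
    by have /orP[h|h] := le_total x y; [exact: H|rewrite distrC (distrC y); exact: H].
  rewrite [leRHS]ger0_norm ?subr_ge0 // ler_norml.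
  by case: (E x) => -[h1 ->]; case: (E y) => -[h2 ->]; lra.
have cc : continuous (g \o cl).
  move=> x; apply: eps_continuous => e e0; have [d [d0 hd]] := cg _ (clab x) e e0.
  by exists d; split=> // y hy; apply: hd => //; apply: le_lt_trans hy.
(* The integral starts at [a - 1], so that [x = a] is an interior point and the derivative there is
   two-sided. *)
pose G x := (\int[lebesgue_measure]_(t in `[a - 1, x]) (g \o cl) t)%R.
exists G => x /andP[x1 x2].
have int : lebesgue_measure.-integrable `[a - 1, b + 1] (EFin \o (g \o cl)).
  apply: continuous_compact_integrable; first exact: segment_compact.
  exact: continuous_subspaceT.
have xb : x < b + 1 by lra.
have ax : a - 1 < x by lra.
have [D E] := continuous_FTC1_closed xb int ax (cc x).
have clx : cl x = x by rewrite /cl (min_idPl x2) (max_idPr x1).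
split; first exact: D.
by rewrite -derive1E E /= clx.
Qed.

Lemma ex_prim (g : R -> C) (a b : R) : a <= b ->
  (forall x, a <= x <= b -> forall e : R, 0 < e -> exists d : R, 0 < d /\
     forall y, a <= y <= b -> `|y - x| < d -> cabs (g y - g x) < e) ->
  exists G, has_prim g a b G.
Proof.
move=> ab cg.
have [U hU] : exists U : R -> R, forall x, a <= x <= b -> is_derive x 1 U (complex.Re (g x)).
  apply: ex_real_prim => // x hx e e0; have [d [d0 hd]] := cg x hx e e0.
  exists d; split=> // y hy yx; apply: le_lt_trans (hd y hy yx).
  by apply: le_trans (cabs_Re _); case: (g y) => ? ?; case: (g x).
have [V hV] : exists V : R -> R, forall x, a <= x <= b -> is_derive x 1 V (complex.Im (g x)).
  apply: ex_real_prim => // x hx e e0; have [d [d0 hd]] := cg x hx e e0.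
  exists d; split=> // y hy yx; apply: le_lt_trans (hd y hy yx).
  by apply: le_trans (cabs_Im _); case: (g y) => ? ?; case: (g x).
exists (fun x => U x +i* V x) => x hx e e0; have e2 : 0 < e / 2 by rewrite divr_gt0.
have [d1 [d10 hd1]] := is_derive_eps (hU x hx) e2; have [d2 [d20 hd2]] := is_derive_eps (hV x hx) e2.
exists (Num.min d1 d2); split; first by rewrite lt_min d10.
move=> y hy; rewrite lt_min => /andP[k1 k2].
apply: (le_trans (cabs_leReIm _)).
have := lerD (hd1 y k1) (hd2 y k2); rewrite -mulrDl => h.
have -> : e = e / 2 + e / 2 by field.
apply: le_trans h; apply: eq_ler; case: (g x) => p q /=.
by rewrite !mulr0 subr0 add0r.
Qed.
End Primitives.

Section Goursat.
Variable R : realType.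
Local Notation C := R[i].

(** The counterclockwise contour integral: [Gh y] and [Kv x] are primitives along the horizontal
    line at height [y] and the vertical line at abscissa [x], and [dz = 'i * dy] on the latter. *)
Definition rect_sum (Gh Kv : R -> R -> C) (a b c d : R) : C :=
  (Gh c b - Gh c a) - (Gh d b - Gh d a) + 'i * ((Kv b d - Kv b c) - (Kv a d - Kv a c)).

(** The affine part has the primitive [P], whose boundary increments cancel; only the error [e]
    times the perimeter remains. *)
Lemma goursat_local (phi : C -> C) (Gh Kv : R -> R -> C) (zs p L : C) (a b c d e : R) :
  a <= b -> c <= d -> 0 <= e ->
  (forall y, c <= y <= d -> has_prim (fun x => phi (x +i* y)) a b (Gh y)) ->
  (forall x, a <= x <= b -> has_prim (fun y => phi (x +i* y)) c d (Kv x)) ->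
  (forall x y, a <= x <= b -> c <= y <= d -> cabs (phi (x +i* y) - (p + L * (x +i* y - zs))) <= e) ->
  cabs (rect_sum Gh Kv a b c d) <= e * (2 * ((b - a) + (d - c))).
Proof.
move=> ab cd e0 hG hK hphi.
have aab : a <= a <= b by rewrite lexx.
have bab : a <= b <= b by rewrite lexx ab.
have ccd : c <= c <= d by rewrite lexx.
have dcd : c <= d <= d by rewrite lexx cd.
pose P (z : C) := p * z + L / 2 * ((z - zs) * (z - zs)).
pose D (z : C) := p + L * (z - zs).
have dP z : cderiv P z (D z).
  have h1 := cderivB (cderiv_id z) (cderiv_cst zs z).
  have := cderivD (cderivZ p (cderiv_id z)) (cderivZ (L / 2) (cderivM h1 h1)).
  by congr (cderiv _ _ _); rewrite /D; field.
have hh y : c <= y <= d -> cabs ((Gh y b - Gh y a) - (P (b +i* y) - P (a +i* y))) <= e * (b - a).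
  move=> hy; apply: (has_prim_dist ab (hG y hy) (cderiv_prim_h (D := D) (fun x _ => dP (x +i* y)))) => x hx.
  exact: hphi.
have vv x : a <= x <= b -> cabs ((Kv x d - Kv x c) - ((- 'i * P (x +i* d)) - (- 'i * P (x +i* c)))) <= e * (d - c).
  move=> hx.
  have dQ z : cderiv (fun z => - 'i * P z) z ('i * - D z).
    by have := cderivZ (- 'i) (dP z); congr (cderiv _ _ _); ring.
  have := has_prim_dist cd (hK x hx) (cderiv_prim_v (D := fun z => - D z) (fun y _ => dQ (x +i* y))).
  by apply=> y hy; rewrite opprK; exact: hphi.
have -> : rect_sum Gh Kv a b c d =
   (((Gh c b - Gh c a) - (P (b +i* c) - P (a +i* c))) - ((Gh d b - Gh d a) - (P (b +i* d) - P (a +i* d))))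
   + ('i * ((Kv b d - Kv b c) - ((- 'i * P (b +i* d)) - (- 'i * P (b +i* c)))) -
      'i * ((Kv a d - Kv a c) - ((- 'i * P (a +i* d)) - (- 'i * P (a +i* c))))).
  have i2 : 'i * 'i = -1 :> C by rewrite -expr2 sqr_i.
  have i2' t : 'i * (- 'i * t) = t :> C by rewrite mulrA mulrN i2 opprK mul1r.
  by rewrite /rect_sum !mulrBr !i2'; ring.
apply: (le_trans (cabsD _ _)).
have k1 := hh c ccd; have k2 := hh d dcd; have k3 := vv a aab; have k4 := vv b bab.
have := lerD (lerD k1 k2) (lerD k4 k3).
have i1 (z : C) : cabs ('i * z) = cabs z by rewrite cabsM cabs_i normr1 mul1r.
move=> h; apply: le_trans (_ : _ <= e * (b - a) + e * (b - a) + (e * (d - c) + e * (d - c))) _; last first.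
  by apply: eq_ler; ring.
apply: le_trans h; apply: lerD; apply: (le_trans (cabsD _ _)); rewrite cabsN ?i1 //.
Qed.

(** The bound [4 * e * ((b - a)^2 + (d - c)^2)] is additive under quartering. Locally the error
    [e * s] times the perimeter [2 * s], with [s] half the perimeter, stays below it. *)
Lemma goursat (phi : C -> C) (Gh Kv : R -> R -> C) (a b c d : R) :
  a <= b -> c <= d ->
  (forall x y, a <= x <= b -> c <= y <= d -> exists L, cderiv phi (x +i* y) L) ->
  (forall y, c <= y <= d -> has_prim (fun x => phi (x +i* y)) a b (Gh y)) ->
  (forall x, a <= x <= b -> has_prim (fun y => phi (x +i* y)) c d (Kv x)) ->
  rect_sum Gh Kv a b c d = 0.
Proof.
move=> ab cd dphi hG hK; apply: cabs_eq0; apply/eqP; rewrite eq_le cabs_ge0 andbT.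
apply/ler_addgt0Pl => e0 e00; rewrite addr0.
pose S := (b - a) ^+ 2 + (d - c) ^+ 2; have S0 : 0 <= S by rewrite addr_ge0 // sqr_ge0.
have S1 : 0 < 4 * (S + 1) by rewrite mulr_gt0 // ltr_wpDl.
pose e := e0 / (4 * (S + 1)); have e1 : 0 < e by rewrite divr_gt0.
suff h : cabs (rect_sum Gh Kv a b c d) <= 4 * e * S.
  apply: (le_trans h); rewrite -(@ler_pM2r _ (4 * (S + 1))) // /e.
  have -> : 4 * (e0 / (4 * (S + 1))) * S * (4 * (S + 1)) = e0 * (4 * S) by field; rewrite gt_eqF // ltr_wpDl.
  by apply: ler_wpM2l; rewrite ?ltW //; lra.
pose PP a b c d := cabs (rect_sum Gh Kv a b c d) <= 4 * e * ((b - a) ^+ 2 + (d - c) ^+ 2).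
apply: (@rect_bisection _ PP) => //.
  move=> a1 b1 c1 d1 _ _; rewrite /PP.
  set m := (a1 + b1) / 2; set n := (c1 + d1) / 2 => h1 h2 h3 h4.
  have -> : rect_sum Gh Kv a1 b1 c1 d1 = (rect_sum Gh Kv a1 m c1 n + rect_sum Gh Kv a1 m n d1)
     + (rect_sum Gh Kv m b1 c1 n + rect_sum Gh Kv m b1 n d1) by rewrite /rect_sum; ring.
  apply: (le_trans (cabsD _ _)).
  apply: le_trans (lerD (cabsD _ _) (cabsD _ _)) _.
  apply: le_trans (lerD (lerD h1 h2) (lerD h3 h4)) _.
  by apply: eq_ler; rewrite /m /n; field.
move=> x y hx hy; have [L hL] := dphi x y hx hy; have [dl [dl0 hdl]] := hL e e1.
exists (dl / 2); split; first by rewrite divr_gt0.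
move=> a1 b1 c1 d1 ha hb hc hd /andP[x1 x2] /andP[y1 y2] s1 s2; rewrite /PP.
have ab1 : a1 <= b1 by apply: le_trans x2.
have cd1 : c1 <= d1 by apply: le_trans y2.
set s := (b1 - a1) + (d1 - c1); have s0 : 0 <= s by rewrite addr_ge0 // subr_ge0.
have es : 0 <= e * s by rewrite mulr_ge0 // ltW.
have : cabs (rect_sum Gh Kv a1 b1 c1 d1) <= e * s * (2 * s).
  apply: (@goursat_local phi Gh Kv (x +i* y) (phi (x +i* y)) L) => //.
  - move=> t /andP[t1 t2]; apply: (has_prim_sub ha hb); apply: hG.
    by rewrite (le_trans hc t1) (le_trans t2 hd).
  - move=> t /andP[t1 t2]; apply: (has_prim_sub hc hd); apply: hK.
    by rewrite (le_trans ha t1) (le_trans t2 hb).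
  - move=> t u /andP[t1 t2] /andP[u1 u2].
    have zs : cabs (t +i* u - x +i* y) <= s.
      apply: (le_trans (cabs_leReIm _)) => /=; apply: lerD; rewrite ler_norml; lra.
    have zd : cabs (t +i* u - x +i* y) < dl by apply: (le_lt_trans zs); rewrite /s; lra.
    rewrite opprD addrA; apply: (le_trans (hdl _ zd)).
    by apply: ler_wpM2l => //; exact: ltW.
move=> h; apply: (le_trans h).
have -> : e * s * (2 * s) = 2 * e * s ^+ 2 by ring.
have -> : 4 * e * ((b1 - a1) ^+ 2 + (d1 - c1) ^+ 2) = 2 * e * (2 * ((b1 - a1) ^+ 2 + (d1 - c1) ^+ 2)) by ring.
apply: ler_wpM2l; first by rewrite mulr_ge0 // ltW.
by rewrite /s; have := sqr_ge0 ((b1 - a1) - (d1 - c1)); rewrite sqrrB sqrrD; lra.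
Qed.
End Goursat.

(** * The complex exponential *)

Section ComplexExp.
Variable R : realType.
Local Notation C := R[i].

Definition expi (t : R) : C := cos t +i* sin t.
Definition cexp (z : C) : C := (expR (complex.Re z))%:C * expi (complex.Im z).

Lemma cabs_expi t : cabs (expi t) = 1.
Proof. by rewrite /cabs /expi /= cos2Dsin2 sqrtr1. Qed.

Lemma expiD s t : expi (s + t) = expi s * expi t.
Proof. by apply/eqP; rewrite eq_complex /= cosD sinD !eqxx /= addrC mulrC [X in _ + X]mulrC [X in X + _]mulrC eqxx. Qed.

Lemma expi0 : expi 0 = 1.
Proof. by rewrite /expi cos0 sin0. Qed.

Lemma expi2pi : expi (pi *+ 2) = 1.
Proof. by rewrite /expi cos2pi sin2pi. Qed.

Lemma cexpD z y : cexp (z + y) = cexp z * cexp y.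
Proof.
case: z => a b; case: y => c d; rewrite /cexp /= expRD expiD.
by rewrite (rmorphM (real_complex R)) /= mulrACA.
Qed.

Lemma cexp0 : cexp 0 = 1.
Proof. by rewrite /cexp /= expR0 expi0 mulr1. Qed.

Lemma cabs_cexp z : cabs (cexp z) = expR (complex.Re z).
Proof. by rewrite /cexp cabsM cabs_expi mulr1 cabs_real gtr0_norm // expR_gt0. Qed.

Lemma cderiv_cexp0 : cderiv cexp 0 1.
Proof.
(* The error terms [b1] to [b4] add up to [8 * e1 * m], so [e / 12] leaves room. *)
move=> e e0; have [e1 [e10 e1e e11]] : exists e1 : R, [/\ 0 < e1, e1 <= e / 12 & e1 <= 1].
  by exists (Num.min (e / 12) 1); rewrite lt_min ltr01 divr_gt0 // !ge_min !lexx orbT.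
have [d1 [d10 h1]] := is_derive_eps (is_derive_expR (0 : R)) e10.
have [d2 [d20 h2]] := is_derive_eps (is_derive_cos (0 : R)) e10.
have [d3 [d30 h3]] := is_derive_eps (is_derive_sin (0 : R)) e10.
exists (Num.min (Num.min d1 d2) (Num.min d3 e1)); split; first by rewrite 3!lt_min d10 d20 d30 e10.
move=> [s t]; rewrite !lt_min => /andP[/andP[k1 k2] /andP[k3 k4]].
rewrite subr0 in k1 k2 k3 k4 *; rewrite cexp0 mul1r.
have hs : `|s| <= cabs (s +i* t) := cabs_Re (s +i* t).
have ht : `|t| <= cabs (s +i* t) := cabs_Im (s +i* t).
set m := cabs (s +i* t) in k1 k2 k3 k4 hs ht *.
have := h1 s; rewrite subr0 expR0 mul1r => /(_ (le_lt_trans hs k1)) {}h1.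
have := h2 t; rewrite subr0 cos0 sin0 oppr0 mul0r subr0 => /(_ (le_lt_trans ht k2)) {}h2.
have := h3 t; rewrite subr0 sin0 cos0 mul1r subr0 => /(_ (le_lt_trans ht k3)) {}h3.
have m0 : 0 <= m := cabs_ge0 _.
have em : e1 * `|s| <= e1 * m /\ e1 * `|t| <= e1 * m by split; apply: ler_wpM2l => //; exact: ltW.
have mm : m * m <= e1 * m by apply: ler_wpM2r => //; exact: ltW.
have a1 : `|expR s - 1| <= 2 * m.
  have -> : expR s - 1 = (expR s - 1 - s) + s by ring.
  apply: (le_trans (ler_normD _ _)); have : e1 * m <= m by rewrite ler_piMl.
  lra.
have a2 : `|sin t| <= 2 * m.
  have -> : sin t = (sin t - t) + t by ring.
  apply: (le_trans (ler_normD _ _)); have : e1 * m <= m by rewrite ler_piMl.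
  lra.
have c1 : `|cos t| <= 1 := cos_max _.
apply: (le_trans (cabs_leReIm _)); rewrite /cexp /= !mul0r subr0 addr0.
have -> : expR s * cos t - 1 - s = (expR s - 1 - s) * cos t + (1 + s) * (cos t - 1) by ring.
have -> : expR s * sin t - 0 - t = (expR s - 1) * sin t + (sin t - t) by ring.
have b1 : `|(expR s - 1 - s) * cos t| <= e1 * m.
  rewrite normrM; apply: (@le_trans _ _ (e1 * `|s| * 1)); last by rewrite mulr1; case: em.
  by apply: ler_pM.
have b2 : `|(1 + s) * (cos t - 1)| <= 2 * (e1 * m).
  rewrite normrM; apply: ler_pM => //; last by apply: (le_trans h2); case: em.
  by apply: (le_trans (ler_normD _ _)); rewrite normr1; lra.
have b3 : `|(expR s - 1) * sin t| <= 4 * (e1 * m).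
  rewrite normrM; apply: (@le_trans _ _ ((2 * m) * (2 * m))); first exact: ler_pM.
  by lra.
have b4 : `|sin t - t| <= e1 * m by apply: (le_trans h3); case: em.
apply: (le_trans (lerD (ler_normD _ _) (ler_normD _ _))).
have : e1 * m <= e / 12 * m by exact: ler_wpM2r.
have : 0 <= e * m by rewrite mulr_ge0 // ltW.
lra.
Qed.

Lemma cderiv_cexp z : cderiv cexp z (cexp z).
Proof.
have d1 : cderiv (fun y => y - z) z 1.
  by have := cderivB (cderiv_id z) (cderiv_cst z z); rewrite subr0.
have d2 : cderiv cexp (z - z) 1 by rewrite subrr; exact: cderiv_cexp0.
have := cderivZ (cexp z) (cderiv_comp d1 d2); rewrite !mulr1.
by apply: cderiv_ext => y; rewrite -cexpD addrC subrK.
Qed.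

Lemma cexp_expi (s t : R) : cexp (s +i* t) = (expR s)%:C * expi t.
Proof. by []. Qed.

Lemma expi_cexp (t : R) : expi t = cexp (0 +i* t).
Proof. by rewrite cexp_expi expR0 mul1r. Qed.

Lemma expi_lip (s t : R) : cabs (expi s - expi t) <= `|s - t|.
Proof.
wlog st : s t / t <= s => [H|].
  by have /orP[h|h] := le_total t s; [exact: H|rewrite cabsB distrC; exact: H].
have hp := @cderiv_prim_v R cexp (fun z => - 'i * cexp z) 0 t s.
have := has_prim_le (M := 1) st (hp _).
rewrite -!expi_cexp ger0_norm ?subr_ge0 // mul1r; apply.
  move=> y _; have := cderiv_cexp (0 +i* y); congr (cderiv _ _ _).
  by rewrite mulrA mulrN -expr2 sqr_i opprK mul1r.
by move=> x _; rewrite cabsN cabsM cabsN cabs_i normr1 mul1r cabs_cexp /= expR0.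
Qed.
End ComplexExp.

(** * Maximum principle and derivative estimate *)

Section MaxModulus.
Variable R : realType.
Local Notation C := R[i].
Implicit Types (f : C -> C) (z a : C).

(* The mean of f over the circle of radius e^s does not depend on s: apply Goursat
   to f(e^(s+it)) on [s0,s1] x [0,2pi], where the horizontal sides cancel. *)
Lemma center_le_circle f (r M : R) : 0 < r < 1 ->
  (forall z, 0 < cabs z < 1 -> exists L, cderiv f z L) -> ccont f 0 ->
  (forall t : R, cabs (f (r%:C * expi t)) <= M) -> cabs (f 0) <= M.
Proof.
move=> /andP[r0 r1] df cf hM; apply/ler_addgt0Pr => e e0.
have [dl [dl0 hdl]] := cf e e0.
pose b := ln r.
have eb : expR b = r by rewrite /b lnK.
have b0 : b < 0 by rewrite -expR_lt1 eb.
(* The inner radius [expR a] is below [dl], so that on this circle [f] differs from [f 0] by less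
   than [e]. *)
pose a := Num.min (b - 1) (ln dl - 1).
have ab : a <= b by rewrite /a ge_min; apply/orP; left; lra.
have adl : expR a < dl.
  rewrite -[ltRHS](@lnK R) ?posrE // ltr_expR.
  by rewrite /a gt_min; apply/orP; right; lra.
have p0 : (0 : R) <= pi *+ 2 by rewrite mulrn_wge0 // ltW // pi_gt0.
pose phi z := f (cexp z).
have dphi x y : x <= b -> exists L, cderiv phi (x +i* y) L.
  move=> xb.
  have c1 : 0 < cabs (cexp (x +i* y)) < 1.
    by rewrite cabs_cexp /= expR_gt0 expR_lt1 (le_lt_trans xb).
  have [L hL] := df _ c1; exists (L * cexp (x +i* y)).
  exact: cderiv_comp (cderiv_cexp _) hL.
have cphi x y : x <= b -> ccont phi (x +i* y).
  by move=> xb; have [L hL] := dphi x y xb; exact: cderiv_cont hL.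
have exG y : exists G, has_prim (fun x => phi (x +i* y)) a b G.
  apply: ex_prim => // x /andP[_ xb] e1 e10; have [d [d0 hd]] := cphi x y xb e1 e10.
  exists d; split=> // t _ tx; apply: hd.
  have -> : t +i* y - x +i* y = (t - x)%:C by csplit; ring.
  by rewrite cabs_real.
have exK x : exists K, x <= b -> has_prim (fun y => phi (x +i* y)) 0 (pi *+ 2) K.
  have [xb|xb] := leP x b; last by exists (fun=> 0).
  have [K hK] : exists K, has_prim (fun y => phi (x +i* y)) 0 (pi *+ 2) K; last by exists K.
  apply: ex_prim => // y _ e1 e10; have [d [d0 hd]] := cphi x y xb e1 e10.
  exists d; split=> // t _ tx; apply: hd.
  have -> : x +i* t - x +i* y = 0 +i* (t - y) by csplit; ring.
  by rewrite cabs_i.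
have [Gh hG] := choice exG; have [Kv hK] := choice exK.
have J : rect_sum Gh Kv a b 0 (pi *+ 2) = 0.
  apply: (@goursat R phi) => // [x y /andP[_ xb] _|x /andP[_ xb]]; [exact: dphi|exact: hK].
have per x : phi (x +i* (pi *+ 2)) = phi (x +i* 0).
  by rewrite /phi !cexp_expi expi2pi expi0.
have E1 : Gh 0 b - Gh 0 a = Gh (pi *+ 2) b - Gh (pi *+ 2) a.
  apply/eqP; rewrite -subr_eq0; apply/eqP; apply: cabs_eq0; apply/eqP; rewrite eq_le cabs_ge0 andbT.
  have := has_prim_dist (M := 0) ab (hG 0) (hG (pi *+ 2)); rewrite mul0r; apply=> x _.
  by rewrite per subrr cabs0.
have E2 : Kv b (pi *+ 2) - Kv b 0 = Kv a (pi *+ 2) - Kv a 0.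
  move: J; rewrite /rect_sum E1 subrr add0r => /eqP; rewrite mulf_eq0 => /orP[|].
    by rewrite eq_complex /= oner_eq0 andbF.
  by rewrite subr_eq0 => /eqP.
have q0 : (0 : R) < pi *+ 2 by rewrite mulrn_wgt0 // pi_gt0.
have k1 : cabs (Kv b (pi *+ 2) - Kv b 0) <= M * (pi *+ 2 - 0).
  apply: (has_prim_le p0 (hK b (lexx b))) => y _.
  by rewrite /phi cexp_expi eb; exact: hM.
have k2 : cabs ((Kv a (pi *+ 2) - Kv a 0) - (f 0 * (pi *+ 2)%:C - f 0 * 0%:C)) <= e * (pi *+ 2 - 0).
  have hc : has_prim (fun=> f 0) 0 (pi *+ 2) (fun t => f 0 * t%:C).
    move=> x _ e1 e10; exists 1; split=> // y _ _.
    have -> : f 0 * y%:C - f 0 * x%:C - f 0 * (y - x)%:C = 0 by rewrite rmorphB /=; ring.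
    by rewrite cabs0 mulr_ge0 // ltW.
  apply: (has_prim_dist p0 (hK a ab) hc) => y _; rewrite /phi; apply: ltW; apply: hdl.
  by rewrite subr0 cabs_cexp.
move: k2; rewrite -E2 subr0 mulr0 subr0 => k2; rewrite subr0 in k1.
have := cabs_sub_ge (f 0 * (pi *+ 2)%:C) (Kv b (pi *+ 2) - Kv b 0).
rewrite (cabsB (f 0 * _)) cabsM cabs_real gtr0_norm // => k3.
rewrite -(ler_pM2r q0) mulrDl; lra.
Qed.

Definition bfac a z := (z - a) / (1 - a^* * z).

Lemma bfac_den a z : cabs a < 1 -> cabs z <= 1 -> 1 - a^* * z != 0.
Proof.
move=> a1 z1; apply/negP => /eqP h.
have : cabs (a^* * z) = 1 by move/eqP: h; rewrite subr_eq0 => /eqP <-; rewrite cabs1.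
rewrite cabsM cabs_conj => h1; have := cabs_ge0 a; have := cabs_ge0 z => h2 h3; nra.
Qed.

Lemma bfac_id a z : cabs (1 - a^* * z) ^+ 2 - cabs (z - a) ^+ 2 = (1 - cabs a ^+ 2) * (1 - cabs z ^+ 2).
Proof. by rewrite !cabs_sqr; case: a => a b; case: z => x y; rewrite conjE /=; ring. Qed.

Lemma one_sub_bfac_sqr a z : cabs a < 1 -> cabs z <= 1 ->
  1 - cabs (bfac a z) ^+ 2 = (1 - cabs a ^+ 2) * (1 - cabs z ^+ 2) / cabs (1 - a^* * z) ^+ 2.
Proof.
move=> a1 z1; have d0 : cabs (1 - a^* * z) != 0 by rewrite gt_eqF // cabs_gt0 bfac_den.
by rewrite -bfac_id /bfac cabsM cabsV; field.
Qed.

Lemma cabs_sqr_lt1 z : cabs z < 1 -> 0 < 1 - cabs z ^+ 2.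
Proof. by move=> h; rewrite subr_gt0 expr_lt1 // cabs_ge0. Qed.

Lemma bfac_lt1 a z : cabs a < 1 -> cabs z < 1 -> cabs (bfac a z) < 1.
Proof.
move=> a1 z1; have h := one_sub_bfac_sqr a1 (ltW z1).
have : 0 < 1 - cabs (bfac a z) ^+ 2.
  have d0 : 0 < cabs (1 - a^* * z) by rewrite cabs_gt0 bfac_den // ltW.
  by rewrite h divr_gt0 ?exprn_gt0 // mulr_gt0 // cabs_sqr_lt1.
by rewrite subr_gt0 expr_lt1 // cabs_ge0.
Qed.

Lemma bfac_eq1 a z : cabs a < 1 -> cabs z = 1 -> cabs (bfac a z) = 1.
Proof.
move=> a1 z1; have := @one_sub_bfac_sqr a z a1; rewrite z1 => /(_ (lexx _)).
rewrite expr1n subrr mulr0 mul0r => /eqP; rewrite subr_eq0 eq_sym => h.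
by apply/eqP; move: h; rewrite -[X in _ == X](expr1n _ 2) eqrXn2 ?cabs_ge0.
Qed.

Lemma bfac_le1 a z : cabs a < 1 -> cabs z <= 1 -> cabs (bfac a z) <= 1.
Proof.
move=> a1; rewrite le_eqVlt => /orP[/eqP h|h]; first by rewrite bfac_eq1.
exact: ltW (bfac_lt1 a1 h).
Qed.

Lemma bfac_deriv a z : cabs a < 1 -> cabs z <= 1 ->
  cderiv (bfac a) z ((1 - cabs a ^+ 2)%:C / (1 - a^* * z) ^+ 2).
Proof.
move=> a1 z1; have d0 := bfac_den a1 z1.
have h1 := cderivB (cderiv_id z) (cderiv_cst a z).
have h2 := cderivB (cderiv_cst 1 z) (cderivZ a^* (cderiv_id z)).
have := cderiv_div h1 h2 d0.
have -> // : (1 - 0) * (1 - a^* * z) - (z - a) * (0 - a^* * 1) = (1 - cabs a ^+ 2)%:C.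
by rewrite rmorphB /= -/(cabs a) sqr_cabsE rmorph1; ring.
Qed.

Lemma disc_alg_bounded f : disc_alg f -> exists M, forall z, cabs z <= 1 -> cabs (f z) <= M.
Proof.
move=> /disc_algP [_ cf _].
suff [M hM] : exists M, forall x y : R, -1 <= x <= 1 -> -1 <= y <= 1 -> cabs (x +i* y) <= 1 -> cabs (f (x +i* y)) <= M.
  exists M => -[x y] h; apply: hM => //; rewrite -ler_norml.
    exact: le_trans (cabs_Re (x +i* y)) h.
  exact: le_trans (cabs_Im (x +i* y)) h.
pose P (a b c d : R) := exists M, forall x y : R, a <= x <= b -> c <= y <= d -> cabs (x +i* y) <= 1 -> cabs (f (x +i* y)) <= M.
apply: (@rect_bisection R P); try lra.
  move=> a b c d ab cd [M1 h1] [M2 h2] [M3 h3] [M4 h4].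
  exists (Num.max (Num.max M1 M2) (Num.max M3 M4)) => x y /andP[x1 x2] /andP[y1 y2] hz.
  rewrite !le_max; case: (leP x ((a + b) / 2)) => hx; case: (leP y ((c + d) / 2)) => hy.
  - by rewrite h1 ?x1 ?y1.
  - by rewrite h2 ?x1 ?y2 ?hx ?(ltW hy) ?orbT.
  - by rewrite h3 ?x2 ?y1 ?hy ?(ltW hx) ?orbT.
  - by rewrite h4 ?x2 ?y2 ?(ltW hy) ?(ltW hx) ?orbT.
move=> x y hx hy.
have [d [d0 hd]] : exists d : R, 0 < d /\ exists M, forall z, cabs (z - x +i* y) < d -> cabs z <= 1 -> cabs (f z) <= M.
  have [h|h] := leP (cabs (x +i* y)) 1.
    have [d [d0 hd]] := cf _ h 1 ltr01; exists d; split=> //; exists (1 + cabs (f (x +i* y))) => z h1 h2.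
    by have := cabs_sub_ge (f z) (f (x +i* y)); have := hd z h1 h2; lra.
  have [d [d0 hd]] := cnear_gt h; exists d; split=> //; exists 0 => z /hd h1 h2.
  by move: (lt_le_trans h1 h2); rewrite ltxx.
exists (d / 2); split; first by rewrite divr_gt0.
move=> a b c e _ _ _ _ hx' hy' s1 s2; case: hd => M hM; exists M => u v hu hv; apply: hM.
have -> : u +i* v - x +i* y = (u - x) +i* (v - y) by csplit; ring.
apply: (le_lt_trans (cabs_leReIm _)) => /=.
have k1 : `|u - x| < d / 2 by rewrite ltr_norml; lra.
have k2 : `|v - y| < d / 2 by rewrite ltr_norml; lra.
lra.
Qed.

Lemma cabs_le_supnorm f z : disc_alg f -> cabs z <= 1 -> cabs (f z) <= supnorm f.
Proof.
move=> /disc_alg_bounded [M hM] hz; apply: sup_ubound; last by exists z.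
by exists M => _ [y hy <-]; exact: hM.
Qed.

Lemma supnorm_le f (M : R) : (forall z, cabs z <= 1 -> cabs (f z) <= M) -> supnorm f <= M.
Proof.
move=> h; apply: ge_sup; last by move=> _ [z hz <-]; exact: h.
by exists (cabs (f 0)); exists 0 => //; rewrite /cD /mkset cabs0.
Qed.

Lemma supnorm_ge0 f : disc_alg f -> 0 <= supnorm f.
Proof.
move=> df; apply: le_trans (cabs_ge0 (f 0)) _; apply: cabs_le_supnorm => //.
by rewrite cabs0.
Qed.

(** A Moebius map moves [a] to the centre. The circle bound then holds up to [e] on circles of
    radius near 1, uniformly in the angle by bisection, and [center_le_circle] applies to such a
    circle. *)
Lemma disc_alg_max_modulus f (M : R) : disc_alg f ->
  (forall z, cabs z = 1 -> cabs (f z) <= M) -> forall z, cabs z <= 1 -> cabs (f z) <= M.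
Proof.
move=> /disc_algP [df cf _] hM a; rewrite le_eqVlt => /orP[/eqP /hM //|a1].
have na1 : cabs (- a) < 1 by rewrite cabsN.
apply/ler_addgt0Pr => e e0.
pose g z := f (bfac (- a) z).
have -> : f a = g 0 by rewrite /g /bfac mulr0 subr0 divr1 sub0r opprK.
pose P (s t : R) := exists r0 : R, 0 < r0 < 1 /\ forall u r : R, s <= u <= t -> r0 <= r < 1 ->
   cabs (g (r%:C * expi u)) <= M + e.
have [r0 [/andP[r00 r01] hr]] : P 0 (pi *+ 2).
  apply: (@itv_bisection R P); first by rewrite mulrn_wge0 // ltW // pi_gt0.
    move=> s t st [r1 [/andP[h1 h2] h3]] [r2 [/andP[h4 h5] h6]].
    exists (Num.max r1 r2); split; first by rewrite lt_max h1 gt_max h2.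
    move=> u r /andP[u1 u2]; rewrite ge_max => /andP[/andP[k1 k2] k3].
    by case: (leP u ((s + t) / 2)) => hu; [apply: h3|apply: h6]; rewrite ?u1 ?u2 ?hu ?k1 ?k2 ?k3 ?(ltW hu).
  move=> t _; have z1 : cabs (expi t) = 1 := cabs_expi t.
  have zl : cabs (expi t) <= 1 by rewrite z1.
  have [d1 [d10 hd1]] := cf _ (bfac_le1 na1 zl) e e0.
  have [d [d0 hd]] := cderiv_cont (bfac_deriv na1 zl) d10.
  exists (d / 2); split; first by rewrite divr_gt0.
  move=> s u _ _ ht su; exists (Num.max (1 / 2) (1 - d / 2)); split.
    by rewrite lt_max gt_max; apply/andP; split; [apply/orP; left; lra|apply/andP; split; lra].
  move=> v r hv; rewrite ge_max => /andP[/andP[q1 q2] q3].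
  have rp : 0 <= r by lra.
  have zr : cabs (r%:C * expi v) < 1 by rewrite cabsM cabs_expi mulr1 cabs_real ger0_norm.
  have dist : cabs (r%:C * expi v - expi t) < d.
    have -> : r%:C * expi v - expi t = (r - 1)%:C * expi v + (expi v - expi t) by rewrite rmorphB /=; ring.
    apply: (le_lt_trans (cabsD _ _)); rewrite cabsM cabs_expi mulr1 cabs_real.
    have k1 : `|r - 1| <= d / 2 by rewrite ler_norml; lra.
    have k2 : `|v - t| < d / 2 by rewrite ltr_norml; lra.
    by have := expi_lip v t; lra.
  have := hd1 _ (hd _ dist) (bfac_le1 na1 (ltW zr)).
  have := hM _ (bfac_eq1 na1 z1); have := cabs_sub_ge (g (r%:C * expi v)) (f (bfac (- a) (expi t))).
  by rewrite /g; lra.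
apply: (@center_le_circle g r0) => //; first by rewrite r00.
- move=> z /andP[_ z1]; have [L hL] := df _ (bfac_lt1 na1 z1).
  by eexists; apply: cderiv_comp hL; exact: bfac_deriv na1 (ltW z1).
- have z0 : cabs (0 : C) < 1 by rewrite cabs0.
  have [L hL] := df _ (bfac_lt1 na1 z0).
  exact: cderiv_cont (cderiv_comp (bfac_deriv na1 (ltW z0)) hL).
- move=> t.
  suff [u [hu ->]] : exists u, 0 <= u <= pi *+ 2 /\ expi t = expi u.
    by apply: hr => //; rewrite lexx r01.
  have p0 : (0 : R) < pi *+ 2 by rewrite mulrn_wgt0 // pi_gt0.
  pose k := Num.floor (t / (pi *+ 2)).
  exists (t - k%:~R * (pi *+ 2)); split.
    have := floor_le_tmp (t / (pi *+ 2)); have := floorD1_gt (t / (pi *+ 2)); rewrite -/k.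
    rewrite ltr_pdivrMr // ler_pdivlMr // intrD mulrDl mul1r => h1 h2.
    by apply/andP; split; lra.
  have per (m : nat) (s : R) : expi (s + m%:R * (pi *+ 2)) = expi s.
    elim: m => [|m IH]; first by rewrite mul0r addr0.
    by rewrite -natr1 mulrDl mul1r addrA expiD expi2pi mulr1.
  case: k => m; first by rewrite -[in LHS](subrK (m%:R * (pi *+ 2)) t) per.
  by rewrite NegzE mulrNz mulNr opprK per.
Qed.

Lemma supnorm_le_circle f (M : R) : disc_alg f ->
  (forall z, cabs z = 1 -> cabs (f z) <= M) -> supnorm f <= M.
Proof. by move=> df hM; apply: supnorm_le; exact: disc_alg_max_modulus. Qed.

(** The difference quotient [q] around [a], rescaled by [p] and completed by the value [L], is
    controlled by [center_le_circle]. On the circle of radius [1 / 2] it is at most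
    [2 * supnorm f / (p / 2)]. *)
Lemma deriv_estimate f a L : disc_alg f -> cabs a < 1 -> cderiv f a L ->
  cabs L <= 4 * supnorm f / (1 - cabs a).
Proof.
move=> daf a1 dL; have /disc_algP [df _ _] := daf.
pose p := 1 - cabs a; have p0 : 0 < p by rewrite subr_gt0.
have pC : p%:C != 0 :> C by rewrite -cabs_gt0 cabs_real gtr0_norm.
pose q z := if z == 0 then L else (f (a + p%:C * z) - f a) / (p%:C * z).
have inU z : cabs z < 1 -> cabs (a + p%:C * z) < 1.
  move=> z1; apply: (le_lt_trans (cabsD _ _)); rewrite cabsM cabs_real gtr0_norm //.
  by have := cabs_ge0 z; rewrite /p in p0 *; nra.
have -> : L = q 0 by rewrite /q eqxx.
have aff z : cderiv (fun z => a + p%:C * z) z p%:C.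
  by have := cderivD (cderiv_cst a z) (cderivZ p%:C (cderiv_id z)); rewrite add0r mulr1.
have h2 : (0 : R) < (1 / 2 : R) < 1 by lra.
apply: (center_le_circle h2).
- move=> z /andP[z0 z1]; rewrite cabs_gt0 in z0.
  have [M hM] := df _ (inU z z1).
  have k1 := cderivB (cderiv_comp (aff z) hM) (cderiv_cst (f a) z).
  have k2 := cderivZ p%:C (cderiv_id z).
  have nz : p%:C * z != 0 by rewrite mulf_neq0.
  eexists; apply: cderiv_near (cderiv_div k1 k2 nz).
  have zz : 0 < cabs z by rewrite cabs_gt0.
  apply: cnear_mono (cnear_gt zz) => y; rewrite cabs_gt0 /q => y0.
  by rewrite (negbTE y0).
- move=> e e0; have e2 : 0 < e / 2 by rewrite divr_gt0.
  have [d [d0 hd]] := dL _ e2.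
  exists (d / p); split; first by rewrite divr_gt0.
  move=> y; rewrite subr0 ltr_pdivlMr // => hy; rewrite /q eqxx.
  case: ifPn => y0; first by rewrite subrr cabs0.
  have nz : p%:C * y != 0 by rewrite mulf_neq0.
  have ay : a + p%:C * y - a = p%:C * y by ring.
  have np : 0 < cabs (p%:C * y) by rewrite cabs_gt0.
  have := hd (a + p%:C * y); rewrite ay => h.
  have {}h : cabs (f (a + p%:C * y) - f a - L * (p%:C * y)) <= e / 2 * cabs (p%:C * y).
    by apply: h; rewrite cabsM cabs_real gtr0_norm // mulrC.
  have -> : (f (a + p%:C * y) - f a) / (p%:C * y) - L = (f (a + p%:C * y) - f a - L * (p%:C * y)) / (p%:C * y).
    by field; rewrite pC y0.
  by rewrite cabsM cabsV ltr_pdivrMr //; apply: (le_lt_trans h); rewrite ltr_pM2r //; lra.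
- move=> t; rewrite /q.
  have ch : cabs ((1 / 2)%:C * expi t) = 1 / 2 by rewrite cabsM cabs_expi mulr1 cabs_real gtr0_norm //; lra.
  rewrite ifF; last by apply/negbTE; rewrite -cabs_gt0 ch; lra.
  rewrite cabsM cabsV cabsM ch cabs_real gtr0_norm // ler_pdivrMr; last by rewrite mulr_gt0 //; lra.
  have -> : 4 * supnorm f / (1 - cabs a) * (p * (1 / 2)) = supnorm f + supnorm f.
    by rewrite /p; field; rewrite gt_eqF // subr_gt0.
  apply: (le_trans (cabsD _ _)); rewrite cabsN lerD //; apply: cabs_le_supnorm => //; last exact: ltW.
  by apply: ltW; apply: inU; rewrite ch; lra.
Qed.
End MaxModulus.

(** * Completeness of the disc algebra *)

Section Completeness.
Variable R : realType.
Local Notation C := R[i].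
Implicit Types (f g : C -> C).

Lemma disc_alg_lin (c : C) f g : disc_alg f -> disc_alg g -> disc_alg (c *: f + g).
Proof.
move=> /disc_algP [f1 f2 f3] /disc_algP [g1 g2 g3]; apply/disc_algP; split.
- move=> z hz; have [L hL] := f1 z hz; have [M hM] := g1 z hz; eexists.
  exact: cderivD (cderivZ c hL) hM.
- move=> z hz e e0; have e2 : 0 < e / 2 by rewrite divr_gt0.
  have k0 : 0 < 1 + cabs c by rewrite ltr_pwDl // cabs_ge0.
  apply: cnear_mono (cnear_and (f2 z hz _ (divr_gt0 e2 k0)) (g2 z hz _ e2)) => y [h1 h2] hy.
  have {}h1 := h1 hy; have {}h2 := h2 hy.
  rewrite [(c *: f + g) y]/(c * f y + g y) [(c *: f + g) z]/(c * f z + g z).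
  have -> : c * f y + g y - (c * f z + g z) = c * (f y - f z) + (g y - g z) by ring.
  apply: (le_lt_trans (cabsD _ _)); rewrite cabsM.
  have : cabs c * cabs (f y - f z) <= e / 2.
    apply: (@le_trans _ _ ((1 + cabs c) * (e / 2 / (1 + cabs c)))).
      by apply: ler_pM; rewrite ?cabs_ge0 ?lerDr // ltW.
    by apply: eq_ler; field; rewrite gt_eqF.
  lra.
- move=> z hz; have -> : (c *: f + g) z = c * f z + g z by [].
  by rewrite f3 // g3 // mulr0; exact: addr0.
Qed.

Lemma disc_algB f g : disc_alg f -> disc_alg g -> disc_alg (f - g).
Proof.
move=> df dg; have -> : f - g = (-1) *: g + f by rewrite scaleN1r addrC.
exact: disc_alg_lin.
Qed.

Lemma disc_alg0 : disc_alg (0 : C -> C).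
Proof.
apply/disc_algP; split=> // z hz; first by exists 0; exact: cderiv_cst.
by move=> e e0; exists 1; split=> // y _ _; rewrite subrr cabs0.
Qed.

Lemma disc_algZ (c : C) f : disc_alg f -> disc_alg (c *: f).
Proof. by move=> df; have := disc_alg_lin c df disc_alg0; rewrite addr0. Qed.

Lemma disc_algD f g : disc_alg f -> disc_alg g -> disc_alg (f + g).
Proof. by move=> df dg; have := disc_alg_lin 1 df dg; rewrite scale1r. Qed.

Lemma disc_alg_sum (I : Type) (r : seq I) (F : I -> C -> C) :
  (forall i, disc_alg (F i)) -> disc_alg (\sum_(i <- r) F i).
Proof. by move=> h; elim/big_rec : _ => [|i x _ hx]; [exact: disc_alg0|exact: disc_algD]. Qed.

Lemma disc_algM f g : disc_alg f -> disc_alg g -> disc_alg (fun z => f z * g z).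
Proof.
move=> daf dag; have [M hM] := disc_alg_bounded daf; have [N hN] := disc_alg_bounded dag.
move: daf dag => /disc_algP [f1 f2 f3] /disc_algP [g1 g2 g3]; apply/disc_algP; split.
- move=> z hz; have [L hL] := f1 z hz; have [K hK] := g1 z hz; eexists.
  exact: cderivM hL hK.
- move=> z hz e e0; have e2 : 0 < e / 2 by rewrite divr_gt0.
  have k0 : 0 < 1 + `|M| by rewrite ltr_pwDl.
  have k1 : 0 < 1 + `|N| by rewrite ltr_pwDl.
  apply: cnear_mono (cnear_and (f2 z hz _ (divr_gt0 e2 k1)) (g2 z hz _ (divr_gt0 e2 k0))) => y [h1 h2] hy.
  have {}h1 := h1 hy; have {}h2 := h2 hy.
  have -> : f y * g y - f z * g z = (f y - f z) * g y + f z * (g y - g z) by ring.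
  apply: (le_lt_trans (cabsD _ _)); rewrite !cabsM.
  have -> : e = e / 2 + e / 2 by field.
  have gy : cabs (g y) < 1 + `|N| by have := hN y hy; have := ler_norm N; lra.
  have fz : cabs (f z) < 1 + `|M| by have := hM z hz; have := ler_norm M; lra.
  apply: ltrD.
    have -> : e / 2 = e / 2 / (1 + `|N|) * (1 + `|N|) by field; rewrite gt_eqF.
    by apply: ltr_pM; rewrite ?cabs_ge0.
  have -> : e / 2 = (1 + `|M|) * (e / 2 / (1 + `|M|)) by field; rewrite gt_eqF.
  by apply: ltr_pM; rewrite ?cabs_ge0.
- by move=> z hz; rewrite f3 // mul0r.
Qed.

(** Every [u m - eps m] lies below every [u n + eps n], so the supremum of the former is a suitable
    [x]. *)
Lemma real_seq_lim (u eps : nat -> R) : (forall m n, (m <= n)%N -> `|u n - u m| <= eps m) ->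
  exists x, forall m, `|u m - x| <= eps m.
Proof.
move=> h.
have uv m n : u m - eps m <= u n + eps n.
  have h1 := h m _ (leq_maxl m n); have h2 := h n _ (leq_maxr m n).
  by move: h1 h2; rewrite !ler_norml; lra.
exists (sup (range (fun m => u m - eps m))) => m; set x := sup _.
have h1 : u m - eps m <= x.
  by apply: sup_ubound; [exists (u 0%N + eps 0%N) => _ [k _ <-]|exists m].
have h2 : x <= u m + eps m.
  by apply: ge_sup; [exists (u m - eps m); exists m|move=> _ [k _ <-]].
by rewrite ler_norml; lra.
Qed.

Lemma complex_seq_lim (u : nat -> C) (eps : nat -> R) :
  (forall m n, (m <= n)%N -> cabs (u n - u m) <= eps m) ->
  exists x, forall m, cabs (u m - x) <= 2 * eps m.
Proof.
move=> h.
have [x hx] : exists x, forall m, `|complex.Re (u m) - x| <= eps m.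
  apply: real_seq_lim => m n mn; apply: le_trans (h m n mn).
  by apply: le_trans (cabs_Re _); case: (u n) => ? ?; case: (u m).
have [y hy] : exists y, forall m, `|complex.Im (u m) - y| <= eps m.
  apply: real_seq_lim => m n mn; apply: le_trans (h m n mn).
  by apply: le_trans (cabs_Im _); case: (u n) => ? ?; case: (u m).
exists (x +i* y) => m; apply: (le_trans (cabs_leReIm _)).
have := lerD (hx m) (hy m); case: (u m) => p q /=; lra.
Qed.

(** Within [r], half the distance of [a] to the circle, derivatives are at most [4 * supnorm f / r];
    the mean value inequality along the segment from [a] to [z] concludes. *)
Lemma disc_alg_lip f (a z : C) (r : R) : disc_alg f -> cabs a < 1 -> r = (1 - cabs a) / 2 ->
  cabs (z - a) < r -> cabs (f z - f a) <= 4 * supnorm f / r * cabs (z - a).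
Proof.
move=> daf a1 rE zr; have /disc_algP [df _ _] := daf; have s0 := supnorm_ge0 daf.
have r0 : 0 < r by rewrite rE divr_gt0 // subr_gt0.
pose E (t : R) := f (a + t%:C * (z - a)).
have inb t : 0 <= t <= 1 -> cabs (a + t%:C * (z - a)) <= 1 - r.
  move=> /andP[t0 t1]; apply: (le_trans (cabsD _ _)); rewrite cabsM cabs_real ger0_norm //.
  by have := cabs_ge0 (z - a); nra.
have := @mean_value_ineq R E 0 1 (4 * supnorm f / r * cabs (z - a)) ler01.
have E1 : E 1 = f z by rewrite /E mul1r addrC subrK.
have E0 : E 0 = f a by rewrite /E mul0r addr0.
rewrite E1 E0 subr0 mulr1 => ->//.
move=> x hx e e0; have ia := inb x hx.
have i1 : cabs (a + x%:C * (z - a)) < 1 by lra.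
have [L hL] := df _ i1.
have nL := deriv_estimate daf i1 hL.
have lb : cabs L <= 4 * supnorm f / r.
  apply: (le_trans nL); apply: ler_wpM2l; first by rewrite mulr_ge0.
  by rewrite lef_pV2 ?posrE ?subr_gt0 //; lra.
have k0 : 0 < 1 + cabs (z - a) by rewrite ltr_pwDl // cabs_ge0.
have [d [d0 hd]] := hL _ (divr_gt0 e0 k0).
exists (d / (1 + cabs (z - a))); split; first by rewrite divr_gt0.
move=> y hy; rewrite ltr_pdivlMr // => yx.
have F1 : a + y%:C * (z - a) - (a + x%:C * (z - a)) = (y - x)%:C * (z - a) by rewrite rmorphB /=; ring.
have F2 : cabs ((y - x)%:C * (z - a)) = `|y - x| * cabs (z - a) by rewrite cabsM cabs_real.
have := hd (a + y%:C * (z - a)); rewrite F1 F2 => h.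
have {}h : cabs (f (a + y%:C * (z - a)) - f (a + x%:C * (z - a)) - L * ((y - x)%:C * (z - a)))
   <= e / (1 + cabs (z - a)) * (`|y - x| * cabs (z - a)).
  by apply: h; apply: le_lt_trans yx; apply: ler_wpM2l => //; rewrite lerDr.
have -> : f (a + y%:C * (z - a)) - f (a + x%:C * (z - a)) =
  (f (a + y%:C * (z - a)) - f (a + x%:C * (z - a)) - L * ((y - x)%:C * (z - a))) + L * ((y - x)%:C * (z - a)) by ring.
apply: (le_trans (cabsD _ _)); rewrite mulrDl addrC cabsM F2; apply: lerD.
  rewrite -mulrA [cabs _ * `|_|]mulrC; apply: ler_wpM2r => //.
  by rewrite mulr_ge0 // cabs_ge0.
apply: (le_trans h); rewrite mulrCA mulrC; apply: ler_wpM2r => //.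
rewrite mulrAC ler_pdivrMr //; apply: ler_wpM2l; [exact: ltW|by rewrite lerDr].
Qed.

(** Differentiability of the limit: the derivatives at [a] are Cauchy by [deriv_estimate], and
    [disc_alg_lip] bounds the increments of [F n - F N] by a multiple of [eps N] uniformly in [n],
    hence those of [f - F N]. *)
Lemma disc_alg_complete (F : nat -> C -> C) (eps : nat -> R) :
  (forall n, disc_alg (F n)) ->
  (forall e : R, 0 < e -> exists N, forall n, (N <= n)%N -> eps n < e) ->
  (forall m n z, (m <= n)%N -> cabs z <= 1 -> cabs (F n z - F m z) <= eps m) ->
  exists f, disc_alg f /\ forall m z, cabs z <= 1 -> cabs (F m z - f z) <= 2 * eps m.
Proof.
move=> dF e0 hF.
have eps0 m : 0 <= eps m.
  have := hF m m 0 (leqnn m); rewrite cabs0 subrr cabs0; apply; exact: ler01.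
have ex z : exists x, (cabs z <= 1 -> forall m, cabs (F m z - x) <= 2 * eps m) /\ (1 < cabs z -> x = 0).
  have [h|h] := leP (cabs z) 1; last by exists 0.
  have [x hx] : exists x, forall m, cabs (F m z - x) <= 2 * eps m.
    by apply: complex_seq_lim => m n mn; exact: hF.
  by exists x; split=> // h1.
have [f hf] := choice ex; exists f; split; last by move=> m z hz; exact: (hf z).1.
have cF n := iffLR (disc_algP (F n)) (dF n).
apply/disc_algP; split; last by move=> z hz; exact: (hf z).2.
- move=> a a1; pose r := (1 - cabs a) / 2; have r0 : 0 < r by rewrite divr_gt0 // subr_gt0.
  have dif m n : (m <= n)%N -> supnorm (F n - F m) <= eps m.
    by move=> mn; apply: supnorm_le => z hz; exact: hF.
  have exL n : exists L, cderiv (F n) a L by have [h _ _] := cF n; exact: h.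
  have [Ls hLs] := choice exL.
  have [L hL] : exists L, forall m, cabs (Ls m - L) <= 2 * (2 / r * eps m).
    apply: complex_seq_lim => m n mn.
    have h := deriv_estimate (disc_algB (dF n) (dF m)) a1 (cderivB (hLs n) (hLs m)).
    apply: (le_trans h).
    have -> : 4 * supnorm (F n - F m) / (1 - cabs a) = 2 / r * supnorm (F n - F m).
      by rewrite /r; field; rewrite gt_eqF // subr_gt0.
    by apply: ler_wpM2l; rewrite ?dif // ltW // divr_gt0.
  exists L => e ep.
  (* Chosen so that [(4 / r + 1) * k = e / 3]: each of [A1], [A2], [A3] takes a third of the
     error. *)
  pose k := e / 3 / (4 / r + 1).
  have k0 : 0 < k by rewrite divr_gt0 ?divr_gt0 // ltr_wpDl // ltW // divr_gt0.
  have [N hN] := e0 k k0.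
  have e3 : 0 < e / 3 by rewrite divr_gt0.
  have epsN := hN N (leqnn N).
  have bnd : 4 / r * eps N <= e / 3.
    have -> : e / 3 = (4 / r + 1) * k by rewrite /k; field; rewrite gt_eqF // gt_eqF //= ltr_wpDl // ltW.
    by apply: ler_pM => //; [rewrite ltW // divr_gt0| rewrite lerDl|exact: ltW].
  have [d [d0 hd]] := hLs N _ e3.
  exists (Num.min d r); split; first by rewrite lt_min d0 r0.
  move=> z; rewrite lt_min => /andP[zd zr].
  have z1 : cabs z <= 1 by have := cabsD (z - a) a; rewrite subrK /r in zr *; lra.
  set t := cabs (z - a) in zd zr *.
  have t0 : 0 <= t := cabs_ge0 _.
  have A1 : cabs ((f z - F N z) - (f a - F N a)) <= e / 3 * t.
    (* The slack [x] absorbs the passage from [F n] to [f] at [z] and at [a], at most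
       [2 * eps n < x / 2] each. *)
    apply/ler_addgt0Pr => x x0.
    have x4 : 0 < x / 4 by rewrite divr_gt0.
    have [N' hN'] := e0 _ x4; pose n := maxn N N'.
    have hn := hN' n (leq_maxr _ _).
    have l1 := disc_alg_lip (disc_algB (dF n) (dF N)) a1 (erefl r) zr.
    have l2 : cabs ((F n z - F N z) - (F n a - F N a)) <= e / 3 * t.
      apply: (le_trans l1); apply: ler_wpM2r => //; apply: le_trans bnd.
      rewrite mulrAC; apply: ler_wpM2l; last by apply: dif; exact: leq_maxl.
      by rewrite ltW // divr_gt0.
    have l3 := (hf z).1 z1 n; have l4 := (hf a).1 (ltW a1) n.
    have -> : f z - F N z - (f a - F N a) = (F n z - F N z - (F n a - F N a)) + (- (F n z - f z) + (F n a - f a)) by ring.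
    apply: (le_trans (cabsD _ _)); have := cabsD (- (F n z - f z)) (F n a - f a); rewrite cabsN; lra.
  have A2 := hd z zd; rewrite -/t in A2.
  have A3 : cabs ((Ls N - L) * (z - a)) <= e / 3 * t.
    rewrite cabsM; apply: ler_wpM2r => //; apply: (le_trans (hL N)); apply: le_trans bnd.
    by apply: eq_ler; field; rewrite gt_eqF.
  have -> : f z - f a - L * (z - a) = ((f z - F N z) - (f a - F N a)) + (F N z - F N a - Ls N * (z - a)) + (Ls N - L) * (z - a) by ring.
  by apply: (le_trans (cabsD3 _ _ _)); lra.
- move=> z hz e ep; have e6 : 0 < e / 6 by rewrite divr_gt0.
  have [N hN] := e0 _ e6; have hN1 := hN N (leqnn N).
  have [_ h _] := cF N.
  apply: cnear_mono (h z hz _ e6) => y h1 hy; have {}h1 := h1 hy.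
  have h2 := (hf z).1 hz N; have h3 := (hf y).1 hy N.
  have -> : f y - f z = - (F N y - f y) + (F N y - F N z) + (F N z - f z) by ring.
  by apply: (le_lt_trans (cabsD3 _ _ _)); rewrite cabsN; lra.
Qed.
End Completeness.

(** * Blaschke products and their lifts *)

Section RealDerivRules.
Variable R : realType.
Implicit Types (f g : R -> R) (x l m : R).

Lemma rderiv_eq f x l m : is_derive x 1 f l -> l = m -> is_derive x 1 f m.
Proof. by move=> h <-. Qed.

Lemma rderiv_cst (c x : R) : is_derive x 1 (fun=> c) 0.
Proof. exact: is_derive_cst. Qed.

Lemma rderiv_id x : is_derive x 1 (fun y : R => y) 1.
Proof. exact: is_derive_id. Qed.

Lemma rderivD f g x l m : is_derive x 1 f l -> is_derive x 1 g m -> is_derive x 1 (fun y => f y + g y) (l + m).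
Proof. by move=> df dg; exact: (is_deriveD df dg). Qed.

Lemma rderivM f g x l m : is_derive x 1 f l -> is_derive x 1 g m ->
  is_derive x 1 (fun y => f y * g y) (l * g x + f x * m).
Proof.
move=> df dg; apply: (rderiv_eq (is_deriveM df dg)).
by rewrite /GRing.scale /= addrC mulrC.
Qed.

Lemma rderivZ (c : R) f x l : is_derive x 1 f l -> is_derive x 1 (fun y => c * f y) (c * l).
Proof. by move=> df; apply: (rderiv_eq (rderivM (rderiv_cst c x) df)); rewrite mul0r add0r. Qed.

Lemma rderivB f g x l m : is_derive x 1 f l -> is_derive x 1 g m -> is_derive x 1 (fun y => f y - g y) (l - m).
Proof. by move=> df dg; exact: (is_deriveB df dg). Qed.

Lemma rderivV f x l : f x != 0 -> is_derive x 1 f l -> is_derive x 1 (fun y => (f y)^-1) (- l / f x ^+ 2).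
Proof.
move=> f0 df; apply: (rderiv_eq (is_deriveV f0 df)).
by rewrite /GRing.scale /= mulNr mulNr mulrC.
Qed.

Lemma rderiv_comp f g x l m : is_derive (g x) 1 f l -> is_derive x 1 g m -> is_derive x 1 (fun y => f (g y)) (l * m).
Proof. by move=> df dg; exact: (is_derive1_comp df dg). Qed.

Lemma rderiv_sum (I : Type) (r : seq I) (h : I -> R -> R) (dh : I -> R) x :
  (forall i, is_derive x 1 (h i) (dh i)) -> is_derive x 1 (fun y => \sum_(i <- r) h i y) (\sum_(i <- r) dh i).
Proof.
move=> hd; elim: r => [|i r IH].
  rewrite big_nil; have -> : (fun y => \sum_(i <- [::]) h i y) = (fun=> 0) by apply/funext => y; rewrite big_nil.
  exact: rderiv_cst.
rewrite big_cons.
have -> : (fun y => \sum_(j <- i :: r) h j y) = (fun y => h i y + \sum_(j <- r) h j y).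
  by apply/funext => y; rewrite big_cons.
exact: rderivD.
Qed.
End RealDerivRules.

(** * Blaschke factors and the kernel inequality *)

Section BlaschkeFactors.
Variable R : realType.
Local Notation C := R[i].
Implicit Types (a z y : C) (s : seq C).

(* Poisson kernel: on the circle it is the modulus of the derivative of bfac a. *)
Definition pois a z : R := (1 - cabs a ^+ 2) / cabs (1 - a^* * z) ^+ 2.

Lemma pois_gt0 a z : cabs a < 1 -> cabs z <= 1 -> 0 < pois a z.
Proof. by move=> a1 z1; rewrite divr_gt0 ?cabs_sqr_lt1 // exprn_gt0 // cabs_gt0 bfac_den. Qed.

(** For a single factor the kernel [(1 - b(z) conj(b(y))) / (1 - z conj(y))] has rank one; products
    are treated by telescoping. *)
Lemma one_sub_bfac a z y : cabs a < 1 -> cabs z <= 1 -> cabs y <= 1 ->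
  1 - bfac a z * (bfac a y)^* =
  (1 - z * y^*) * ((1 - cabs a ^+ 2)%:C / ((1 - a^* * z) * (1 - a^* * y)^*)).
Proof.
move=> a1 z1 y1; have d1 := bfac_den a1 z1; have d2 := bfac_den a1 y1.
have d3 : (1 - a^* * y)^* != 0 by rewrite cconj_eq0.
rewrite /bfac cconjM cconjV.
have -> : (1 - cabs a ^+ 2)%:C = 1 - a * a^* by rewrite -sqr_cabsE rmorphB rmorph1.
have e1 : (1 - a^* * y)^* = 1 - a * y^* by rewrite cconjB cconjM cconj1 cconjK.
rewrite e1 in d3 *; rewrite cconjB; field; by rewrite d1 d3.
Qed.

Lemma one_sub_bfac_norm a z y : cabs a < 1 -> cabs z = 1 -> cabs y <= 1 ->
  cabs (1 - bfac a z * (bfac a y)^*) ^+ 2 = cabs (1 - z * y^*) ^+ 2 * pois a z * pois a y.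
Proof.
move=> a1 z1 y1; have z1' : cabs z <= 1 by rewrite z1.
have d1 : cabs (1 - a^* * z) != 0 by rewrite gt_eqF // cabs_gt0 bfac_den.
have d2 : cabs (1 - a^* * y) != 0 by rewrite gt_eqF // cabs_gt0 bfac_den.
rewrite one_sub_bfac // cabsM cabsM cabsV (cabsM (1 - a^* * z)) cabs_conj cabs_real.
by rewrite gtr0_norm ?cabs_sqr_lt1 // /pois; field; rewrite d1 d2.
Qed.

Definition bprod s z := \prod_(a <- s) bfac a z.
Definition psum s z : R := \sum_(a <- s) pois a z.
(** The squared moduli as weights make this the diagonal value [(1 - |B|^2) / (1 - |z|^2)] of the
    kernel of [bprod s], see [esum_disc]; on the circle, where that quotient is undefined, it equals
    [psum]. *)
Fixpoint esum s z : R :=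
  if s is a :: s' then pois a z + cabs (bfac a z) ^+ 2 * esum s' z else 0.

Definition inU s := forall a, a \in s -> cabs a < 1.

Lemma inU_cons a s : inU (a :: s) -> cabs a < 1 /\ inU s.
Proof. by move=> h; split=> [|b bs]; apply: h; rewrite inE ?eqxx // bs orbT. Qed.

Lemma bprod_cons a s z : bprod (a :: s) z = bfac a z * bprod s z.
Proof. by rewrite /bprod big_cons. Qed.

Lemma psum_cons a s z : psum (a :: s) z = pois a z + psum s z.
Proof. by rewrite /psum big_cons. Qed.

Lemma psum_ge0 s z : inU s -> cabs z <= 1 -> 0 <= psum s z.
Proof.
move=> + z1; elim: s => [|a s IH] hs; first by rewrite /psum big_nil.
by have [a1 s1] := inU_cons hs; rewrite psum_cons addr_ge0 ?IH // ltW // pois_gt0.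
Qed.

Lemma esum_ge0 s z : inU s -> cabs z <= 1 -> 0 <= esum s z.
Proof.
move=> + z1; elim: s => [|a s IH] hs //=.
have [a1 s1] := inU_cons hs; apply: addr_ge0; first by rewrite ltW // pois_gt0.
by rewrite mulr_ge0 ?sqr_ge0 // IH.
Qed.

Lemma bprod_circle s z : inU s -> cabs z = 1 -> cabs (bprod s z) = 1.
Proof.
move=> + z1; elim: s => [|a s IH] hs; first by rewrite /bprod big_nil cabs1.
by have [a1 s1] := inU_cons hs; rewrite bprod_cons cabsM bfac_eq1 // IH // mulr1.
Qed.

Lemma esum_circle s z : inU s -> cabs z = 1 -> esum s z = psum s z.
Proof.
move=> + z1; elim: s => [|a s IH] hs /=; first by rewrite /psum big_nil.
by have [a1 s1] := inU_cons hs; rewrite psum_cons bfac_eq1 // expr1n mul1r IH.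
Qed.

Lemma esum_disc s z : inU s -> cabs z <= 1 -> (1 - cabs z ^+ 2) * esum s z = 1 - cabs (bprod s z) ^+ 2.
Proof.
move=> + z1; elim: s => [|a s IH] hs /=; first by rewrite /bprod big_nil cabs1 expr1n subrr mulr0.
have [a1 s1] := inU_cons hs; rewrite bprod_cons cabsM exprMn mulrDr.
rewrite [X in _ + X]mulrCA (IH s1) /pois mulrA [(1 - cabs z ^+ 2) * _]mulrC -one_sub_bfac_sqr //; ring.
Qed.

(** The cross term obeys [2xy <= ad + bc] since [(xy)^2 <= (ad)(bc)]. Keeping [x^2 + y^2] on the
    right lets a strict bound on [x^2] survive in [kernel_lt]. *)
Lemma cauchy_schwarz2 (a b c d x y : R) : 0 <= a -> 0 <= b -> 0 <= c -> 0 <= d -> 0 <= x -> 0 <= y ->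
  x ^+ 2 <= a * b -> y ^+ 2 <= c * d -> (x + y) ^+ 2 <= x ^+ 2 + y ^+ 2 + (a * d + b * c).
Proof.
move=> a0 b0 c0 d0 x0 y0 hx hy.
suff : x * y *+ 2 <= a * d + b * c by rewrite sqrrD; lra.
have ad : 0 <= a * d by exact: mulr_ge0.
have bc : 0 <= b * c by exact: mulr_ge0.
rewrite -(ler_pXn2r (n := 2)) ?nnegrE ?mulrn_wge0 ?mulr_ge0 ?addr_ge0 //.
have -> : (x * y *+ 2) ^+ 2 = (x ^+ 2 * y ^+ 2) *+ 4 by ring.
have h1 : x ^+ 2 * y ^+ 2 <= (a * b) * (c * d) by apply: ler_pM => //; exact: sqr_ge0.
have := sqr_ge0 (a * d - b * c).
have -> : (a * d - b * c) ^+ 2 = (a * d + b * c) ^+ 2 - (a * b * (c * d)) *+ 4 by ring.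
by rewrite subr_ge0; apply: le_trans; rewrite lerMn2r h1 orbT.
Qed.

(** Induction through [1 - b s conj(b' s') = (1 - b conj(b')) + b conj(b') (1 - s conj(s'))], with
    [|b| = 1] because [z] is on the circle; the two parts combine by Cauchy-Schwarz. *)
Lemma kernel_le s z y : inU s -> cabs z = 1 -> cabs y <= 1 ->
  cabs (1 - bprod s z * (bprod s y)^*) ^+ 2 <= cabs (1 - z * y^*) ^+ 2 * psum s z * esum s y.
Proof.
move=> + z1 y1; have z1' : cabs z <= 1 by rewrite z1.
elim: s => [|a s IH] hs.
  by rewrite /bprod !big_nil cconj1 mulr1 subrr cabs0 expr0n /= mulr0.
have [a1 s1] := inU_cons hs; rewrite !bprod_cons psum_cons [esum _ _]/=.
set L := cabs (1 - z * y^*) ^+ 2; have L0 : 0 <= L by rewrite sqr_ge0.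
have hx := one_sub_bfac_norm a1 z1 y1; rewrite -/L in hx.
set x := cabs (1 - bfac a z * (bfac a y)^*) in hx.
pose v := cabs (bfac a z * (bfac a y)^* * (1 - bprod s z * (bprod s y)^*)).
have hv : v ^+ 2 <= (L * psum s z) * (cabs (bfac a y) ^+ 2 * esum s y).
  rewrite /v cabsM cabsM cabs_conj bfac_eq1 // mul1r exprMn [leRHS]mulrCA.
  by apply: ler_wpM2l; [exact: sqr_ge0|exact: IH].
apply: (@le_trans _ _ ((x + v) ^+ 2)).
  rewrite ler_pXn2r ?nnegrE ?cabs_ge0 ?addr_ge0 ?cabs_ge0 //.
  have -> : 1 - bfac a z * bprod s z * (bfac a y * bprod s y)^*
    = (1 - bfac a z * (bfac a y)^*) + bfac a z * (bfac a y)^* * (1 - bprod s z * (bprod s y)^*).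
    by rewrite cconjM; ring.
  exact: cabsD.
have pz := pois_gt0 a1 z1'; have py := pois_gt0 a1 y1.
have ps := psum_ge0 s1 z1'; have es := esum_ge0 s1 y1.
have A1 : 0 <= L * pois a z by rewrite mulr_ge0 // ltW.
have A3 : 0 <= L * psum s z by rewrite mulr_ge0.
have A4 : 0 <= cabs (bfac a y) ^+ 2 * esum s y by rewrite mulr_ge0 // sqr_ge0.
apply: (le_trans (cauchy_schwarz2 A1 (ltW py) A3 A4 (cabs_ge0 _) (cabs_ge0 _) (eq_ler hx) hv)).
rewrite hx.
have -> : L * (pois a z + psum s z) * (pois a y + cabs (bfac a y) ^+ 2 * esum s y) =
  L * pois a z * pois a y + (L * psum s z) * (cabs (bfac a y) ^+ 2 * esum s y) +
  (L * pois a z * (cabs (bfac a y) ^+ 2 * esum s y) + pois a y * (L * psum s z)) by ring.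
by rewrite lerD2r lerD2l.
Qed.

(** Lagrange's identity: the second summand is the exact defect in Cauchy-Schwarz for two weighted
    vectors. *)
Lemma lagrange_weighted (m n : R) (u0 u1 v0 v1 : C) :
  cabs (m%:C * u0 * v0^* + n%:C * u1 * v1^*) ^+ 2 + m * n * cabs (u0 * v1 - u1 * v0) ^+ 2
  = (m * cabs u0 ^+ 2 + n * cabs u1 ^+ 2) * (m * cabs v0 ^+ 2 + n * cabs v1 ^+ 2).
Proof.
rewrite !cabs_sqr; case: u0 => a b; case: u1 => c d; case: v0 => e f; case: v1 => g h; rewrite !conjE /=; ring.
Qed.

(** With two factors the defect is positive: the vectors belonging to [z] and [y] have determinant
    [(y - z) (1 - conj(b) a)] up to nonvanishing factors. Degree at least 2 enters here. *)
Lemma kernel_lt2 a b z y : cabs a < 1 -> cabs b < 1 -> cabs z = 1 -> cabs y <= 1 -> z != y ->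
  cabs (1 - bfac a z * bfac b z * (bfac a y * bfac b y)^*) ^+ 2 <
  cabs (1 - z * y^*) ^+ 2 * (pois a z + pois b z) * (pois a y + cabs (bfac a y) ^+ 2 * pois b y).
Proof.
move=> a1 b1 z1 y1 zy; have z1' : cabs z <= 1 by rewrite z1.
have daz := bfac_den a1 z1'; have dbz := bfac_den b1 z1'.
have day := bfac_den a1 y1; have dby := bfac_den b1 y1.
pose m := 1 - cabs a ^+ 2; pose n := 1 - cabs b ^+ 2.
have m0 : 0 < m := cabs_sqr_lt1 a1; have n0 : 0 < n := cabs_sqr_lt1 b1.
pose u0 := (1 - a^* * z)^-1; pose u1 := bfac a z / (1 - b^* * z).
pose v0 := (1 - a^* * y)^-1; pose v1 := bfac a y / (1 - b^* * y).
have E : 1 - bfac a z * bfac b z * (bfac a y * bfac b y)^* =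
  (1 - z * y^*) * (m%:C * u0 * v0^* + n%:C * u1 * v1^*).
  have -> : 1 - bfac a z * bfac b z * (bfac a y * bfac b y)^* =
    (1 - bfac a z * (bfac a y)^*) + bfac a z * (bfac a y)^* * (1 - bfac b z * (bfac b y)^*).
    by rewrite cconjM; ring.
  rewrite !one_sub_bfac // -/m -/n /u0 /u1 /v0 /v1 cconjM !cconjV !invfM; ring.
have L0 : 0 < cabs (1 - z * y^*).
  rewrite cabs_gt0 subr_eq0; apply/eqP => h.
  have zz : z * z^* = 1 by rewrite -sqr_cabsE z1 expr1n.
  have z0 : z != 0 by rewrite -cabs_gt0 z1.
  have : z * (z^* - y^*) = 0 by rewrite mulrBr zz -h subrr.
  move/eqP; rewrite mulf_eq0 (negbTE z0) /= subr_eq0 => /eqP /(congr1 Num.conj).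
  by rewrite !cconjK => /eqP; rewrite (negbTE zy).
have W : u0 * v1 - u1 * v0 = (y - z) * (1 - b^* * a) * (u0 * v0 * ((1 - b^* * z)^-1 * (1 - b^* * y)^-1)).
  by rewrite /u0 /u1 /v0 /v1 /bfac; field; rewrite daz dbz day dby.
have W0 : 0 < cabs (u0 * v1 - u1 * v0).
  rewrite cabs_gt0 W !mulf_neq0 ?invr_eq0 //; first by rewrite subr_eq0 eq_sym.
  exact: bfac_den b1 (ltW a1).
have := lagrange_weighted m n u0 u1 v0 v1.
have -> : m * cabs u0 ^+ 2 + n * cabs u1 ^+ 2 = pois a z + pois b z.
  by rewrite /u0 /u1 cabsM bfac_eq1 // mul1r !cabsV !exprVn.
have -> : m * cabs v0 ^+ 2 + n * cabs v1 ^+ 2 = pois a y + cabs (bfac a y) ^+ 2 * pois b y.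
  by rewrite /v0 /v1 cabsM !cabsV exprMn !exprVn /pois -/m -/n; ring.
rewrite -[ltRHS]mulrA => <-; rewrite E cabsM exprMn ltr_pM2l ?exprn_gt0 //.
by rewrite ltrDl !mulr_gt0 // exprn_gt0.
Qed.

Lemma kernel_lt a b s z y : inU [:: a, b & s] -> cabs z = 1 -> cabs y <= 1 -> z != y ->
  cabs (1 - bprod [:: a, b & s] z * (bprod [:: a, b & s] y)^*) ^+ 2 <
  cabs (1 - z * y^*) ^+ 2 * psum [:: a, b & s] z * esum [:: a, b & s] y.
Proof.
move=> hs z1 y1 zy; have z1' : cabs z <= 1 by rewrite z1.
have [a1 /inU_cons [b1 s1]] := inU_cons hs.
have hx := kernel_lt2 a1 b1 z1 y1 zy.
have hv := kernel_le s1 z1 y1.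
rewrite !bprod_cons !psum_cons [esum _ _]/=.
set L := cabs (1 - z * y^*) ^+ 2 in hx hv *; have L0 : 0 <= L by rewrite sqr_ge0.
have paz := pois_gt0 a1 z1'; have pbz := pois_gt0 b1 z1'.
have pay := pois_gt0 a1 y1; have pby := pois_gt0 b1 y1.
have ps := psum_ge0 s1 z1'; have es := esum_ge0 s1 y1.
set x := cabs _ in hx.
pose B := bfac a z * bfac b z * (bfac a y * bfac b y)^*.
pose k := cabs (bfac a y) ^+ 2 * cabs (bfac b y) ^+ 2.
have k0 : 0 <= k by rewrite mulr_ge0 // sqr_ge0.
pose v := cabs (B * (1 - bprod s z * (bprod s y)^*)).
have hv' : v ^+ 2 <= (L * psum s z) * (k * esum s y).
  rewrite /v cabsM exprMn.
  have -> : cabs B ^+ 2 = k by rewrite /B cabsM cabs_conj (cabsM (bfac a z)) (cabsM (bfac a y)) (bfac_eq1 a1 z1) (bfac_eq1 b1 z1) !mul1r exprMn.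
  by rewrite [leRHS]mulrCA; apply: ler_wpM2l.
set p := pois a z + pois b z in hx *; set q := pois a y + _ * pois b y in hx *.
have p0 : 0 <= p by rewrite addr_ge0 // ltW.
have q0 : 0 <= q by apply: addr_ge0; [exact: ltW|apply: mulr_ge0; [exact: sqr_ge0|exact: ltW]].
apply: (@le_lt_trans _ _ ((x + v) ^+ 2)).
  rewrite ler_pXn2r ?nnegrE ?cabs_ge0 ?addr_ge0 ?cabs_ge0 //.
  have -> : 1 - bfac a z * (bfac b z * bprod s z) * (bfac a y * (bfac b y * bprod s y))^*
    = (1 - B) + B * (1 - bprod s z * (bprod s y)^*) by rewrite /B !cconjM; ring.
  exact: cabsD.
have A1 : 0 <= L * p by rewrite mulr_ge0.
have A3 : 0 <= L * psum s z by rewrite mulr_ge0.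
have A4 : 0 <= k * esum s y by rewrite mulr_ge0.
apply: (le_lt_trans (cauchy_schwarz2 A1 q0 A3 A4 (cabs_ge0 _) (cabs_ge0 _) (ltW hx) hv')).
have -> : L * (pois a z + (pois b z + psum s z)) *
   (pois a y + cabs (bfac a y) ^+ 2 * (pois b y + cabs (bfac b y) ^+ 2 * esum s y)) =
  (L * p * q + L * psum s z * (k * esum s y)) + (L * p * (k * esum s y) + q * (L * psum s z)).
  by rewrite /p /q /k; ring.
by rewrite ltrD2r; exact: ltr_leD hx hv'.
Qed.
End BlaschkeFactors.

(** * Finite Blaschke products and their angular lifts *)

Section Blaschke.
Variables (R : realType) (d : nat) (theta : R) (a : 'I_d -> R[i]).
Hypothesis d2 : (2 <= d)%N.
Hypothesis ha : forall j, cabs (a j) < 1.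
Local Notation C := R[i].
Local Notation B := (blaschke theta a).
Implicit Types (z : C).

Let s := [seq a j | j <- index_enum 'I_d].

Lemma blaschkeE z : B z = expi theta * bprod s z.
Proof. by rewrite /blaschke /bprod big_map. Qed.

Let sU : inU s.
Proof. by move=> x /mapP [j _ ->]. Qed.

Let s2 : exists x y r, s = [:: x, y & r].
Proof.
have : size s = d by rewrite size_map /index_enum -enumT size_enum_ord.
case: s => [|x [|y r]] hs; [by move: d2; rewrite -hs|by move: d2; rewrite -hs|].
by exists x, y, r.
Qed.

Lemma blaschke_circle z : cabs z = 1 -> cabs (B z) = 1.
Proof. by move=> z1; rewrite blaschkeE cabsM cabs_expi mul1r bprod_circle. Qed.

Lemma bprod_le1 (r : seq C) z : inU r -> cabs z <= 1 -> cabs (bprod r z) <= 1.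
Proof.
move=> hr z1; rewrite -(@ler_pXn2r _ 2) ?nnegrE ?cabs_ge0 // expr1n -subr_ge0 -esum_disc //.
by rewrite mulr_ge0 ?esum_ge0 // subr_ge0 expr_le1 // cabs_ge0.
Qed.

Lemma blaschke_le1 z : cabs z <= 1 -> cabs (B z) <= 1.
Proof. by move=> z1; rewrite blaschkeE cabsM cabs_expi mul1r; exact: bprod_le1. Qed.

(** One factor suffices, as the others have modulus at most 1; [|1 - conj(x) z| <= 2] produces the
    4. *)
Lemma blaschke_defect : exists k : R, 0 < k /\
  forall z, cabs z <= 1 -> k * (1 - cabs z ^+ 2) <= 1 - cabs (B z) ^+ 2.
Proof.
have [x [y [r sE]]] := s2; have := sU; rewrite sE => /inU_cons [x1 r1].
exists ((1 - cabs x ^+ 2) / 4); split; first by rewrite divr_gt0 // cabs_sqr_lt1.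
move=> z z1; rewrite blaschkeE cabsM cabs_expi mul1r sE bprod_cons cabsM.
apply: (@le_trans _ _ (1 - cabs (bfac x z) ^+ 2)).
  rewrite one_sub_bfac_sqr // mulrAC; apply: ler_wpM2l.
    by rewrite mulr_ge0 ?(ltW (cabs_sqr_lt1 x1)) // subr_ge0 expr_le1 // cabs_ge0.
  have p0 : 0 < cabs (1 - x^* * z) by rewrite cabs_gt0 bfac_den.
  rewrite lef_pV2 ?posrE ?exprn_gt0 //.
  have : cabs (1 - x^* * z) <= 2.
    apply: (le_trans (cabsD _ _)); rewrite cabs1 cabsN cabsM cabs_conj.
    by have := cabs_ge0 x; have := cabs_ge0 z; nra.
  by nra.
rewrite lerD2l lerN2 exprMn ler_piMr ?sqr_ge0 // expr_le1 // ?cabs_ge0 //.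
exact: bprod_le1.
Qed.

Lemma blaschke_lt1 z : cabs z < 1 -> cabs (B z) < 1.
Proof.
move=> z1; have [k [k0 hk]] := blaschke_defect; have := hk z (ltW z1) => h.
have : 0 < 1 - cabs (B z) ^+ 2 by apply: lt_le_trans h; rewrite mulr_gt0 // cabs_sqr_lt1.
by rewrite subr_gt0 expr_lt1 // cabs_ge0.
Qed.

Lemma blaschke_deriv z : cabs z <= 1 -> exists L, cderiv B z L.
Proof.
move=> z1; have [M hM] := @cderiv_prod R _ (index_enum 'I_d) (fun j => bfac (a j)) z
   (fun j => ex_intro _ _ (bfac_deriv (ha j) z1)).
by exists (expi theta * M); apply: cderivZ hM.
Qed.

(** On the circle [z b'(z) / b(z)] is the positive number [pois x z]; being logarithmic derivatives,
    these add up over a product. *)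
Lemma bfac_deriv_circle x z : cabs x < 1 -> cabs z = 1 ->
  cderiv (bfac x) z (bfac x z * z^* * (pois x z)%:C).
Proof.
move=> x1 z1; have z1' : cabs z <= 1 by rewrite z1.
have d0 := bfac_den x1 z1'.
have := bfac_deriv x1 z1'; congr (cderiv _ _ _).
have zz : z * z^* = 1 by rewrite -sqr_cabsE z1 expr1n.
have d3 : (1 - x^* * z)^* != 0 by rewrite cconj_eq0.
have e1 : (z - x) * z^* = (1 - x^* * z)^* by rewrite cconjB cconjM cconj1 cconjK mulrBl zz.
have -> : (pois x z)%:C = (1 - cabs x ^+ 2)%:C / ((1 - x^* * z) * (1 - x^* * z)^*).
  by rewrite -sqr_cabsE; exact: (fmorph_div (real_complex R)).
rewrite /bfac [X in _ = X * _]mulrAC e1.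
by move: d3; set u := (1 - _)^* => d3; clearbody u; field; rewrite d0 d3.
Qed.

Lemma bprod_deriv_circle (r : seq C) z : inU r -> cabs z = 1 ->
  cderiv (bprod r) z (bprod r z * z^* * (psum r z)%:C).
Proof.
move=> + z1; elim: r => [|x r IH] hr.
  rewrite /psum big_nil mulr0; apply: cderiv_ext (cderiv_cst 1 z) => y.
  by rewrite /bprod big_nil.
have [x1 r1] := inU_cons hr.
apply: (@cderiv_ext _ (fun y => bfac x y * bprod r y)) => [y|]; first by rewrite bprod_cons.
have := cderivM (bfac_deriv_circle x1 z1) (IH r1); congr (cderiv _ _ _).
by rewrite bprod_cons psum_cons rmorphD /=; ring.
Qed.

Lemma derive1_blaschke_circle z : cabs z = 1 -> cabs (derive1 B z) = psum s z.
Proof.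
move=> z1; have z1' : cabs z <= 1 by rewrite z1.
have dB : cderiv B z (expi theta * (bprod s z * z^* * (psum s z)%:C)).
  apply: (@cderiv_ext _ (fun y => expi theta * bprod s y)) => [y|]; first by rewrite blaschkeE.
  exact: cderivZ (bprod_deriv_circle sU z1).
rewrite (derive1_cderiv dB) !cabsM cabs_expi bprod_circle // cabs_conj z1 !mul1r cabs_real.
by rewrite ger0_norm // psum_ge0.
Qed.

(** The kernel inequality at a fixed point whose diagonal value [esum s y] is 1: in the disc because
    [|B y| = |y|], on the circle by the hypothesis on [psum]. *)
Lemma blaschke_expand z y : cabs z = 1 -> cabs y <= 1 -> z != y -> B y = y ->
  (cabs y = 1 -> psum s y = 1) ->
  cabs (1 - y^* * B z) ^+ 2 < cabs (1 - y^* * z) ^+ 2 * psum s z.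
Proof.
move=> z1 y1 zy By py.
have E1 : esum s y = 1.
  move: (y1); rewrite le_eqVlt => /orP[/eqP h|h]; first by rewrite esum_circle // py.
  have := esum_disc sU y1.
  have -> : cabs (bprod s y) = cabs y by rewrite -[in RHS]By blaschkeE cabsM cabs_expi mul1r.
  have n0 : 1 - cabs y ^+ 2 != 0 by rewrite gt_eqF // cabs_sqr_lt1.
  by move=> h1; apply: (mulfI n0); rewrite mulr1.
have := E1; have [u [v [r sE]]] := s2; have := sU; rewrite sE => hU E2.
have := kernel_lt hU z1 y1 zy; rewrite E2 mulr1 -sE [z * _]mulrC.
have -> // : bprod s z * (bprod s y)^* = y^* * B z.
rewrite -{2}By !blaschkeE cconjM mulrACA.
have -> : (expi theta)^* * expi theta = 1 by rewrite mulrC -sqr_cabsE cabs_expi expr1n.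
by rewrite mul1r mulrC.
Qed.

(** By design [1 - conj(x) e^(it) = PX - i PY], hence [bfac x] sends [e^(it)] to
    [e^(it) (PX + i PY) / (PX - i PY)]. For [|x| < 1] one has [PX > 0], so the argument of the
    quotient is [2 * atan (PY / PX)] without jumps, and [blift] is a smooth lift. *)
Definition PX x (t : R) : R := 1 - (complex.Re x * cos t + complex.Im x * sin t).
Definition PY x (t : R) : R := complex.Re x * sin t - complex.Im x * cos t.
Definition blift x (t : R) : R := t + 2 * atan (PY x t / PX x t).
Definition poist x (t : R) : R := (1 - cabs x ^+ 2) / (PX x t ^+ 2 + PY x t ^+ 2).

Lemma one_sub_expi x t : 1 - x^* * expi t = PX x t -i* PY x t.
Proof. by case: x => p q; rewrite conjE /expi; csplit; rewrite /PX /PY /=; ring. Qed.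

Lemma poist_pois x t : poist x t = pois x (expi t).
Proof.
rewrite /pois one_sub_expi (cabs_sqr (_ -i* _)).
by rewrite [complex.Re (_ -i* _)]/= [complex.Im (_ -i* _)]/= sqrrN.
Qed.

Lemma PX_gt0 x t : cabs x < 1 -> 0 < PX x t.
Proof.
move=> x1; have := cabs_Re (x^* * expi t); rewrite cabsM cabs_conj cabs_expi mulr1.
have -> : complex.Re (x^* * expi t) = 1 - PX x t by case: x {x1} => p q; rewrite conjE /PX /=; ring.
by rewrite ler_norml => /andP[_ h]; lra.
Qed.

Lemma cos_2atan (q : R) : cos (2 * atan q) = (1 - q ^+ 2) / (1 + q ^+ 2).
Proof.
have h : 0 < 1 + q ^+ 2 by rewrite ltr_pwDl // sqr_ge0.
rewrite mulr_natl cos_mulr2n cos_atan exprVn sqr_sqrtr ?ltW //; field.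
by rewrite gt_eqF.
Qed.

Lemma sin_2atan (q : R) : sin (2 * atan q) = 2 * q / (1 + q ^+ 2).
Proof.
have h : 0 < 1 + q ^+ 2 by rewrite ltr_pwDl // sqr_ge0.
have c2 : cos (atan q) ^+ 2 = (1 + q ^+ 2)^-1 by rewrite cos_atan exprVn sqr_sqrtr // ltW.
have c0 : cos (atan q) != 0.
  by apply/eqP => e; move: c2; rewrite e expr0n /= => /esym /eqP; rewrite invr_eq0 gt_eqF.
have sq : sin (atan q) = q * cos (atan q) by rewrite -{2}(atanK q) /tan divfK.
by rewrite mulr_natl sin_mulr2n sq -c2; ring.
Qed.

Lemma expi_blift x t : cabs x < 1 -> expi (blift x t) = bfac x (expi t).
Proof.
move=> x1; have X0 := PX_gt0 t x1.
have zl : cabs (expi t) <= 1 by rewrite cabs_expi.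
have d0 := bfac_den x1 zl.
apply: (mulIf d0); rewrite /bfac divfK // one_sub_expi /blift expiD.
have n0 : PX x t != 0 by rewrite gt_eqF.
have s0 : PX x t ^+ 2 + PY x t ^+ 2 != 0 by rewrite gt_eqF // ltr_pwDl ?exprn_gt0 ?sqr_ge0.
have -> : expi t * expi (2 * atan (PY x t / PX x t)) * (PX x t -i* PY x t) = expi t * (PX x t +i* PY x t).
  rewrite -mulrA; congr (_ * _); rewrite /expi cos_2atan sin_2atan.
  by csplit; field; rewrite ?n0 //= addrC.
have := cos2Dsin2 t; rewrite /PX /PY /expi; case: x {x1 X0 d0 n0 s0} => p q /= h.
by csplit; [transitivity (cos t - p * (cos t ^+ 2 + sin t ^+ 2))|transitivity (sin t - q * (cos t ^+ 2 + sin t ^+ 2))];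
  try (by rewrite h mulr1); ring.
Qed.

Lemma PX_derive x (t : R) : is_derive t 1 (PX x) (PY x t).
Proof.
have h := rderivB (rderiv_cst 1 t) (rderivD (rderivZ (complex.Re x) (is_derive_cos t)) (rderivZ (complex.Im x) (is_derive_sin t))).
by apply: (rderiv_eq h); rewrite /PY; ring.
Qed.

Lemma PY_derive x (t : R) : is_derive t 1 (PY x) (1 - PX x t).
Proof.
have h := rderivB (rderivZ (complex.Re x) (is_derive_sin t)) (rderivZ (complex.Im x) (is_derive_cos t)).
by apply: (rderiv_eq h); rewrite /PX; ring.
Qed.

Lemma blift_derive x (t : R) : cabs x < 1 -> is_derive t 1 (blift x) (poist x t).
Proof.
move=> x1; have X0 := PX_gt0 t x1; have n0 : PX x t != 0 by rewrite gt_eqF.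
have s0 : PX x t ^+ 2 + PY x t ^+ 2 != 0 by rewrite gt_eqF // ltr_pwDl ?exprn_gt0 ?sqr_ge0.
have dQ := rderivM (PY_derive x t) (rderivV n0 (PX_derive x t)).
have dA := rderivD (rderiv_id t) (rderivZ 2 (rderiv_comp (g := fun y => PY x y / PX x y) (is_derive1_atan (PY x t / PX x t)) dQ)).
apply: (rderiv_eq dA).
have E : 1 + (PY x t / PX x t) ^+ 2 != 0 by rewrite gt_eqF // ltr_pwDl ?sqr_ge0.
(* The numerator is [2 PX - (PX^2 + PY^2)] once [|x|^2] is multiplied by [cos^2 + sin^2]. *)
have -> : poist x t = (2 * PX x t - (PX x t ^+ 2 + PY x t ^+ 2)) / (PX x t ^+ 2 + PY x t ^+ 2).
  congr (_ / _); rewrite cabs_sqr.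
  have -> : complex.Re x ^+ 2 + complex.Im x ^+ 2 = (complex.Re x ^+ 2 + complex.Im x ^+ 2) * (cos t ^+ 2 + sin t ^+ 2).
    by rewrite cos2Dsin2 mulr1.
  by rewrite /PX /PY; ring.
have -> : 1 + (PY x t / PX x t) ^+ 2 = (PX x t ^+ 2 + PY x t ^+ 2) / PX x t ^+ 2 by field.
by field; rewrite n0 s0.
Qed.

Lemma poist_derive x (t : R) : cabs x < 1 -> exists l, is_derive t 1 (poist x) l.
Proof.
move=> x1; have X0 := PX_gt0 t x1.
have s0 : PX x t ^+ 2 + PY x t ^+ 2 != 0 by rewrite gt_eqF // ltr_pwDl ?exprn_gt0 ?sqr_ge0.
have dX := PX_derive x t; have dY := PY_derive x t.
have s1 : PX x t * PX x t + PY x t * PY x t != 0 by rewrite -!expr2.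
have := rderivZ (1 - cabs x ^+ 2) (rderivV (f := fun y => PX x y * PX x y + PY x y * PY x y) s1 (rderivD (rderivM dX dX) (rderivM dY dY))).
have -> : (fun y => (1 - cabs x ^+ 2) * (PX x y * PX x y + PY x y * PY x y)^-1) = poist x.
  by apply/funext => y; rewrite /poist !expr2.
by move=> h; eexists; exact: h.
Qed.

Lemma poist_gt0 x t : cabs x < 1 -> 0 < poist x t.
Proof. by move=> x1; rewrite poist_pois pois_gt0 // cabs_expi. Qed.

Definition blasch_lift (t : R) : R := theta + \sum_(j < d) blift (a j) t.
Definition blasch_dlift (t : R) : R := \sum_(j < d) poist (a j) t.

Lemma expi_blasch_lift t : expi (blasch_lift t) = B (expi t).
Proof.
rewrite /blasch_lift expiD /blaschke; congr (_ * _).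
rewrite (big_morph (@expi R) (@expiD R) (@expi0 R)).
by apply: eq_bigr => j _; rewrite expi_blift.
Qed.

Lemma blasch_lift_derive (t : R) : is_derive t 1 blasch_lift (blasch_dlift t).
Proof.
have h := rderivD (rderiv_cst theta t) (rderiv_sum (index_enum 'I_d) (fun j => blift_derive t (ha j))).
by apply: (rderiv_eq h); rewrite add0r.
Qed.

Lemma blasch_dlift_derive (t : R) : exists l, is_derive t 1 blasch_dlift l.
Proof.
have [l hl] := choice (fun j => poist_derive t (ha j)).
by eexists; exact: (rderiv_sum (index_enum 'I_d) hl).
Qed.

Lemma poist_period x t : poist x (t + pi *+ 2) = poist x t.
Proof. by rewrite !poist_pois expiD expi2pi mulr1. Qed.

Lemma blift_period x t : blift x (t + pi *+ 2) = blift x t + pi *+ 2.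
Proof.
have [c s1] : cos (t + pi *+ 2) = cos t /\ sin (t + pi *+ 2) = sin t.
  by have := expiD t (pi *+ 2); rewrite expi2pi mulr1 => -[].
by rewrite /blift /PX /PY c s1 addrAC.
Qed.

Lemma blasch_lift_period t : blasch_lift (t + pi *+ 2) = blasch_lift t + d%:R * (pi *+ 2).
Proof.
rewrite /blasch_lift -addrA; congr (_ + _).
under eq_bigr do rewrite blift_period.
by rewrite big_split /= sumr_const card_ord mulr_natl.
Qed.

Lemma blasch_dlift_period t : blasch_dlift (t + pi *+ 2) = blasch_dlift t.
Proof. by apply: eq_bigr => j _; rewrite poist_period. Qed.

Lemma blasch_dlift_psum t : blasch_dlift t = psum s (expi t).
Proof. by rewrite /psum big_map; apply: eq_bigr => j _; rewrite poist_pois. Qed.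

Lemma derive1_blaschke_expi t : cabs (derive1 B (expi t)) = blasch_dlift t.
Proof. by rewrite blasch_dlift_psum derive1_blaschke_circle // cabs_expi. Qed.

Lemma blasch_lift_expand t y : cabs y <= 1 -> expi t != y -> B y = y ->
  (cabs y = 1 -> cabs (derive1 B y) = 1) ->
  cabs (1 - y^* * expi (blasch_lift t)) ^+ 2 < cabs (1 - y^* * expi t) ^+ 2 * blasch_dlift t.
Proof.
move=> y1 ty By h; rewrite expi_blasch_lift blasch_dlift_psum; apply: blaschke_expand => //.
  exact: cabs_expi.
by move=> yc; rewrite -derive1_blaschke_circle // h.
Qed.
End Blaschke.

(** * Shadowing for lifts of circle maps *)

Section RealLemmas.
Variable R : realType.
Implicit Types (f g : R -> R).

Definition rcont f := forall x e : R, 0 < e -> exists d : R, 0 < d /\ forall y, `|y - x| < d -> `|f y - f x| < e.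

Lemma rderiv_cont f (x l : R) : is_derive x 1 f l ->
  forall e : R, 0 < e -> exists d : R, 0 < d /\ forall y, `|y - x| < d -> `|f y - f x| < e.
Proof.
move=> df; apply: continuous_eps.
by apply: differentiable_continuous; apply/derivable1_diffP; case: df.
Qed.

Lemma rderiv_MVT g (dg : R -> R) (x y : R) : x < y ->
  (forall t, x <= t <= y -> is_derive t 1 g (dg t)) -> exists t, x < t < y /\ g y - g x = dg t * (y - x).
Proof.
move=> xy hd.
have cg : {within `[x, y], continuous g}.
  by apply: derivable_within_continuous => t; rewrite in_itv /= => /hd [].
have [|t tin E] := @MVT R g dg x y xy _ cg; last by exists t; split=> //; move: tin; rewrite in_itv.
by move=> t; rewrite in_itv /= => /andP[h1 h2]; apply: hd; rewrite !ltW.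
Qed.

Lemma rderiv_nondecr g (dg : R -> R) (x y : R) : x <= y ->
  (forall t, x <= t <= y -> is_derive t 1 g (dg t)) -> (forall t, x <= t <= y -> 0 <= dg t) -> g x <= g y.
Proof.
rewrite le_eqVlt => /orP[/eqP -> //|xy] hd hp.
have [t [/andP[h1 h2] E]] := rderiv_MVT xy hd; rewrite -subr_ge0 E.
by apply: mulr_ge0; [apply: hp; rewrite !ltW|rewrite subr_ge0 ltW].
Qed.

Lemma rderiv_incr g (dg : R -> R) (x y : R) : x < y ->
  (forall t, x <= t <= y -> is_derive t 1 g (dg t)) -> (forall t, x < t < y -> 0 < dg t) -> g x < g y.
Proof.
move=> xy hd hp; have [t [h E]] := rderiv_MVT xy hd.
by rewrite -subr_gt0 E mulr_gt0 ?subr_gt0 // hp.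
Qed.

(** A positive minimum over a closed part of the interval: [P] marks this part, and the second
    alternative expresses that its complement is open. *)
Lemma itv_pos_bound (P : R -> Prop) f (a b : R) : rcont f -> a <= b ->
  (forall x, a <= x <= b -> (0 < f x) \/ exists d : R, 0 < d /\ forall y, `|y - x| < d -> ~ P y) ->
  exists k : R, 0 < k /\ forall x, a <= x <= b -> P x -> k <= f x.
Proof.
move=> cf ab h.
apply: (@itv_bisection R (fun a b => exists k : R, 0 < k /\ forall x, a <= x <= b -> P x -> k <= f x)) => //.
  move=> a1 b1 _ [k1 [k10 h1]] [k2 [k20 h2]]; exists (Num.min k1 k2); split; first by rewrite lt_min k10.
  move=> x /andP[x1 x2] px; rewrite ge_min; case: (leP x ((a1 + b1) / 2)) => hx.
    by rewrite h1 // x1.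
  by rewrite (h2 x) ?orbT // x2 ltW.
move=> x hx; case: (h x hx) => [fx|[d [d0 hd]]].
  have f2 : 0 < f x / 2 by rewrite divr_gt0.
  have [d [d0 hd]] := cf x _ f2; exists d; split=> // a1 b1 _ _ ax s.
  exists (f x / 2); split=> // y hy _.
  have /hd : `|y - x| < d by rewrite ltr_norml; lra.
  by rewrite ltr_norml; lra.
exists d; split=> // a1 b1 _ _ ax s; exists 1; split=> // y hy py.
by exfalso; apply: (hd y) => //; rewrite ltr_norml; lra.
Qed.

Lemma eventually_eps (J e : R) : 0 < e -> exists N, forall n, (N <= n)%N -> J <= n%:R * e.
Proof.
move=> e0; exists (Num.trunc (`|J| / e)).+1 => n hn.
have h : `|J| / e < n%:R.
  apply: lt_le_trans (_ : (Num.trunc (`|J| / e)).+1%:R <= _); last by rewrite ler_nat.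
  by apply: truncnS_gt.
by apply: le_trans (ler_norm J) _; rewrite -ler_pdivrMr // ltW.
Qed.
End RealLemmas.

Section Dynamics.
Variable R : realType.
Variables (b c db H : R -> R) (d : nat).
Local Notation tau := (@pi R *+ 2).
Hypothesis d2 : (2 <= d)%N.
Hypothesis b_deriv : forall t : R, is_derive t 1 b (db t).
Hypothesis b_incr : forall s t, s < t -> b s < b t.
Hypothesis bK : cancel b c.
Hypothesis cK : cancel c b.
Hypothesis b_per : forall t, b (t + tau) = b t + d%:R * tau.
Hypothesis db_cont : rcont db.
Hypothesis H_cont : rcont H.
Hypothesis H_per : forall t, H (t + tau) = H t.

Lemma tau_gt0 : 0 < tau.
Proof. by rewrite mulrn_wgt0 // pi_gt0. Qed.

Definition cong (s t : R) := exists k : int, s = t + k%:~R * tau.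

Lemma cong_refl s : cong s s.
Proof. by exists 0; rewrite mul0r addr0. Qed.

Lemma cong_trans s t u : cong s t -> cong t u -> cong s u.
Proof. by move=> [k ->] [l ->]; exists (l + k); rewrite intrD mulrDl addrA. Qed.

Lemma cong_sym s t : cong s t -> cong t s.
Proof. by move=> [k ->]; exists (- k); rewrite mulrNz mulNr addrK. Qed.

Lemma per_int (V : zmodType) (f : R -> V) (g : V) : (forall t, f (t + tau) = f t + g) ->
  forall (k : int) t, f (t + k%:~R * tau) = f t + g *~ k.
Proof.
move=> hf.
have hn (n : nat) t : f (t + n%:R * tau) = f t + g *+ n.
  elim: n => [|n IH]; first by rewrite mul0r addr0 mulr0n addr0.
  by rewrite -natr1 mulrDl mul1r addrA hf IH mulrSr addrA.
case=> n t; first exact: hn.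
rewrite NegzE mulrNz mulNr mulrNz.
by have := hn n.+1 (t - n.+1%:R * tau); rewrite subrK => ->; rewrite addrK.
Qed.

Lemma cong_b s t : cong s t -> cong (b s) (b t).
Proof.
move=> [k ->]; exists (k * d%:Z); rewrite (per_int b_per); congr (_ + _).
by rewrite intrM -mulrA -mulrzl.
Qed.

Lemma cong_iter n s t : cong s t -> cong (iter n b s) (iter n b t).
Proof. by elim: n => //= n IH /IH; exact: cong_b. Qed.

Lemma H_cong s t : cong s t -> H s = H t.
Proof.
move=> [k ->]; have h u : H (u + tau) = H u + 0 by rewrite addr0 H_per.
by rewrite (per_int h) mul0rz addr0.
Qed.

(** Birkhoff sum; for [H = log |w|] on the circle it is the logarithm of the modulus of
    [wprod n]. *)
Fixpoint birk n x := if n is m.+1 then H x + birk m (b x) else 0.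

Lemma birk_cong n s t : cong s t -> birk n s = birk n t.
Proof. by elim: n s t => //= n IH s t st; rewrite (H_cong st) (IH _ _ (cong_b st)). Qed.

Lemma birk_add m n x : birk (m + n) x = birk m x + birk n (iter m b x).
Proof. by elim: m x => [|m IH] x /=; rewrite ?add0r // IH addrA -iterSr. Qed.

Lemma birk_last n x : birk n.+1 x = birk n x + H (iter n b x).
Proof. by rewrite -addn1 birk_add /= addr0. Qed.

Lemma iter_bc n u : iter n b (iter n c u) = u.
Proof. by elim: n u => //= n IH u; rewrite -iterS iterSr cK IH. Qed.

Lemma iter_cb n u : iter n c (iter n b u) = u.
Proof. by elim: n u => //= n IH u; rewrite -iterS iterSr bK IH. Qed.

Lemma birk_pull n u : birk n.+1 (iter n.+1 c u) = birk n (iter n c (c u)) + H (c u).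
Proof. by rewrite birk_last iterSr iter_bc. Qed.

Lemma b_mono s t : s <= t -> b s <= b t.
Proof. by rewrite le_eqVlt => /orP[/eqP ->//|/b_incr/ltW]. Qed.

Lemma c_incr s t : s < t -> c s < c t.
Proof. by move=> st; rewrite ltNge; apply/negP => /b_mono; rewrite !cK leNgt st. Qed.

Lemma c_mono s t : s <= t -> c s <= c t.
Proof. by rewrite le_eqVlt => /orP[/eqP ->//|/c_incr/ltW]. Qed.

Lemma b_cont : rcont b.
Proof. by move=> x; apply: rderiv_cont (b_deriv x). Qed.

Lemma repr_period t : exists k : int, k%:~R * tau <= t < (k + 1)%:~R * tau.
Proof.
exists (Num.floor (t / tau)); rewrite -ler_pdivlMr ?tau_gt0 // -ltr_pdivrMr ?tau_gt0 //.
by rewrite floor_le_tmp floorD1_gt.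
Qed.

Lemma cong_repr t : exists s, 0 <= s < tau /\ cong t s.
Proof.
have [k /andP[h1 h2]] := repr_period t; exists (t - k%:~R * tau); split; last by exists k; rewrite subrK.
by move: h2; rewrite intrD mulrDl mul1r => h2; apply/andP; split; lra.
Qed.

Lemma H_bounded : exists M : R, forall t, `|H t| <= M.
Proof.
suff [M hM] : exists M : R, forall t, 0 <= t <= tau -> `|H t| <= M.
  exists M => t; have [s [/andP[s0 s1] /H_cong ->]] := cong_repr t; apply: hM.
  by rewrite s0 ltW.
apply: (@itv_bisection R (fun a b => exists M : R, forall t, a <= t <= b -> `|H t| <= M)); first exact: ltW tau_gt0.
  move=> x y _ [M1 h1] [M2 h2]; exists (Num.max M1 M2) => t /andP[t1 t2]; rewrite le_max.
  case: (leP t ((x + y) / 2)) => ht; first by rewrite h1 // t1.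
  by rewrite (h2 t) ?orbT // t2 ltW.
move=> x _; have [e [e0 he]] := H_cont x ltr01; exists e; split=> // u v _ _ hx s.
exists (`|H x| + 1) => t ht.
have /he : `|t - x| < e by rewrite ltr_norml; lra.
by have := ler_normD (H t - H x) (H x); rewrite subrK; lra.
Qed.

Lemma H_unif (e : R) : 0 < e -> exists dl : R, 0 < dl /\ forall s t, `|s - t| < dl -> `|H s - H t| <= e.
Proof.
move=> e0.
suff [dl [dl0 h]] : exists dl : R, 0 < dl /\ forall s t, 0 <= s <= tau -> `|s - t| < dl -> `|H s - H t| <= e.
  exists dl; split=> // s t st; have [s' [/andP[s0 s1] [k sE]]] := cong_repr s.
  have -> : H s = H s' by apply: H_cong; exists k.
  have -> : H t = H (t - k%:~R * tau) by apply: H_cong; exists k; rewrite subrK.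
  apply: h; first by rewrite s0 ltW.
  by move: st; rewrite sE; congr (`|_| < _); ring.
apply: (@itv_bisection R (fun a b => exists dl : R, 0 < dl /\ forall s t, a <= s <= b -> `|s - t| < dl -> `|H s - H t| <= e)).
- exact: ltW tau_gt0.
- move=> x y _ [d1 [d10 h1]] [d3 [d30 h3]]; exists (Num.min d1 d3); split; first by rewrite lt_min d10.
  move=> s t /andP[s1 s2]; rewrite lt_min => /andP[k1 k2].
  case: (leP s ((x + y) / 2)) => hs; first by apply: h1 => //; rewrite s1.
  by apply: h3 => //; rewrite s2 ltW.
- move=> x _; have e2 : 0 < e / 2 by rewrite divr_gt0.
  have [r [r0 hr]] := H_cont x e2; exists (r / 2); split; first by rewrite divr_gt0.
  move=> u v _ _ hx hs; exists (r / 2); split; first by rewrite divr_gt0.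
  move=> s t hst st.
  have k1 : `|s - x| < r / 2 by rewrite ltr_norml; lra.
  have k2 : `|t - x| < r by have := ler_normD (t - s) (s - x); rewrite addrA subrK (distrC t s); lra.
  have k3 : `|s - x| < r by lra.
  have := ler_normD (H s - H x) (H x - H t); rewrite addrA subrK (distrC (H x)).
  by have := hr _ k2; have := hr _ k3; lra.
Qed.

(** Each pull-back may exceed [e] by [A] times the loss of [ell]; the losses telescope to at most
    [ell u v] because [ell] stays nonnegative. *)
Lemma distortion (inv : R -> R -> Prop) (ell : R -> R -> R) (e A : R) :
  0 <= A -> (forall u v, inv u v -> 0 <= ell u v) ->
  (forall u v, inv u v -> inv (c u) (c v) /\
     `|H (c u) - H (c v)| <= e + A * (ell u v - ell (c u) (c v))) ->
  forall n u v, inv u v -> `|birk n (iter n c u) - birk n (iter n c v)| <= n%:R * e + A * ell u v.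
Proof.
move=> A0 l0 step; elim=> [|n IH] u v iuv.
  by rewrite /= subrr normr0 mul0r add0r mulr_ge0 // l0.
have [icc hH] := step u v iuv; rewrite !birk_pull.
have h := IH _ _ icc.
have -> : birk n (iter n c (c u)) + H (c u) - (birk n (iter n c (c v)) + H (c v)) =
  (birk n (iter n c (c u)) - birk n (iter n c (c v))) + (H (c u) - H (c v)) by ring.
apply: (le_trans (ler_normD _ _)); rewrite -natr1 mulrDl mul1r.
by have := lerD h hH; lra.
Qed.

(** [J] depends neither on [n] nor on the points, so for large [n] a further [n * e] absorbs it. *)
Definition shadowing := forall e : R, 0 < e -> exists J : R, forall n x s,
  exists t, cong (iter n b t) s /\ birk n x <= birk n t + n%:R * e + J.

(** * Shadowing from a uniformly expanded metric *)

Section Elliptic.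
Variables (m dm : R -> R).
Hypothesis m_deriv : forall t : R, is_derive t 1 m (dm t).
Hypothesis dm_cont : rcont dm.
Hypothesis dm_gt0 : forall t, 0 < dm t.
Hypothesis dm_per : forall t, dm (t + tau) = dm t.
Hypothesis db_per : forall t, db (t + tau) = db t.
Hypothesis m_per : forall t, m (t + tau) = m t + tau.
Hypothesis expand : forall t, dm t < dm (b t) * db t.

Lemma rcontM f g : rcont f -> rcont g -> rcont (fun t : R => f t * g t : R).
Proof.
move=> cf cg x e e0; apply: continuous_eps => //.
by apply: continuousM; apply: eps_continuous; [exact: cf|exact: cg].
Qed.

Lemma rcontB f g : rcont f -> rcont g -> rcont (fun t : R => f t - g t : R).
Proof.
move=> cf cg x e e0; apply: continuous_eps => //.
by apply: continuousB; apply: eps_continuous; [exact: cf|exact: cg].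
Qed.

Lemma rcont_comp f g : rcont f -> rcont g -> rcont (fun t : R => f (g t) : R).
Proof.
move=> cf cg x e e0; have [r [r0 hr]] := cf (g x) e e0; have [r' [r0' hr']] := cg x r r0.
by exists r'; split=> // y /hr' /hr.
Qed.

Lemma pos_periodic (f : R -> R) : rcont f -> (forall t, 0 < f t) -> (forall t, f (t + tau) = f t) ->
  exists k : R, 0 < k /\ forall t, k <= f t.
Proof.
move=> cf fp fper.
have [k [k0 hk]] := @itv_pos_bound R (fun=> True) f 0 tau cf (ltW tau_gt0) (fun x _ => or_introl (fp x)).
exists k; split=> // t; have [s [/andP[s0 s1] [i ->]]] := cong_repr t.
have h u : f (u + tau) = f u + 0 by rewrite addr0 fper.
by rewrite (per_int h) mul0rz addr0; apply: hk => //; rewrite s0 ltW.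
Qed.

(** Periodicity makes the expansion uniform: [c] shrinks [ell] by the factor [1 + kap]. A
    pulled-back interval shorter than [dl] costs at most [e]; a longer one costs at most [2 * M] and
    loses at least [kap * (mu * dl)] of [ell], which fixes [A]. *)
Lemma elliptic_shadowing : shadowing.
Proof.
move=> e e0; have [M hM] := H_bounded; have [dl [dl0 hdl]] := H_unif e0.
have M0 : 0 <= M by apply: le_trans (hM 0).
have [g [g0 hg]] : exists k : R, 0 < k /\ forall t, k <= dm (b t) * db t - dm t.
  apply: pos_periodic.
  - exact: rcontB (rcontM (rcont_comp dm_cont b_cont) db_cont) dm_cont.
  - by move=> t; rewrite subr_gt0.
  - move=> t; rewrite b_per db_per dm_per.
    have h u : dm (u + tau) = dm u + 0 by rewrite addr0 dm_per.
    by have := per_int h d (b t); rewrite mul0rz addr0 => ->.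
have [mu [mu0 hmu]] := pos_periodic dm_cont dm_gt0 dm_per.
have [k [k0 hk]] : exists k : R, 0 < k /\ forall t, k <= (dm t)^-1.
  apply: pos_periodic => [x e1 e10|t|t]; last by rewrite dm_per.
    apply: continuous_eps => //; apply: continuousV; first by rewrite gt_eqF.
    by apply: eps_continuous; exact: dm_cont.
  by rewrite invr_gt0.
pose kap := g * k.
have kap0 : 0 < kap by rewrite mulr_gt0.
have hkap t : (1 + kap) * dm t <= dm (b t) * db t.
  have := hg t; have := hk t => h1 h2; rewrite mulrDl mul1r /kap.
  have : g * k * dm t <= g * ((dm t)^-1 * dm t) by rewrite -mulrA ler_pM2l // ler_wpM2r // ltW.
  by rewrite mulVf ?gt_eqF // mulr1; lra.
pose ell u v := m v - m u.
pose inv (u v : R) := u <= v.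
pose A := 2 * M / (kap * (mu * dl)).
have A0 : 0 <= A by rewrite divr_ge0 ?mulr_ge0 // ltW.
have ell0 u v : inv u v -> 0 <= ell u v.
  by move=> uv; rewrite subr_ge0; apply: (rderiv_nondecr (dg := dm)) => // t _; exact: ltW.
have contr u v : u <= v -> (1 + kap) * ell (c u) (c v) <= ell u v.
  move=> uv; have cuv := c_mono uv.
  have := @rderiv_nondecr R (fun t => m (b t) - (1 + kap) * m t) (fun t => dm (b t) * db t - (1 + kap) * dm t) _ _ cuv.
  rewrite !cK /ell => h.
  suff : m u - (1 + kap) * m (c u) <= m v - (1 + kap) * m (c v) by lra.
  by apply: h => t _; rewrite subr_ge0.
have low u v : u <= v -> mu * (v - u) <= ell u v.
  move=> uv; have := @rderiv_nondecr R (fun t => m t - mu * t) (fun t => dm t - mu * 1) _ _ uv.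
  move=> h; suff : m u - mu * u <= m v - mu * v by rewrite /ell; lra.
  by apply: h => t _; rewrite mulr1 subr_ge0.
have step u v : inv u v -> inv (c u) (c v) /\ `|H (c u) - H (c v)| <= e + A * (ell u v - ell (c u) (c v)).
  move=> uv; have cuv := c_mono uv; split=> //.
  have h1 := contr u v uv; have h2 := low _ _ cuv; have h3 := ell0 _ _ cuv.
  have h4 : kap * ell (c u) (c v) <= ell u v - ell (c u) (c v) by move: h1; rewrite mulrDl mul1r; lra.
  have h5 : 0 <= ell u v - ell (c u) (c v) by apply: le_trans h4; rewrite mulr_ge0 // ltW.
  have [h|h] := ltP (c v - c u) dl.
    have : `|H (c u) - H (c v)| <= e by apply: hdl; rewrite distrC ger0_norm // subr_ge0.
    by have := mulr_ge0 A0 h5; lra.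
  have : `|H (c u) - H (c v)| <= 2 * M.
    by apply: (le_trans (ler_normB _ _)); have := hM (c u); have := hM (c v); lra.
  have h6 : kap * (mu * dl) <= ell u v - ell (c u) (c v).
    apply: le_trans h4; apply: ler_wpM2l; first exact: ltW.
    by apply: le_trans h2; apply: ler_wpM2l => //; exact: ltW.
  have : A * (kap * (mu * dl)) <= A * (ell u v - ell (c u) (c v)) by exact: ler_wpM2l.
  have -> : A * (kap * (mu * dl)) = 2 * M by rewrite /A divfK // gt_eqF // !mulr_gt0.
  by lra.
exists (A * tau) => n x s.
pose u := iter n b x.
(* [v] is the representative of [s] in [(u, u + tau]], so [ell u v <= tau] whatever [n] is. *)
have [k1 /andP[q1 q2]] := repr_period (u - s).
pose v := s + (k1 + 1)%:~R * tau.
have uv : u <= v /\ v <= u + tau.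
  by rewrite /v; move: q1 q2; rewrite intrD mulrDl mul1r; lra.
exists (iter n c v); split; first by rewrite iter_bc; exists (k1 + 1).
have := distortion A0 ell0 step n uv.1; rewrite {1}/u iter_cb => h.
have el : ell u v <= tau.
  have := ell0 _ _ uv.2; rewrite /ell m_per; lra.
have := ler_wpM2l A0 el; have := ler_norm (birk n x - birk n (iter n c v)).
by lra.
Qed.
End Elliptic.

(** * Shadowing around a neutral fixed point *)

Section Parabolic.
Variable l : R.
Hypothesis b0 : b 0 = 0.
Hypothesis db0 : db 0 = 1.
Hypothesis db_deriv0 : is_derive (0 : R) 1 db l.
Hypothesis l_ge0 : 0 <= l.
Hypothesis db_per : forall t, db (t + tau) = db t.
Let q (t : R) : R := 1 - cos t.
Hypothesis expand : forall t, 0 < q t -> q (b t) < db t * q t.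

Lemma q_per t : q (t + tau) = q t.
Proof. by rewrite /q cosD cos2pi sin2pi mulr1 mulr0 subr0. Qed.

Lemma q_cong s t : cong s t -> q s = q t.
Proof.
move=> [k ->]; have h u : q (u + tau) = q u + 0 by rewrite addr0 q_per.
by rewrite (per_int h) mul0rz addr0.
Qed.

Lemma q_ge0 t : 0 <= q t.
Proof. by rewrite subr_ge0 cos_le1. Qed.

Lemma q_le2 t : q t <= 2.
Proof. by rewrite /q; have := cos_geN1 t; lra. Qed.

Lemma q0 : q 0 = 0.
Proof. by rewrite /q cos0 subrr. Qed.

Lemma q_deriv (t : R) : is_derive t 1 q (sin t).
Proof.
apply: (rderiv_eq (rderivB (rderiv_cst 1 t) (is_derive_cos t))).
by rewrite opprK add0r.
Qed.

Lemma q_cont : rcont q.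
Proof. by move=> x; apply: rderiv_cont (q_deriv x). Qed.

Lemma q_gt0_base t : 0 < t < tau -> 0 < q t.
Proof.
move=> /andP[t0 t1]; rewrite /q.
have -> : t = (t / 2) *+ 2 by rewrite -mulr_natr divfK.
rewrite cos_mulr2n.
have s0 : 0 < sin (t / 2).
  by apply: sin_gt0_pi; move: t1; rewrite mulr2n; lra.
have := cos2Dsin2 (t / 2); have : 0 < sin (t / 2) ^+ 2 by rewrite exprn_gt0.
by rewrite mulr2n; lra.
Qed.

(** The lifts [k * tau] of the fixed point are the poles of the coordinate [xi] below; [xi]-lengths
    make sense only between two consecutive ones. *)
Definition same (k : int) (u v : R) := [/\ k%:~R * tau < u, u <= v & v < (k + 1)%:~R * tau].

Lemma q_gt0 (k : int) t : k%:~R * tau < t < (k + 1)%:~R * tau -> 0 < q t.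
Proof.
rewrite intrD mulrDl mul1r => h.
have -> : q t = q (t - k%:~R * tau) by apply: q_cong; exists k; rewrite subrK.
by apply: q_gt0_base; lra.
Qed.

Lemma same_q k u v t : same k u v -> u <= t <= v -> 0 < q t.
Proof.
move=> [h1 h2 h3] /andP[h4 h5]; apply: (@q_gt0 k).
by rewrite (lt_le_trans h1 h4) (le_lt_trans h5 h3).
Qed.

(** This is [- cot (t / 2)], the boundary coordinate of the half-plane with the fixed point at
    infinity. Its derivative is [1 / q], so [expand] says that [b] increases [xi]-lengths. *)
Let xi (t : R) : R := - sin t / q t.

Lemma xi_deriv (t : R) : 0 < q t -> is_derive t 1 xi (q t)^-1.
Proof.
move=> qt; have n0 : q t != 0 by rewrite gt_eqF.
have ds := rderivZ (-1) (is_derive_sin t).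
have -> : xi = (fun y => (-1 * sin y) * (q y)^-1) by apply/funext => y; rewrite /xi mulN1r.
apply: (rderiv_eq (rderivM ds (rderivV n0 (q_deriv t)))).
have E : sin t ^+ 2 = q t * (2 - q t) by rewrite sin2cos2 /q; ring.
have -> : cos t = 1 - q t by rewrite /q; ring.
have -> : -1 * (1 - q t) / q t + -1 * sin t * (- sin t / q t ^+ 2) = -1 * (1 - q t) / q t + sin t ^+ 2 / q t ^+ 2.
  by rewrite expr2; ring.
by rewrite E; field.
Qed.

Lemma xi_sqr t : 0 < q t -> 1 + xi t ^+ 2 = 2 / q t.
Proof.
move=> qt; have n0 : q t != 0 by rewrite gt_eqF.
have E : sin t ^+ 2 = q t * (2 - q t) by rewrite sin2cos2 /q; ring.
have -> : xi t ^+ 2 = sin t ^+ 2 / q t ^+ 2 by rewrite /xi expr_div_n sqrrN.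
by rewrite E; field.
Qed.

Lemma xi_low k u v : same k u v -> 2^-1 * (v - u) <= xi v - xi u.
Proof.
move=> suv; have [_ uv _] := suv.
have := @rderiv_nondecr R (fun t => xi t - 2^-1 * t) (fun t => (q t)^-1 - 2^-1 * 1) _ _ uv.
move=> h; suff : xi u - 2^-1 * u <= xi v - 2^-1 * v by lra.
apply: h => t ht; have qt := same_q suv ht.
  exact: rderivB (xi_deriv qt) (rderivZ 2^-1 (rderiv_id t)).
by rewrite mulr1 subr_ge0 lef_pV2 ?posrE // q_le2.
Qed.

Lemma b_int (k : int) : b (k%:~R * tau) = (k * d%:Z)%:~R * tau.
Proof.
by have := per_int b_per k 0; rewrite !add0r b0 add0r => ->; rewrite intrM -mulrA mulrzl.
Qed.

(** Multiples of [tau] go to multiples of [d * tau] under [b], so the index of the new interval is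
    the integer quotient of [k] by [d]. *)
Lemma same_step k u v : same k u v -> exists k', same k' (c u) (c v).
Proof.
move=> [h1 h2 h3]; exists (k %/ d%:Z)%Z.
have dp : (0 < d%:Z)%R by rewrite ltz_nat; exact: ltn_trans d2.
have e1 := divz_eq k d; have e2 := modz_ge0 k (lt0r_neq0 dp); have e3 := ltz_pmod k dp.
set k' := (k %/ d%:Z)%Z in e1 *.
split; [|exact: c_mono|].
  rewrite -[ltLHS]bK b_int; apply: c_incr; apply: le_lt_trans h1.
  by rewrite ler_pM2r ?tau_gt0 // ler_int; lia.
rewrite -[ltRHS]bK b_int; apply: c_incr; apply: (lt_le_trans h3).
rewrite ler_pM2r ?tau_gt0 // ler_int; nia.
Qed.

(** Serves with [kap = 1] everywhere and with a factor above 1 away from the fixed point. *)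
Lemma xi_contr (kap : R) k u v : same k u v -> 
  (forall t, c u <= t <= c v -> kap * q (b t) <= db t * q t) ->
  kap * (xi (c v) - xi (c u)) <= xi v - xi u.
Proof.
move=> suv hk; have [k' suv'] := same_step suv; have [_ cuv _] := suv'.
have := @rderiv_nondecr R (fun t => xi (b t) - kap * xi t) (fun t => (q (b t))^-1 * db t - kap * (q t)^-1) _ _ cuv.
rewrite !cK => h; suff : xi u - kap * xi (c u) <= xi v - kap * xi (c v) by lra.
have pos t : c u <= t <= c v -> 0 < q t /\ 0 < q (b t).
  move=> ht; split; first exact: same_q suv' ht.
  by apply: (same_q suv); case/andP: ht => /b_mono + /b_mono; rewrite !cK => -> ->.
apply: h => t ht; have [p1 p2] := pos t ht.
  exact: rderivB (rderiv_comp (xi_deriv p2) (b_deriv t)) (rderivZ kap (xi_deriv p1)).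
have := hk t ht; rewrite subr_ge0 -(ler_pM2r (mulr_gt0 p1 p2)).
have -> : kap / q t * (q t * q (b t)) = kap * q (b t) by field; rewrite gt_eqF.
by have -> : (q (b t))^-1 * db t * (q t * q (b t)) = db t * q t by field; rewrite gt_eqF.
Qed.

Lemma xi_contr1 k u v : same k u v -> xi (c v) - xi (c u) <= xi v - xi u.
Proof.
move=> suv; rewrite -[leLHS]mul1r; apply: (xi_contr suv) => t ht.
have [k' suv'] := same_step suv.
by rewrite mul1r ltW // expand // (same_q suv' ht).
Qed.

Lemma c0 : c 0 = 0. Proof. by rewrite -{1}b0 bK. Qed.

Lemma c_tau_lt : c tau < tau.
Proof.
have : tau < b tau.
  have := b_int 1; rewrite mul1r mul1r => ->; rewrite ltr_pMl ?tau_gt0 //.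
  by rewrite (ltr_int R 1); rewrite ltz_nat.
by move=> /c_incr; rewrite bK.
Qed.

(* Since b'' (0) = l >= 0, the neutral fixed point repels on its right side. *)
Lemma b_gt t : 0 < t < tau -> t < b t.
Proof.
move=> /andP[t0 tt]; have [h|h] := leP (c tau) t.
  by apply: lt_le_trans tt _; rewrite -(cK tau); exact: b_mono.
rewrite ltNge; apply/negP => bt.
(* [g] increases by [expand]. If [b t <= t], it is at most 0 at [t], hence at most some [- eta < 0]
   near 0, and [s - b s] would be at least of order [eta * s^2]. *)
pose g (s : R) := xi (b s) - xi s.
have inq s : 0 < s <= t -> [/\ 0 < q s, 0 < q (b s), 0 < b s & b s < tau].
  move=> /andP[s0 st].
  have bs0 : 0 < b s by rewrite -b0; exact: b_incr.
  have bs1 : b s < tau by rewrite -(cK tau); apply: b_incr; exact: le_lt_trans h.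
  by split=> //; apply: q_gt0_base; rewrite ?s0 ?bs0 // (le_lt_trans st).
have gincr s r : 0 < s -> s < r -> r <= t -> g s < g r.
  move=> s0 sr rt; apply: (@rderiv_incr R g (fun y => (q (b y))^-1 * db y - (q y)^-1)) => // y.
    move=> /andP[y1 y2]; have [|p1 p2 _ _] := inq y; first by rewrite (lt_le_trans s0 y1) (le_trans y2 rt).
    exact: rderivB (rderiv_comp (xi_deriv p2) (b_deriv y)) (xi_deriv p1).
  move=> /andP[y1 y2]; have [|p1 p2 _ _] := inq y; first by rewrite (lt_trans s0 y1) (le_trans (ltW y2) rt).
  rewrite subr_gt0 -(ltr_pM2r (mulr_gt0 p1 p2)).
  have -> : (q y)^-1 * (q y * q (b y)) = q (b y) by field; rewrite gt_eqF.
  have -> : (q (b y))^-1 * db y * (q y * q (b y)) = db y * q y by field; rewrite gt_eqF.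
  exact: expand.
have xi_le s r : 0 < s -> s <= r -> r < tau -> xi s <= xi r.
  move=> s0 sr r1; have ss : same 0 s r by split; rewrite ?mul0r ?add0r ?mul1r.
  by rewrite -subr_ge0; apply: le_trans (xi_low ss); rewrite mulr_ge0 // subr_ge0.
have gt0' : g t <= 0.
  by have [|p1 p2 p3 p4] := inq t; rewrite ?t0 ?lexx // subr_le0; apply: xi_le.
pose t1 := t / 2; have t10 : 0 < t1 by rewrite divr_gt0.
have t1t : t1 < t by rewrite /t1; lra.
pose eta := - g t1.
have eta0 : 0 < eta by rewrite oppr_gt0; apply: lt_le_trans gt0'; exact: gincr.
have sm s : 0 < s -> s <= t1 -> g s <= - eta.
  rewrite opprK => s0; rewrite le_eqVlt => /orP[/eqP ->//|st]; apply: ltW; apply: gincr => //; exact: ltW.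
have half0 : (0 : R) < 2^-1 by [].
have [r1 [r10 hr1]] := is_derive_eps (b_deriv 0) half0.
have [r2 [r20 hr2]] := is_derive_eps (is_derive_sin (0 : R)) half0.
(* Half of the coefficient in [k2]: since [l >= 0], the derivative of [db] at 0 allows only
   [s - b s <= eta / 32 * s^2]. *)
have e32 : 0 < eta / 32 by rewrite divr_gt0.
have [r3 [r30 hr3]] := is_derive_eps db_deriv0 e32.
pose s := Num.min t1 (Num.min (r1 / 2) (Num.min (r2 / 2) (r3 / 2))).
have s0 : 0 < s by rewrite !lt_min t10 !divr_gt0.
have [ss1 ss2 ss3 ss4] : [/\ s <= t1, s < r1, s < r2 & s < r3].
  have h1 : s <= r1 / 2 by rewrite /s !ge_min lexx !orbT.
  have h2 : s <= r2 / 2 by rewrite /s !ge_min lexx !orbT.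
  have h3 : s <= r3 / 2 by rewrite /s !ge_min lexx !orbT.
  by split; [rewrite /s ge_min lexx|lra|lra|lra].
clearbody s.
have gs := sm s s0 ss1.
have [|p1 p2 p3 p4] := inq s; first by rewrite s0 (le_trans ss1) // ltW.
have bs : b s < s.
  rewrite ltNge; apply/negP => hbs; have := xi_le s (b s) s0 hbs p4; move: gs; rewrite /g; lra.
have bs2 : s / 2 <= b s.
  have := hr1 s; rewrite subr0 b0 subr0 db0 mul1r (gtr0_norm s0) => /(_ ss2).
  by rewrite ler_norml; lra.
have qlow th : s / 2 <= th -> th <= s -> s ^+ 2 / 16 <= q th.
  move=> th1 th2; have th0 : 0 <= th by lra.
  have := @rderiv_nondecr R (fun y => q y - 4^-1 * (y * y)) (fun y => sin y - 4^-1 * (1 * y + y * 1)) _ _ th0.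
  rewrite q0 mulr0 mulr0 subr0 => hh.
  have : 0 <= q th - 4^-1 * (th * th).
    apply: hh => y /andP[y1 y2].
      exact: rderivB (q_deriv y) (rderivZ 4^-1 (rderivM (rderiv_id y) (rderiv_id y))).
    have := hr2 y; rewrite subr0 sin0 subr0 cos0 mul1r (ger0_norm y1) => /(_ (le_lt_trans y2 (le_lt_trans th2 ss3))).
    by rewrite ler_norml; lra.
  by move: th1; rewrite expr2; nra.
have [th [/andP[th1 th2] E1]] := @rderiv_MVT R xi (fun y => (q y)^-1) (b s) s bs
  (fun y hy => xi_deriv (q_gt0_base (t := y) ltac:(lra))).
have qth : s ^+ 2 / 16 <= q th by apply: qlow; lra.
have s2 : 0 < s ^+ 2 by rewrite exprn_gt0.
have qth0 : 0 < q th by lra.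
have k1 : eta * q th <= s - b s.
  rewrite -(divfK (lt0r_neq0 qth0) (s - b s)) ler_pM2r // [_ / _]mulrC -E1.
  by move: gs; rewrite /g; lra.
have k2 : eta * (s ^+ 2 / 16) <= s - b s by apply: le_trans k1; rewrite ler_pM2l.
have [ze [/andP[z1 z2] E2]] := @rderiv_MVT R (fun y => b y - y) (fun y => db y - 1) 0 s s0
  (fun y _ => rderivB (b_deriv y) (rderiv_id y)).
have := hr3 ze; rewrite subr0 db0 (gtr0_norm z1) => /(_ (lt_trans z2 ss4)).
rewrite ler_norml => /andP[k3 _].
move: E2; rewrite b0 !subr0 => E2.
have k4 : - (eta / 32 * s) <= db ze - 1.
  have : 0 <= l * ze by rewrite mulr_ge0 // ltW.
  have : eta / 32 * ze <= eta / 32 * s by rewrite ler_pM2l // ltW.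
  by lra.
have : - (eta / 32 * s) * s <= b s - s by rewrite E2; apply: ler_wpM2r => //; exact: ltW.
have : 0 < eta * s ^+ 2 by rewrite mulr_gt0.
by move: k2; rewrite expr2; lra.
Qed.

Lemma c_lt t : 0 < t < tau -> 0 < c t < t.
Proof.
move=> /andP[t0 t1]; have ct0 : 0 < c t by rewrite -c0; exact: c_incr.
rewrite ct0 /=; have ct1 : c t < tau by apply: lt_trans c_tau_lt; exact: c_incr.
by have := @b_gt (c t); rewrite cK; apply; rewrite ct0.
Qed.

Lemma iter_c_in n t : 0 < t < tau -> 0 < iter n c t < tau.
Proof.
move=> h; elim: n => //= n IH; have /andP[h1 h2] := c_lt IH.
by rewrite h1 (lt_trans h2) //; case/andP: IH.
Qed.

(** The iterates decrease; a positive infimum [L] would satisfy [L < b L], and one more step of [c]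
    would pass below it. *)
Lemma iter_c_small t (e : R) : 0 < t < tau -> 0 < e -> exists N, forall n, (N <= n)%N -> iter n c t < e.
Proof.
move=> ht e0; pose y n := iter n c t.
have yin n : 0 < y n < tau := iter_c_in n ht.
have ydec n : y n.+1 < y n by have /andP[] := c_lt (yin n).
have ymon m n : (m <= n)%N -> y n <= y m.
  by move=> /subnK <-; elim: (n - m)%N => // k IH; rewrite addSn; apply: le_trans (ltW (ydec _)) IH.
pose L := inf (range y).
have hl : has_inf (range y).
  by split; [exists (y 0%N); exists 0%N|exists 0 => _ [k _ <-]; case/andP: (yin k) => /ltW].
have L0 : 0 <= L by apply: lb_le_inf; [case: hl|move=> _ [k _ <-]; case/andP: (yin k) => /ltW].
have Ly n : L <= y n by apply: ge_inf; [case: hl|exists n].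
have infl z : L < z -> exists n, y n < z.
  move=> Lz; apply: contrapT => hn; move: Lz; rewrite ltNge => /negP; apply.
  apply: lb_le_inf; first by case: hl.
  by move=> _ [k _ <-]; rewrite leNgt; apply/negP => hk; apply: hn; exists k.
suff [N hN] : exists N, y N < e by exists N => n /ymon h; exact: le_lt_trans h hN.
have Lz : L = 0.
  apply/eqP; rewrite eq_le L0 andbT leNgt; apply/negP => Lp.
  have Lt : L < tau by apply: (le_lt_trans (Ly 0%N)); case/andP: (yin 0%N).
  have : L < b L by apply: b_gt; rewrite Lp.
  move=> /infl [n hn].
  have : y n.+1 < L by rewrite /y iterS -/(y n) -[ltRHS]bK; exact: c_incr.
  by rewrite ltNge Ly.
have : L < e by rewrite Lz.
exact: infl.
Qed.

(** The interval from [c (tau / 2)] to [c (3 / 2 * tau)] covers a full period under [b] and stays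
    away from the lifts of the fixed point. Thus one step leads from the zone to any prescribed
    target. *)
Lemma preimage_zone : exists z : R, 0 < z /\ forall s, exists s', [/\ 0 < s' < tau, z <= q s' & cong (b s') s].
Proof.
have tp := tau_gt0.
pose a1 := c (tau / 2); pose a2 := c (3 / 2 * tau).
have a10 : 0 < a1 by rewrite -c0; apply: c_incr; lra.
have a2t : a2 < tau.
  apply: (@lt_le_trans _ _ (c (2 * tau))); first by apply: c_incr; lra.
  rewrite -[leRHS]bK; apply: c_mono; have := b_int 1; rewrite mul1r mul1r => ->.
  by rewrite ler_pM2r // -[2]/(2%:~R) ler_int lez_nat.
have a12 : a1 <= a2 by apply: c_mono; lra.
have [z [z0 hz]] := @itv_pos_bound R (fun=> True) q a1 a2 q_cont a12
  (fun x hx => or_introl (q_gt0_base (t := x) ltac:(lra))).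
exists z; split=> // s; have [s0 [/andP[h1 h2] hs]] := cong_repr s.
have fin s' : a1 <= s' <= a2 -> cong (b s') s0 -> exists s', [/\ 0 < s' < tau, z <= q s' & cong (b s') s].
  move=> h3 h4; exists s'; split; [lra|exact: hz|].
  exact: cong_trans h4 (cong_sym hs).
have [h|h] := leP s0 (tau / 2).
  apply: (fin (c (s0 + tau))); last by rewrite cK; exists 1; rewrite mul1r.
  by apply/andP; split; apply: c_mono; lra.
apply: (fin (c s0)); last by rewrite cK; exact: cong_refl.
by apply/andP; split; apply: c_mono; lra.
Qed.

Lemma H_near0 (e : R) : 0 < e -> exists z : R, 0 < z /\ forall t, q t < z -> `|H t - H 0| <= e.
Proof.
move=> e0; have tp := tau_gt0.
suff [z [z0 hz]] : exists z : R, 0 < z /\ forall t, 0 <= t <= tau -> q t < z -> `|H t - H 0| <= e.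
  exists z; split=> // t; have [s [/andP[s0 s1] ts]] := cong_repr t.
  by rewrite (q_cong ts) (H_cong ts); apply: hz; rewrite s0 ltW.
apply: (@itv_bisection R (fun a1 a2 => exists z : R, 0 < z /\ forall t, a1 <= t <= a2 -> q t < z -> `|H t - H 0| <= e)).
- exact: ltW.
- move=> x y _ [z1 [z10 h1]] [z2 [z20 h2]]; exists (Num.min z1 z2); split; first by rewrite lt_min z10.
  move=> t /andP[t1 t2]; rewrite lt_min => /andP[k1 k2]; case: (leP t ((x + y) / 2)) => ht.
    by apply: h1 => //; rewrite t1.
  by apply: h2 => //; rewrite t2 ltW.
- move=> x /andP[x0 x1].
  have [hx|hx] : (0 < x < tau) \/ H x = H 0.
  + have [->|nx] := eqVneq x 0; first by right.
    have [->|ny] := eqVneq x tau; first by right; rewrite -[in LHS](add0r tau) H_per.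
    by left; rewrite !lt_neqAle x0 x1 ny eq_sym nx.
  + have qx := q_gt0_base hx; have q2 : 0 < q x / 2 by rewrite divr_gt0.
    have [r [r0 hr]] := q_cont x q2; exists r; split=> // a1 a2 _ _ ha s; exists (q x / 2); split=> // t ht qt.
    have /hr : `|t - x| < r by rewrite ltr_norml; lra.
    by rewrite ltr_norml; lra.
  + have [r [r0 hr]] := H_cont x e0; exists r; split=> // a1 a2 _ _ ha s; exists 1; split=> // t ht _.
    by rewrite -hx ltW //; apply: hr; rewrite ltr_norml; lra.
Qed.

Lemma expand_zone (z : R) : 0 < z -> exists kap : R, 0 < kap /\
  forall t, z <= q t -> (1 + kap) * q (b t) <= db t * q t.
Proof.
move=> z0; have tp := tau_gt0.
have cf : rcont (fun t => db t * q t - q (b t)).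
  exact: rcontB (rcontM db_cont q_cont) (rcont_comp q_cont b_cont).
have [g [g0 hg]] := @itv_pos_bound R (fun t => z <= q t) (fun t => db t * q t - q (b t)) 0 tau cf (ltW tp)
  (fun x _ => ltac:(have [h|h] := ltP (q x) z; [right|left; by rewrite subr_gt0; apply: expand; exact: lt_le_trans h];
    have hh : 0 < z - q x by [rewrite subr_gt0]; have [r [r0 hr]] := q_cont x hh;
    exists r; split=> // y /hr hy hz; move: hy; rewrite ltr_norml; lra)).
(* Half of [g], because [q <= 2]. *)
exists (g / 2); split; first by rewrite divr_gt0.
move=> t; have [s [/andP[s0 s1] ts]] := cong_repr t.
have dbs : db t = db s.
  case: ts => k ->; have h u : db (u + tau) = db u + 0 by rewrite addr0 db_per.
  by rewrite (per_int h) mul0rz addr0.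
rewrite dbs (q_cong ts) (q_cong (cong_b ts)) => zs.
have := hg s; rewrite s0 (ltW s1) => /(_ isT zs) h.
have := q_le2 (b s); have := q_ge0 (b s) => h1 h2; nra.
Qed.

Lemma xi_bound (z t : R) : 0 < z -> z <= q t -> `|xi t| <= 2 / z + 1.
Proof.
move=> z0 zq; have qt : 0 < q t by exact: lt_le_trans zq.
have := xi_sqr qt => h.
have h2 : 2 / q t <= 2 / z by rewrite ler_pM2l // lef_pV2.
have k0 : 0 < 2 / z by rewrite divr_gt0.
have h3 : xi t ^+ 2 <= 2 / z by have := sqr_ge0 (xi t); lra.
rewrite -(ler_pXn2r (n := 2)) ?nnegrE ?normr_ge0 ?addr_ge0 ?ltW //.
rewrite real_normK ?num_real // sqrrD1; have := sqr_ge0 (2 / z); rewrite mulr2n; lra.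
Qed.

Lemma q_from_xi (x t : R) : 0 < q t -> `|xi t| <= x -> 2 / (1 + x ^+ 2) <= q t.
Proof.
move=> qt hx; have h := xi_sqr qt.
have x0 : 0 <= x by exact: le_trans hx.
have h2 : xi t ^+ 2 <= x ^+ 2 by rewrite -[xi t ^+ 2]real_normK ?num_real // ler_pXn2r ?nnegrE.
have p : 0 < 1 + x ^+ 2 by rewrite ltr_pwDl // sqr_ge0.
rewrite ler_pdivrMr //; have : 2 / q t <= 1 + x ^+ 2 by lra.
by rewrite ler_pdivrMr // mulrC.
Qed.

(** Contraction is not uniform near the fixed point, but there [H] is nearly [H 0] at both ends.
    Otherwise the pulled-back interval contains a point with [q >= z1], and its bounded [xi]-length
    keeps all of it where [expand_zone] applies. *)
Lemma zone_distortion (z e : R) : 0 < z -> 0 < e -> exists J : R,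
  forall n k u v, same k u v -> z <= q u -> z <= q v ->
    `|birk n (iter n c u) - birk n (iter n c v)| <= n%:R * e + J.
Proof.
move=> z0 e0; have [M hM] := H_bounded; have [dl [dl0 hdl]] := H_unif e0.
have M0 : 0 <= M by apply: le_trans (hM 0).
have e2 : 0 < e / 2 by rewrite divr_gt0.
have [z1 [z10 hz1]] := H_near0 e2.
(* Bounds the [xi]-length of an interval with both ends in the zone of [z]; this length does not
   grow under [c]. *)
pose D := 2 * (2 / z + 1); have D0 : 0 < D by rewrite mulr_gt0 // ltr_wpDl // ltW // divr_gt0.
(* An interval of [xi]-length at most [D] that meets [q >= z1] has [|xi| <= X] throughout. *)
pose X := 2 / z1 + 1 + D.
have X0 : 0 <= X by rewrite !addr_ge0 // ltW // divr_gt0.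
have z20 : 0 < 2 / (1 + X ^+ 2) by rewrite divr_gt0 // ltr_pwDl // sqr_ge0.
have [kap [kap0 hkap]] := expand_zone z20.
pose ell (u v : R) := xi v - xi u.
pose inv (u v : R) := (exists k, same k u v) /\ ell u v <= D.
pose A := 2 * M / (kap * (dl / 2)).
have kd : 0 < kap * (dl / 2) by rewrite mulr_gt0 // divr_gt0.
have A0 : 0 <= A by rewrite divr_ge0 ?mulr_ge0 // ltW.
have ell0' k u v : same k u v -> 0 <= ell u v.
  by move=> s; apply: le_trans (xi_low s); case: s => _ h _; rewrite mulr_ge0 // subr_ge0.
have ell0 u v : inv u v -> 0 <= ell u v by move=> [[k s] _]; exact: ell0' s.
have step u v : inv u v -> inv (c u) (c v) /\ `|H (c u) - H (c v)| <= e + A * (ell u v - ell (c u) (c v)).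
  move=> [[k s] lD]; have [k' s'] := same_step s; have h1 := xi_contr1 s.
  have lD' : ell (c u) (c v) <= D by exact: le_trans lD.
  split; first by split=> //; exists k'.
  have h5 : 0 <= A * (ell u v - ell (c u) (c v)) by rewrite mulr_ge0 // subr_ge0.
  have cuv : c u <= c v by case: s'.
  have [[hu hv]|[w hw qw]] : (q (c u) < z1 /\ q (c v) < z1) \/ (exists2 w, c u <= w <= c v & z1 <= q w).
  - have [hu|hu] := ltP (q (c u)) z1; last by right; exists (c u) => //; rewrite cuv lexx.
    have [hv|hv] := ltP (q (c v)) z1; last by right; exists (c v) => //; rewrite cuv lexx.
    by left.
  - have := hz1 _ hu; have := hz1 _ hv => k1 k2.
    have := ler_normB (H (c u) - H 0) (H (c v) - H 0).
    have -> : H (c u) - H 0 - (H (c v) - H 0) = H (c u) - H (c v) by ring.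
    by lra.
  have xw := xi_bound z10 qw.
  have near y : c u <= y <= c v -> 2 / (1 + X ^+ 2) <= q y.
    move=> hy; apply: q_from_xi; first exact: same_q s' hy.
    have m1 : same k' (c u) y by case: s' => i1 i2 i3; case/andP: hy => j1 j2; split=> //; exact: le_lt_trans i3.
    have m2 : same k' y (c v) by case: s' => i1 i2 i3; case/andP: hy => j1 j2; split=> //; exact: lt_le_trans j1.
    have m3 : same k' (c u) w by case: s' => i1 i2 i3; case/andP: hw => j1 j2; split=> //; exact: le_lt_trans i3.
    have m4 : same k' w (c v) by case: s' => i1 i2 i3; case/andP: hw => j1 j2; split=> //; exact: lt_le_trans j1.
    have := ell0' _ _ _ m1; have := ell0' _ _ _ m2; have := ell0' _ _ _ m3; have := ell0' _ _ _ m4.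
    by move: lD' xw; rewrite /ell /X !ler_norml; lra.
  have h2 := xi_contr s (fun t ht => hkap t (near t ht)).
  have h3 : kap * ell (c u) (c v) <= ell u v - ell (c u) (c v) by move: h2; rewrite mulrDl mul1r /ell; lra.
  have h4 := xi_low s'.
  have [h|h] := ltP (c v - c u) dl.
    have : `|H (c u) - H (c v)| <= e by apply: hdl; rewrite distrC ger0_norm // subr_ge0.
    by lra.
  have k2 : `|H (c u) - H (c v)| <= 2 * M.
    by apply: (le_trans (ler_normB _ _)); have := hM (c u); have := hM (c v); lra.
  have h6 : kap * (dl / 2) <= ell u v - ell (c u) (c v).
    by apply: le_trans h3; apply: ler_wpM2l; [exact: ltW|rewrite /ell; lra].
  have := ler_wpM2l A0 h6.
  have -> : A * (kap * (dl / 2)) = 2 * M by rewrite /A divfK // gt_eqF.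
  by lra.
exists (A * D) => n k u v s qu qv.
have iuv : inv u v.
  split; first by exists k.
  by have := xi_bound z0 qu; have := xi_bound z0 qv; rewrite /ell /D !ler_norml; lra.
apply: (le_trans (distortion A0 ell0 step n iuv)).
by rewrite lerD2l; apply: ler_wpM2l => //; case: iuv.
Qed.

(** Backward orbits under [c] descend from [(0, tau)] to the fixed point. By monotonicity the orbit
    of [tau - al] dominates those of all points of the zone, so a single [N] works for them. *)
Lemma orbit_to0 (z e : R) : 0 < z -> 0 < e -> exists J : R,
  forall n s, 0 < s < tau -> z <= q s -> n%:R * (H 0 - e) - J <= birk n (iter n c s).
Proof.
move=> z0 e0; have tp := tau_gt0; have [M hM] := H_bounded; have [z1 [z10 hz1]] := H_near0 e0.
have M0 : 0 <= M by apply: le_trans (hM 0).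
have [r [r0 hr]] := q_cont tau z0.
have qtau : q tau = 0 by have := q_per 0; rewrite add0r q0.
pose al := Num.min r tau / 2.
have al0 : 0 < al by rewrite divr_gt0 // lt_min r0.
have alr : al < r by rewrite /al; have : Num.min r tau <= r by [rewrite ge_min lexx]; lra.
have alt : al < tau by rewrite /al; have : Num.min r tau <= tau by [rewrite ge_min lexx orbT]; lra.
have smax s : 0 < s < tau -> z <= q s -> s <= tau - al.
  move=> hs qs; rewrite leNgt; apply/negP => hl.
  have /hr : `|s - tau| < r by rewrite ltr_norml; lra.
  by rewrite qtau subr0 ltr_norml; lra.
have [r1 [r10 hr1]] := q_cont 0 z10.
have ta : 0 < tau - al < tau by lra.
have [N hN] := iter_c_small ta r10.
have mon n s t : s <= t -> iter n c s <= iter n c t by move=> st; elim: n => //= n IH; exact: c_mono.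
have good n s : 0 < s < tau -> z <= q s -> (N <= n)%N -> H 0 - e <= H (iter n c s).
  move=> hs qs /hN hn; have /andP[i1 i2] := iter_c_in n hs.
  have i3 : iter n c s <= iter n c (tau - al) by apply: mon; exact: smax.
  have /hr1 : `|iter n c s - 0| < r1 by rewrite subr0 gtr0_norm //; exact: le_lt_trans hn.
  rewrite q0 subr0 ltr_norml => /andP[_ /hz1]; rewrite ler_norml; lra.
exists (N%:R * (2 * M)) => n s hs qs.
suff : n%:R * (H 0 - e) - (minn n N)%:R * (2 * M) <= birk n (iter n c s).
  apply: le_trans; rewrite lerD2l lerN2; apply: ler_wpM2r; first by rewrite mulr_ge0.
  by rewrite ler_nat geq_minr.
elim: n => [|n IH]; first by rewrite min0n !mul0r subrr.
have -> : birk n.+1 (iter n.+1 c s) = H (iter n.+1 c s) + birk n (iter n c s) by rewrite /= cK.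
have [h|h] := leqP N n.+1.
  have := good n.+1 s hs qs h; rewrite -natr1 mulrDl mul1r.
  have : (minn n N)%:R * (2 * M) <= N%:R * (2 * M).
    by apply: ler_wpM2r; rewrite ?mulr_ge0 // ler_nat geq_minr.
  by lra.
move: IH; rewrite (minn_idPl (ltnW (ltnW h))) -natr1 !mulrDl !mul1r => IH.
have := hM (iter n.+1 c s); have := hM 0; rewrite !ler_norml; lra.
Qed.

(** The index 0 is exempt: the sum starts at the last visit outside the neighbourhood of the fixed
    point, and this term costs up to [2 * M]. *)
Lemma tail_sum (e : R) n y M : 0 <= e -> (forall t, `|H t| <= M) ->
  (forall i, (0 < i < n)%N -> `|H (iter i b y) - H 0| <= e) -> birk n y <= n%:R * (H 0 + e) + 2 * M.
Proof.
move=> e0 hM; have M0 : 0 <= M by apply: le_trans (hM 0).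
elim: n => [|n IH] h; first by rewrite mul0r add0r mulr_ge0.
rewrite birk_last -natr1 mulrDl mul1r; case: n IH h => [|n] IH h.
  by rewrite /= mul0r !add0r; have := hM y; have := hM 0; rewrite !ler_norml; lra.
have := h n.+1; rewrite ltnSn => /(_ isT); rewrite ler_norml => h1.
have := IH (fun i => ltac:(by move=> /andP[i1 i2]; apply: h; rewrite i1 (ltn_trans i2))); lra.
Qed.

Lemma last_index (p : nat -> bool) n :
  (forall i, (0 < i <= n)%N -> p i) \/
  exists j, [/\ (0 < j <= n)%N, ~~ p j & forall i, (j < i <= n)%N -> p i].
Proof.
elim: n => [|n [IH|[j [h1 h2 h3]]]]; first by left=> i /andP[]; case: i.
  case pn: (p n.+1).
    by left=> i /andP[i1]; rewrite leq_eqVlt => /orP[/eqP ->//|i2]; apply: IH; rewrite i1.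
  right; exists n.+1; rewrite pn leqnn; split=> // i /andP[i1 i2].
  by move: (leq_trans i1 i2); rewrite ltnn.
case pn: (p n.+1).
  right; exists j; split=> //; first by case/andP: h1 => -> /leqW.
  by move=> i /andP[i1]; rewrite leq_eqVlt => /orP[/eqP ->//|i2]; apply: h3; rewrite i1.
right; exists n.+1; rewrite pn leqnn; split=> // i /andP[i1 i2].
by move: (leq_trans i1 i2); rewrite ltnn.
Qed.

(** Cut the orbit of [x] at the last time [j] outside [q < z1]. Up to [j] a pull-back with
    controlled distortion follows it; afterwards its sum is nearly [k * H 0], which the backward
    orbit of [s] under [c] matches. A preimage in the zone joins the two pieces. *)
Lemma parabolic_shadowing_right : shadowing.
Proof.
move=> e4 e40; pose e := e4 / 2; have e0 : 0 < e by rewrite divr_gt0.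
have [M hM] := H_bounded; have M0 : 0 <= M by apply: le_trans (hM 0).
have [z1 [z10 hz1]] := H_near0 e0.
have [z2 [z20 hz2]] := preimage_zone.
pose z := Num.min z1 z2; have z0 : 0 < z by rewrite lt_min z10.
have zz1 : z <= z1 by rewrite ge_min lexx.
have zz2 : z <= z2 by rewrite ge_min lexx orbT.
have [J1 hJ1] := zone_distortion z0 e0.
have [J2 hJ2] := orbit_to0 z0 e0.
have J10 : 0 <= J1.
  have [s' [h1 h2 _]] := hz2 0.
  have ss : same 0 s' s' by split; rewrite ?mul0r ?add0r ?mul1r //; case/andP: h1.
  by have := hJ1 0%N _ _ _ ss (le_trans zz2 h2) (le_trans zz2 h2); rewrite /= subrr normr0 mul0r add0r.
(* Targets [s] in the zone come first; an arbitrary target costs one extra step through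
   [preimage_zone]. *)
have stepA n x s : 0 < s < tau -> z <= q s ->
  exists t, cong (iter n b t) s /\ birk n x <= birk n t + n%:R * (2 * e) + (J1 + J2 + 4 * M).
  move=> hs qs.
  have [h|[j [/andP[j0 jn] pj hj]]] := last_index (fun i => q (iter i b x) < z1) n.
    exists (iter n c s); split; first by rewrite iter_bc; exact: cong_refl.
    have h1 := hJ2 n s hs qs.
    have h2 : birk n x <= n%:R * (H 0 + e) + 2 * M.
      apply: tail_sum; [exact: ltW|exact: hM|].
      by move=> i /andP[i1 i2]; apply: hz1; apply: h; rewrite i1 ltnW.
    have : 0 <= n%:R * e :> R by rewrite mulr_ge0 // ltW.
    by lra.
  pose k := (n - j)%N; have nE : n = (j + k)%N by rewrite subnKC.
  have h1 := hJ2 k s hs qs; pose y := iter k c s.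
  have [y' [hy' qy' cy']] := hz2 y.
  pose v := iter j b x.
  have qv : z1 <= q v by rewrite leNgt.
  have [i /andP[i1 i2]] := repr_period v.
  have i1' : i%:~R * tau < v.
    rewrite lt_neqAle i1 andbT; apply/eqP => iv.
    have : q v = 0 by rewrite -q0; apply: q_cong; exists i; rewrite add0r.
    by move=> qv0; move: qv; rewrite qv0; lra.
  pose u := y' + i%:~R * tau.
  have cu : cong u y' by exists i.
  have qu : z <= q u by rewrite (q_cong cu) (le_trans zz2).
  have u1 : i%:~R * tau < u by rewrite /u; lra.
  have u2 : u < (i + 1)%:~R * tau by rewrite /u intrD mulrDl mul1r; lra.
  (* Joining [u] to [y] takes one application of [b], paid for by dropping the first step of [x]:
     only [j] of the [j.+1] initial steps are compared, and so [cv] ends at [b x]. *)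
  case: j j0 jn pj hj @k nE h1 @y cy' @v qv i1 i2 i1' => // j _ jn pj hj k nE h1 y cy' v qv i1 i2 i1'.
  have dist : `|birk j (iter j c u) - birk j (iter j c v)| <= j%:R * e + J1.
    have zv : z <= q v by exact: le_trans qv.
    have /orP[uv|vu] := le_total u v; first by apply: (hJ1 j i).
    by rewrite distrC; apply: (hJ1 j i).
  have cv : iter j c v = b x by rewrite /v iterSr iter_cb.
  exists (iter j c u); split.
    rewrite nE addnC iterD iterS iter_bc; apply: cong_trans (_ : cong (iter k b y) s).
      by apply: cong_iter; apply: cong_trans cy'; exact: cong_b.
    by rewrite iter_bc; exact: cong_refl.
  rewrite nE !birk_add.
  have h2 : birk k (iter j.+1 b x) <= k%:R * (H 0 + e) + 2 * M.
    apply: tail_sum; [exact: ltW|exact: hM|].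
    move=> i' /andP[a1 a2]; apply: hz1; rewrite -iterD; apply: hj.
    by rewrite nE addnC -[X in (X < _)%N]addn0 ltn_add2l a1 leq_add2l ltnW.
  have -> : birk k (iter j.+1 b (iter j c u)) = birk k y.
    by apply: birk_cong; rewrite iterS iter_bc; apply: cong_trans cy'; exact: cong_b.
  have -> : birk j.+1 x = H x + birk j (iter j c v) by rewrite /= cv.
  rewrite birk_last iter_bc natrD -(natr1 j).
  have := hM x; have := hM u; rewrite !ler_norml => b1 b2.
  move: dist; rewrite ler_norml => /andP[b3 _].
  have : 0 <= j%:R * e :> R by rewrite mulr_ge0 // ltW.
  have := h1; rewrite -/y; lra.
exists (J1 + J2 + 4 * M + 2 * M) => n x s; case: n => [|n].
  have h := hM 0; exists s; split; first exact: cong_refl.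
  have [s' [h1 h2 _]] := hz2 0; have := hJ2 0%N s' h1 (le_trans zz2 h2); rewrite /= mul0r; lra.
have [s' [hs' qs' cs']] := hz2 s.
have [t [ht hb]] := stepA n x s' hs' (le_trans zz2 qs').
exists t; split.
  by rewrite iterS; apply: cong_trans cs'; exact: cong_b.
rewrite !birk_last -natr1.
have := hM (iter n b x); have := hM (iter n b t); rewrite !ler_norml.
move: hb; have -> : 2 * e = e4 by rewrite /e; field.
by lra.
Qed.
End Parabolic.

End Dynamics.

Section ParabolicReflection.
Variable R : realType.
Variables (b c db H : R -> R) (d : nat) (l : R).
Local Notation tau := (@pi R *+ 2).

(** For [l < 0] the repelling side is the left one; conjugation by [t -> - t] turns [l] into
    [- l]. *)
Lemma parabolic_shadowing :
  (2 <= d)%N -> (forall t : R, is_derive t 1 b (db t)) -> (forall s t, s < t -> b s < b t) ->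
  cancel b c -> cancel c b -> (forall t, b (t + tau) = b t + d%:R * tau) ->
  rcont db -> rcont H -> (forall t, H (t + tau) = H t) ->
  b 0 = 0 -> db 0 = 1 -> is_derive (0 : R) 1 db l -> (forall t, db (t + tau) = db t) ->
  (forall t, 0 < 1 - cos t -> 1 - cos (b t) < db t * (1 - cos t)) -> shadowing b H.
Proof.
move=> d2 bd bi bK cK bp dbc Hc Hp b0 db0 dl dbp ex.
have [l0|l0] := leP 0 l.
  exact: (@parabolic_shadowing_right R b c db H d d2 bd bi bK cK bp dbc Hc Hp l).
pose b' t := - b (- t); pose c' t := - c (- t); pose db' t := db (- t); pose H' t := H (- t).
have rN (f : R -> R) : rcont f -> rcont (fun t => f (- t)).
  move=> cf x e e0; have [r [r0 hr]] := cf (- x) e e0; exists r; split=> // y hy; apply: hr.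
  by rewrite -opprD normrN.
have dN (t : R) : is_derive t 1 (fun y : R => - y) (-1).
  have := rderivB (rderiv_cst 0 t) (rderiv_id t); rewrite sub0r.
  by have -> : (fun y : R => 0 - y) = (fun y => - y) by apply/funext => y; rewrite sub0r.
have bdN (t : R) : is_derive t 1 b' (db' t).
  have := rderivZ (-1) (rderiv_comp (g := fun y : R => - y) (bd (- t)) (dN t)).
  rewrite mulrN1 mulN1r opprK.
  by have -> : (fun y => -1 * b (- y)) = b' by apply/funext => y; rewrite mulN1r.
have perN (f : R -> R) g : (forall t, f (t + tau) = f t + g) -> forall t, f (- (t + tau)) = f (- t) - g.
  by move=> hf t; rewrite -[in RHS](subrK tau (- t)) hf addrK opprD.
have Sh : shadowing b' H'.
  apply: (@parabolic_shadowing_right R b' c' db' H' d d2 _ _ _ _ _ _ _ _ (- l)) => //.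
  - by move=> s t st; rewrite /b' ltrN2; apply: bi; rewrite ltrN2.
  - by move=> t; rewrite /b' /c' opprK bK opprK.
  - by move=> t; rewrite /b' /c' opprK cK opprK.
  - by move=> t; rewrite /b' (perN _ _ bp) opprB addrC.
  - exact: rN.
  - exact: rN.
  - by move=> t; rewrite /H' (perN H 0) ?subr0 // => u; rewrite addr0.
  - by rewrite /b' oppr0 b0 oppr0.
  - by rewrite /db' oppr0.
  - have dl0 : is_derive (- 0 : R) 1 db l by rewrite oppr0.
    have := rderiv_comp (g := fun y : R => - y) dl0 (dN 0).
    by rewrite mulrN1.
  - by rewrite oppr_ge0 ltW.
  - by move=> t; rewrite /db' (perN db 0) ?subr0 // => u; rewrite addr0.
  - by move=> t; rewrite /b' /db' cosN -(cosN t) => /ex.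
have itN n t : iter n b' t = - iter n b (- t).
  by elim: n => [|n IH]; rewrite ?opprK // !iterS IH /b' opprK.
have bkN n t : birk b' H' n t = birk b H n (- t).
  by elim: n t => // n IH t; rewrite /= IH /b' opprK.
move=> e e0; have [J hJ] := Sh e e0; exists J => n x s.
have [t [[k ht] hb]] := hJ n (- x) (- s); exists (- t); split; last by move: hb; rewrite !bkN opprK.
move: ht; rewrite itN => /(congr1 -%R); rewrite opprK opprD opprK => ->.
by exists (- k); rewrite mulrNz mulNr.
Qed.
End ParabolicReflection.

Section LiftInverse.
Variable R : realType.
Local Notation tau := (@pi R *+ 2).

Lemma lift_inverse (b : R -> R) (d : nat) : (0 < d)%N -> rcont b -> (forall s t, s < t -> b s < b t) ->
  (forall t, b (t + tau) = b t + d%:R * tau) -> exists c, cancel b c /\ cancel c b.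
Proof.
move=> d0 cb bi bp; have tp := @tau_gt0 R.
have bm s t : s <= t -> b s <= b t by rewrite le_eqVlt => /orP[/eqP ->//|/bi/ltW].
have bint := per_int bp.
have ex y : exists x, b x = y.
  pose k := (Num.trunc (`|y - b 0| / (d%:R * tau))).+1.
  have dt : 0 < d%:R * tau by rewrite mulr_gt0 // ltr0n.
  have hk : `|y - b 0| < k%:R * (d%:R * tau) by rewrite -ltr_pdivrMr // truncnS_gt.
  have e1 : b (k%:R * tau) = b 0 + k%:R * (d%:R * tau).
    by have := bint k 0; rewrite add0r => ->; rewrite -mulrzl.
  have e2 : b (- (k%:R * tau)) = b 0 - k%:R * (d%:R * tau).
    by have := bint (- k%:Z) 0; rewrite add0r mulrNz mulNr => ->; rewrite mulrNz -mulrzl.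
  have kt : 0 <= k%:R * tau by rewrite mulr_ge0 // ltW.
  have le : - (k%:R * tau) <= k%:R * tau by lra.
  have cw : {within `[- (k%:R * tau), k%:R * tau], continuous b}.
    by apply: continuous_subspaceT => x; apply: eps_continuous; exact: cb.
  have [|x _ hx] := @IVT R b _ _ y le cw; last by exists x.
  move: hk; rewrite ltr_norml e1 e2 => hk.
  by rewrite ge_min le_max; apply/andP; split; apply/orP; [left|right]; lra.
have [c hc] := choice ex; exists c; split=> // x.
have h := hc (b x); apply/eqP; rewrite eq_le !leNgt; apply/andP; split; apply/negP => /bi; rewrite h ltxx //.
Qed.
End LiftInverse.

(** * Shadowing on the circle *)

Section Circle.
Variable R : realType.
Local Notation C := R[i].
Local Notation tau := (@pi R *+ 2).

Lemma expi_surj (z : C) : cabs z = 1 -> exists t, expi t = z.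
Proof.
case: z => x y h; have h2 : x ^+ 2 + y ^+ 2 = 1 by have := cabs_sqr (x +i* y); rewrite h expr1n.
have x1 : -1 <= x <= 1.
  by rewrite -ler_norml -(@ler_pXn2r _ 2) ?nnegrE // expr1n real_normK ?num_real // -h2 lerDl sqr_ge0.
have s2 : Num.sqrt (1 - x ^+ 2) = `|y|.
  have -> : 1 - x ^+ 2 = y ^+ 2 by rewrite -h2 addrC addKr.
  by rewrite sqrtr_sqr.
have [y0|y0] := leP 0 y.
  by exists (acos x); rewrite /expi acosK // sin_acos // s2 ger0_norm.
by exists (- acos x); rewrite /expi cosN sinN acosK // sin_acos // s2 ltr0_norm // opprK.
Qed.

Lemma expi_cong (s t : R) : cong s t -> expi s = expi t.
Proof.
move=> [k ->]; have h u : expi (u + tau) = expi u + 0 by rewrite addr0 expiD expi2pi mulr1.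
by have := per_int h k t; rewrite mul0rz addr0.
Qed.

Lemma expi_neq (s t : R) : 0 < t - s < tau -> expi s != expi t.
Proof.
move=> /q_gt0_base h; apply/eqP => E.
have E1 : expi (t - s) = 1 :> C.
  have n0 : expi s != 0 :> C by rewrite -cabs_gt0 cabs_expi.
  by apply: (mulIf n0); rewrite -expiD subrK mul1r.
by move: h; case: E1 => -> _; rewrite subrr ltxx.
Qed.

Lemma cabs_one_sub_expi (t : R) : cabs (1 - expi t) ^+ 2 = 2 * (1 - cos t).
Proof.
rewrite cabs_sqr /=; have -> : (0 - sin t) ^+ 2 = 1 - cos t ^+ 2 by rewrite sub0r sqrrN sin2cos2.
by ring.
Qed.

Lemma expiN_conj (t : R) : (expi t)^* = expi (- t).
Proof. by rewrite /expi conjE cosN sinN. Qed.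
End Circle.

Section CircleShadowing.
Variables (R : realType) (d : nat) (theta : R) (a : 'I_d -> R[i]) (w : R[i] -> R[i]).
Hypothesis d2 : (2 <= d)%N.
Hypothesis ha : forall j, cabs (a j) < 1.
Hypothesis wA : disc_alg w.
Hypothesis wT : forall z, cabs z = 1 -> w z != 0.
Local Notation C := R[i].
Local Notation B := (blaschke theta a).
Local Notation tau := (@pi R *+ 2).
Local Notation b := (blasch_lift theta a).
Local Notation db := (blasch_dlift a).

Fixpoint wprod n z : C := if n is m.+1 then w z * wprod m (B z) else 1.

Lemma iter_circle n z : cabs z = 1 -> cabs (iter n B z) = 1.
Proof. by move=> z1; elim: n => //= n; exact: blaschke_circle. Qed.

Lemma wprod_neq0 n z : cabs z = 1 -> wprod n z != 0.
Proof.
elim: n z => [|n IH] z z1 /=; first exact: oner_neq0.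
by rewrite mulf_neq0 ?wT // IH // blaschke_circle.
Qed.

(** The shift [t0] puts a fixed point on the circle at angle 0; the elliptic case takes [t0 = 0]. *)
Let weight (t0 t : R) : R := ln (cabs (w (expi (t0 + t)))).

Lemma cabs_w_cont t0 : rcont (fun t => cabs (w (expi (t0 + t)))).
Proof.
  move=> t e e0; have [_ cw _] := iffLR (disc_algP w) wA.
  have z1 : cabs (expi (t0 + t)) <= 1 by rewrite cabs_expi.
  have [r [r0 hr]] := cw _ z1 e e0; exists r; split=> // y hy.
  have := hr (expi (t0 + y)); rewrite cabs_expi => h.
  have k : cabs (w (expi (t0 + y)) - w (expi (t0 + t))) < e.
    by apply: h => //; apply: le_lt_trans (expi_lip _ _) _; rewrite opprD addrACA subrr add0r.
  rewrite ltr_norml; have := cabs_sub_ge (w (expi (t0 + y))) (w (expi (t0 + t))).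
  have := cabs_sub_ge (w (expi (t0 + t))) (w (expi (t0 + y))); rewrite [in X in _ <= X -> _]cabsB.
  by lra.
Qed.

Lemma weight_cont t0 : rcont (weight t0).
Proof.
have wc := cabs_w_cont t0.
move=> t e e0; apply: continuous_eps => //.
apply: (continuous_comp (f := fun t => cabs (w (expi (t0 + t)))) (g := @ln R)).
  by apply: eps_continuous; exact: wc.
by apply: continuous_ln; rewrite cabs_gt0 wT // cabs_expi.
Qed.

Lemma weight_per t0 t : weight t0 (t + tau) = weight t0 t.
Proof. by rewrite /weight addrA (expiD (t0 + t)) expi2pi mulr1. Qed.

Definition circle_shadowing := forall e : R, 0 < e -> exists N, forall n, (N <= n)%N ->
  forall x u, cabs x = 1 -> cabs u = 1 -> exists z, [/\ cabs z = 1, iter n B z = u &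
    cabs (wprod n x) <= cabs (wprod n z) * expR e ^+ n].

Lemma shadowing_circle (t0 : R) (b1 : R -> R) : (forall t, expi (t0 + b1 t) = B (expi (t0 + t))) ->
  shadowing b1 (weight t0) -> circle_shadowing.
Proof.
(* One half of [e] goes to the shadowing estimate, the other absorbs its constant [J] for large
   [n]. *)
move=> conj sh e e0; have e2 : 0 < e / 2 by rewrite divr_gt0.
have [J hJ] := sh _ e2; have [N hN] := eventually_eps J e2; exists N => n Nn x u x1 u1.
have itE m t : iter m B (expi (t0 + t)) = expi (t0 + iter m b1 t).
  by elim: m => //= m ->; rewrite conj.
have bkE m t : expR (birk b1 (weight t0) m t) = cabs (wprod m (expi (t0 + t))).
  elim: m t => [|m IH] t; first by rewrite [birk _ _ _ _]/= [wprod _ _]/= expR0 cabs1.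
  by rewrite /= expRD IH /weight lnK ?cabsM ?conj // posrE cabs_gt0 wT // cabs_expi.
have [s hs] := expi_surj u1; have [x' hx'] := expi_surj x1.
have [t [ct hb]] := hJ n (x' - t0) (s - t0).
exists (expi (t0 + t)); split; first exact: cabs_expi.
  rewrite itE -hs; apply: expi_cong; case: ct => k ->; exists k; ring.
have -> : x = expi (t0 + (x' - t0)) by rewrite addrC subrK.
rewrite -!bkE -expRM_natl -expRD ler_expR; have := hN n Nn.
by rewrite mulr_natl -mulr_natl; move: hb; lra.
Qed.

Lemma blasch_dlift_gt0 (t : R) : 0 < db t.
Proof.
have d0 : (0 < d)%N by exact: ltn_trans d2.
rewrite /blasch_dlift (bigD1 (Ordinal d0)) //= ltr_pwDl ?poist_gt0 //.
by rewrite sumr_ge0 // => j _; rewrite ltW // poist_gt0.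
Qed.

Lemma blasch_lift_incr s t : s < t -> b s < b t.
Proof.
move=> st; apply: (rderiv_incr (dg := db)) => // y _; last exact: blasch_dlift_gt0.
exact: blasch_lift_derive.
Qed.

Lemma blasch_dlift_cont : rcont db.
Proof. by move=> t; have [l hl] := blasch_dlift_derive ha t; apply: rderiv_cont hl. Qed.

Lemma blasch_lift_cont : rcont b.
Proof. by move=> t; apply: rderiv_cont (blasch_lift_derive theta ha t). Qed.

Lemma poist_cont (x : C) : cabs x < 1 -> rcont (poist x).
Proof. by move=> x1 t; have [l hl] := poist_derive t x1; apply: rderiv_cont hl. Qed.

(** The orbit of [z0] itself converges to [z0], by the definition applied to the compact set
    consisting of this point; continuity of [B] does the rest. *)
Lemma elliptic_fixed : elliptic B -> exists z0, cabs z0 < 1 /\ B z0 = z0.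
Proof.
move=> [z0 [[_ wd] z0U]]; exists z0; split=> //.
have K1 : [set z0] `<=` @cU R by move=> y ->.
apply/eqP; rewrite -subr_eq0; apply/eqP; apply: cabs_eq0; apply/eqP; rewrite eq_le cabs_ge0 andbT.
apply/ler_addgt0Pl => e e0; rewrite addr0; have e2 : 0 < e / 2 by rewrite divr_gt0.
have [L hL] := blaschke_deriv theta ha (ltW z0U).
have [r [r0 hr]] := cderiv_cont hL e2.
have cz : compact [set z0] by exact: compact_set1.
have [N1 _ h1] := wd _ cz K1 _ e2; have [N2 _ h2] := wd _ cz K1 _ r0.
pose n := maxn N1 N2.
have k1 : cabs (iter n.+1 B z0 - z0) < e / 2 by apply: h1 => //=; rewrite ltnW // ltnS leq_maxl.
have k2 : cabs (iter n B z0 - z0) < r by apply: h2 => //=; exact: leq_maxr.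
have := cabs_subl (B z0) (iter n.+1 B z0) z0; have := hr _ k2; rewrite iterS in k1 *.
by rewrite cabsB; lra.
Qed.

(** The metric is the derivative [poist z0] of the lift of [bfac z0]; with both denominators
    cleared, its expansion is exactly [blasch_lift_expand]. *)
Lemma elliptic_circle_shadowing : elliptic B -> circle_shadowing.
Proof.
move=> /elliptic_fixed [z0 [z0U Bz0]].
have d0 : (0 < d)%N by exact: ltn_trans d2.
have [c [bK cK]] := lift_inverse d0 blasch_lift_cont blasch_lift_incr (blasch_lift_period theta a).
apply: (@shadowing_circle 0 b) => [t|]; first by rewrite !add0r expi_blasch_lift.
have es := @elliptic_shadowing R b c db (weight 0) d (blasch_lift_derive theta ha) blasch_lift_incr bK cK
  (blasch_lift_period theta a) blasch_dlift_cont (weight_cont 0) (weight_per 0) (blift z0) (poist z0).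
apply: es.
- by move=> t; exact: blift_derive.
- exact: poist_cont.
- by move=> t; exact: poist_gt0.
- exact: poist_period.
- exact: blasch_dlift_period.
- exact: blift_period.
- move=> t.
  have nz : expi t != z0 by apply/eqP => h; move: z0U; rewrite -h cabs_expi ltxx.
  have h := blasch_lift_expand d2 ha (ltW z0U) nz Bz0 (fun h => ltac:(by move: z0U; rewrite h ltxx)).
  rewrite !poist_pois /pois expi_blasch_lift //.
  have p1 : 0 < cabs (1 - z0^* * expi t) by rewrite cabs_gt0 bfac_den // cabs_expi.
  have p2 : 0 < cabs (1 - z0^* * B (expi t)) by rewrite cabs_gt0 bfac_den // blaschke_circle ?cabs_expi.
  rewrite expi_blasch_lift // in h.
  rewrite mulrAC ltr_pdivlMr ?exprn_gt0 // mulrAC ltr_pdivrMr ?exprn_gt0 // -[ltRHS]mulrA.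
  rewrite ltr_pM2l ?cabs_sqr_lt1 //.
  by rewrite [ltRHS]mulrC.
Qed.

Lemma parabolic_circle_shadowing : doubly_parabolic B -> circle_shadowing.
Proof.
move=> [z0 [_ [z0T [dB [gz _ _]]]]].
have Bz0 : B z0 = z0 by move/eqP: gz; rewrite subr_eq0 => /eqP.
have [t0 tE] := expi_surj z0T.
have d0 : (0 < d)%N by exact: ltn_trans d2.
(* Subtracting [b t0], another angle of [z0], makes 0 an exact fixed point of the lift. *)
pose b1 t := b (t0 + t) - b t0; pose db1 t := db (t0 + t).
have dsh (t : R) : is_derive t 1 (fun y => t0 + y) 1.
  by have := rderivD (rderiv_cst t0 t) (rderiv_id t); rewrite add0r.
have b1d (t : R) : is_derive t 1 b1 (db1 t).
  have := rderivB (rderiv_comp (g := fun y => t0 + y) (blasch_lift_derive theta ha (t0 + t)) (dsh t)) (rderiv_cst (b t0) t).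
  by rewrite mulr1 subr0.
have b1i s t : s < t -> b1 s < b1 t by move=> st; rewrite ltrD2r; apply: blasch_lift_incr; rewrite ltrD2l.
have b1p t : b1 (t + tau) = b1 t + d%:R * tau by rewrite /b1 addrA blasch_lift_period addrAC.
have b1c : rcont b1 by move=> t; apply: rderiv_cont (b1d t).
have [c [bK cK]] := lift_inverse d0 b1c b1i b1p.
have ebt0 : expi (b t0) = z0 by rewrite expi_blasch_lift // tE.
have eb1 t : expi (b1 t) = z0^* * expi (b (t0 + t)).
  by rewrite /b1 addrC expiD -expiN_conj ebt0.
have et t : expi t = z0^* * expi (t0 + t).
  by rewrite expiD tE mulrA [z0^* * _]mulrC -sqr_cabsE z0T expr1n mul1r.
apply: (@shadowing_circle t0 b1) => [t|].
  by rewrite expiD eb1 tE mulrA -sqr_cabsE z0T expr1n mul1r expi_blasch_lift.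
have [l hl] := blasch_dlift_derive ha t0.
apply: (@parabolic_shadowing R b1 c db1 (weight t0) d l) => //.
- move=> t e e0; have [r [r0 hr]] := blasch_dlift_cont (t0 + t) e0; exists r; split=> // y hy; apply: hr.
  by rewrite opprD addrACA subrr add0r.
- exact: weight_cont.
- exact: weight_per.
- by rewrite /b1 addr0 subrr.
- by rewrite /db1 addr0 -(derive1_blaschke_expi theta ha) tE.
- have hl' : is_derive (t0 + 0 : R) 1 db l by rewrite addr0.
  by have := rderiv_comp (g := fun y => t0 + y) hl' (dsh 0); rewrite mulr1.
- by move=> t; rewrite /db1 addrA blasch_dlift_period.
- move=> t qt.
  have nz : expi (t0 + t) != z0.
    apply/eqP => h; move: (et t); rewrite h mulrC -sqr_cabsE z0T expr1n => -[h1 _].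
    by move: qt; rewrite h1 subrr ltxx.
  have z01 : cabs z0 <= 1 by rewrite z0T.
  have := blasch_lift_expand d2 ha z01 nz Bz0 (fun=> dB).
  rewrite -eb1 -et !cabs_one_sub_expi -/(db1 t) -mulrA ltr_pM2l //.
  by rewrite [db1 t * _]mulrC.
Qed.

(** The lifts [c s] and [c (s + tau)] give distinct points: [b] gains [d * tau > tau] per period, so
    they are less than one period apart. *)
Lemma two_preimages y : cabs y = 1 -> exists u v, [/\ cabs u = 1, cabs v = 1, u != v, B u = y & B v = y].
Proof.
move=> y1; have tp := @tau_gt0 R; have d0 : (0 < d)%N by exact: ltn_trans d2.
have [c [bK cK]] := lift_inverse d0 blasch_lift_cont blasch_lift_incr (blasch_lift_period theta a).
have [s hs] := expi_surj y1.
exists (expi (c s)), (expi (c (s + tau))); rewrite !cabs_expi -!expi_blasch_lift // !cK.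
have ci p q : p < q -> c p < c q.
  move=> pq; rewrite ltNge; apply/negP; rewrite le_eqVlt => /orP[/eqP h|/blasch_lift_incr].
    by move: pq; rewrite -(cK p) -h cK ltxx.
  by rewrite !cK ltNge (ltW pq).
split=> //; last by rewrite expiD expi2pi mulr1.
apply: expi_neq; have h1 : c s < c (s + tau) by apply: ci; lra.
have h2 : c (s + tau) < c s + tau.
  rewrite -[ltRHS]bK; apply: ci; rewrite blasch_lift_period cK ltrD2l ltr_pMl //.
  by rewrite ltr1n.
by lra.
Qed.
End CircleShadowing.

(** * The weighted composition operator *)

Section Supnorm.
Variable R : realType.
Local Notation C := R[i].
Implicit Types (f g : C -> C).

Lemma supnormD f g : disc_alg f -> disc_alg g -> supnorm (f + g) <= supnorm f + supnorm g.
Proof.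
move=> df dg; apply: supnorm_le => z hz; apply: (le_trans (cabsD (f z) (g z))).
by apply: lerD; exact: cabs_le_supnorm.
Qed.

Lemma supnormZ_le (c : C) f : disc_alg f -> supnorm (c *: f) <= cabs c * supnorm f.
Proof.
move=> df; apply: supnorm_le => z hz; rewrite [(c *: f) z]/(c * f z) cabsM.
by apply: ler_wpM2l; [exact: cabs_ge0|exact: cabs_le_supnorm].
Qed.

Lemma supnormZ (c : C) f : disc_alg f -> supnorm (c *: f) = cabs c * supnorm f.
Proof.
move=> df; apply/eqP; rewrite eq_le supnormZ_le //=.
have [->|c0] := eqVneq c 0; first by rewrite cabs0 mul0r; apply: supnorm_ge0; exact: disc_algZ.
have cp : 0 < cabs c by rewrite cabs_gt0.
have := supnormZ_le c^-1 (disc_algZ c df).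
by rewrite scalerA mulVf // scale1r cabsV mulrC ler_pdivlMr // mulrC.
Qed.

Lemma supnorm_eq0 f : disc_alg f -> supnorm f = 0 -> f = 0.
Proof.
move=> df h; apply/funext => z; have [hz|hz] := leP (cabs z) 1.
  by apply: cabs_eq0; apply/eqP; rewrite eq_le cabs_ge0 andbT -h cabs_le_supnorm.
by have [_ _ h3] := iffLR (disc_algP f) df; exact: h3.
Qed.

Definition cut f : C -> C := fun z => if cabs z <= 1 then f z else 0.

Lemma cutE f z : cabs z <= 1 -> cut f z = f z.
Proof. by rewrite /cut => ->. Qed.

Lemma disc_alg_cut f : (forall z, cabs z < 1 -> exists L, cderiv f z L) ->
  (forall z, cabs z <= 1 -> forall e : R, 0 < e -> cnear z (fun y => cabs y <= 1 -> cabs (f y - f z) < e)) ->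
  disc_alg (cut f).
Proof.
move=> h1 h2; apply/disc_algP; split.
- move=> z hz; have [L hL] := h1 z hz; exists L; apply: cderiv_near hL.
  by apply: cnear_mono (cnear_lt hz) => y hy; rewrite cutE // ltW.
- move=> z hz e e0; apply: cnear_mono (h2 z hz e e0) => y hy y1.
  by rewrite !cutE //; exact: hy.
- by move=> z hz; rewrite /cut leNgt hz.
Qed.

Lemma disc_alg_cut_deriv f : (forall z, cabs z <= 1 -> exists L, cderiv f z L) -> disc_alg (cut f).
Proof.
move=> h; apply: disc_alg_cut => [z hz|z hz e e0]; first exact: h (ltW hz).
by have [L hL] := h z hz; apply: cnear_mono (cderiv_cont hL e0).
Qed.
End Supnorm.

(** * Growth rate, lower bounds and the resolvent *)

Section Operator.
Variables (R : realType) (d : nat) (theta : R) (a : 'I_d -> R[i]) (w : R[i] -> R[i]).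
Hypothesis d2 : (2 <= d)%N.
Hypothesis ha : forall j, cabs (a j) < 1.
Hypothesis wA : disc_alg w.
Hypothesis wT : forall z, cabs z = 1 -> w z != 0.
Local Notation C := R[i].
Local Notation B := (blaschke theta a).
Local Notation T := (wcomp w B).
Local Notation wprod := (wprod theta a w).
Hypothesis sh : circle_shadowing theta a w.
Implicit Types (f g : C -> C) (z lam : C).

Lemma TE f z : cabs z <= 1 -> T f z = w z * f (B z).
Proof. by move=> hz; rewrite /wcomp; case: asboolP. Qed.

Lemma disc_alg_T f : disc_alg f -> disc_alg (T f).
Proof.
move=> df; have [f1 f2 f3] := iffLR (disc_algP f) df.
have dg : disc_alg (cut (fun z => f (B z))).
  apply: disc_alg_cut => [z hz|z hz e e0].
    have [L hL] := f1 _ (blaschke_lt1 theta d2 ha hz).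
    have [M hM] := blaschke_deriv theta ha (ltW hz).
    by eexists; exact: cderiv_comp hM hL.
  have [r [r0 hr]] := f2 _ (blaschke_le1 theta ha hz) e e0.
  have [M hM] := blaschke_deriv theta ha hz.
  by apply: cnear_mono (cderiv_cont hM r0) => y hy y1; apply: hr => //; exact: blaschke_le1.
have -> : T f = (fun z => w z * cut (fun z => f (B z)) z); last exact: disc_algM.
apply/funext => z; have [hz|hz] := leP (cabs z) 1; first by rewrite TE // cutE.
have [_ _ w3] := iffLR (disc_algP w) wA.
rewrite w3 // mul0r /wcomp; case: asboolP => // h.
by move: (lt_le_trans hz h); rewrite ltxx.
Qed.

Lemma fct_linE (c : C) f g z : (c *: f + g) z = c * f z + g z.
Proof. by []. Qed.

Lemma fct_scaleE (c : C) f z : (c *: f) z = c * f z.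
Proof. by []. Qed.

Lemma T_lin (c : C) f g : T (c *: f + g) = c *: T f + T g.
Proof.
apply/funext => z; rewrite fct_linE /wcomp; case: asboolP => h; last by rewrite mulr0 addr0.
by rewrite fct_linE mulrDr mulrCA.
Qed.

Lemma T_Z (c : C) f : T (c *: f) = c *: T f.
Proof.
apply/funext => z; rewrite fct_scaleE /wcomp; case: asboolP => h; last by rewrite mulr0.
by rewrite fct_scaleE mulrCA.
Qed.

Lemma T_B f g : T (f - g) = T f - T g.
Proof.
have -> : f - g = (-1) *: g + f by rewrite scaleN1r addrC.
by rewrite T_lin scaleN1r addrC.
Qed.

Lemma disc_alg_iterT n f : disc_alg f -> disc_alg (iter n T f).
Proof. by move=> df; elim: n => //= n; exact: disc_alg_T. Qed.

Lemma iter_disc n z : cabs z <= 1 -> cabs (iter n B z) <= 1.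
Proof. by move=> hz; elim: n => //= n; exact: blaschke_le1. Qed.

Lemma iterTE n f z : cabs z <= 1 -> iter n T f z = wprod n z * f (iter n B z).
Proof.
elim: n z => [|n IH] z hz; first by rewrite /= mul1r.
by rewrite iterS TE // IH ?blaschke_le1 // iterSr /= mulrA.
Qed.

Lemma iterT_lin n (c : C) f g : iter n T (c *: f + g) = c *: iter n T f + iter n T g.
Proof. by elim: n => //= n ->; rewrite T_lin. Qed.

Let W := supnorm w.

Lemma W_ge0 : 0 <= W. Proof. exact: supnorm_ge0. Qed.

Lemma w_le z : cabs z <= 1 -> cabs (w z) <= W.
Proof. exact: cabs_le_supnorm. Qed.

Lemma T_bound f : disc_alg f -> supnorm (T f) <= W * supnorm f.
Proof.
move=> df; apply: supnorm_le => z hz; rewrite TE // cabsM.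
by apply: ler_pM; rewrite ?cabs_ge0 ?w_le // cabs_le_supnorm // blaschke_le1.
Qed.

Lemma wprod_le n z : cabs z <= 1 -> cabs (wprod n z) <= W ^+ n.
Proof.
elim: n z => [|n IH] z hz; first by rewrite [wprod _ _]/= cabs1 expr0.
rewrite exprS [wprod _ _]/= cabsM; apply: ler_pM; rewrite ?cabs_ge0 ?w_le //.
by apply: IH; exact: blaschke_le1.
Qed.

Lemma wprod_add m n z : wprod (m + n) z = wprod m z * wprod n (iter m B z).
Proof. by elim: m z => [|m IH] z; rewrite ?mul1r // addSn /= IH mulrA -iterSr. Qed.

Lemma w_low : exists m : R, 0 < m /\ forall z, cabs z = 1 -> m <= cabs (w z).
Proof.
have p0 (t : R) : 0 < cabs (w (expi (0 + t))) by rewrite cabs_gt0 wT // cabs_expi.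
have pp (t : R) : cabs (w (expi (0 + (t + @pi R *+ 2)))) = cabs (w (expi (0 + t))).
  by rewrite addrA (expiD (0 + t)) expi2pi mulr1.
have [m [m0 hm]] := pos_periodic (cabs_w_cont wA 0) p0 pp.
exists m; split=> // z z1; have [t <-] := expi_surj z1.
by have := hm t; rewrite add0r.
Qed.

(** The maxima of [|wprod n|] are submultiplicative, so [rho] is the limit of their [n]-th roots.
    This form gives both uses without a limit: below [rho] every [n] has a large value, above it
    some [n] has only small ones. *)
Definition growth (r : R) := 0 <= r /\ forall n, exists z, cabs z = 1 /\ r ^+ n <= cabs (wprod n z).
Definition rho : R := sup [set r | growth r].

Lemma growth_ub r : growth r -> r <= W.
Proof.
move=> [r0 /(_ 1%N) [z [z1 h]]]; apply: (le_trans h); rewrite /= mulr1.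
by apply: w_le; rewrite z1.
Qed.

Lemma growth_has_sup : has_sup [set r | growth r].
Proof.
split; last by exists W => r /growth_ub.
exists 0; split=> // -[|n]; first by exists 1; rewrite cabs1 expr0.
by exists 1; rewrite cabs1 expr0n /= cabs_ge0.
Qed.

Lemma rho_gt0 : 0 < rho.
Proof.
have [m [m0 hm]] := w_low; apply: (lt_le_trans m0); apply: sup_ubound; first by case: growth_has_sup.
split; first exact: ltW.
move=> n; exists 1; rewrite cabs1; split=> //.
have : cabs (1 : C) = 1 by rewrite cabs1.
elim: n (1 : C) => [|n IH] z z1; first by rewrite expr0 [wprod _ _]/= cabs1.
rewrite exprS [wprod _ _]/= cabsM; apply: ler_pM; rewrite ?exprn_ge0 ?(ltW m0) ?hm //.
exact: IH (blaschke_circle theta ha z1).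
Qed.

Lemma growth_lt_rho r : 0 <= r -> r < rho -> forall n, exists z, cabs z = 1 /\ r ^+ n <= cabs (wprod n z).
Proof.
move=> r0 rr n.
have e0 : 0 < rho - r by rewrite subr_gt0.
have [r' [r0' g]] := sup_adherent e0 growth_has_sup; rewrite subKr => rr'.
have [z [z1 h]] := g n; exists z; split=> //; apply: le_trans h.
by rewrite lerXn2r ?nnegrE // ltW.
Qed.

Lemma decay_gt_rho r : rho < r -> exists n, (0 < n)%N /\ forall z, cabs z = 1 -> cabs (wprod n z) <= r ^+ n.
Proof.
move=> rr; apply: contrapT => H.
have r0 : 0 <= r by apply: ltW; exact: lt_trans rho_gt0 rr.
move: rr; rewrite ltNge => /negP; apply; apply: sup_ubound; first by case: growth_has_sup.
split=> // -[|n]; first by exists 1; rewrite expr0 [wprod _ _]/= !cabs1.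
apply: contrapT => hn; apply: H; exists n.+1; split=> // z z1.
by rewrite leNgt; apply/negP => h; apply: hn; exists z; split=> //; exact: ltW.
Qed.

(** With [e = ln (r1 / r)] the shadowing loss [expR e ^+ n] turns a value [r1 ^+ n] at some point
    into [r ^+ n] above the prescribed [u]. *)
Lemma backward_growth r : 0 < r -> r < rho -> exists N, forall n, (N <= n)%N -> forall u, cabs u = 1 ->
  exists z, [/\ cabs z = 1, iter n B z = u & r ^+ n <= cabs (wprod n z)].
Proof.
move=> r0 rr; pose r1 := (r + rho) / 2.
have r10 : 0 < r1 by rewrite /r1; have := rho_gt0; lra.
have r1r : r < r1 by rewrite /r1; lra.
have r1rho : r1 < rho by rewrite /r1; lra.
clearbody r1.
have q1 : 1 < r1 / r by rewrite ltr_pdivlMr // mul1r.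
have e0 : 0 < ln (r1 / r) by exact: ln_gt0.
have [N hN] := sh e0; exists N => n Nn u u1.
have [x [x1 hx]] := growth_lt_rho (ltW r10) r1rho n.
have [z [z1 zu hz]] := hN n Nn x u x1 u1; exists z; split=> //.
have q0 : 0 < r1 / r by rewrite divr_gt0.
have := le_trans hx hz; rewrite lnK ?posrE // expr_div_n mulrA ler_pdivlMr ?exprn_gt0 //.
by rewrite mulrC ler_pM2r // exprn_gt0.
Qed.

(** The decay over one block of length [n] iterates; the remainder, shorter than [n], is absorbed in
    [K]. *)
Lemma wprod_upper r : rho < r -> exists K : R, 0 < K /\ forall k z, cabs z = 1 -> cabs (wprod k z) <= K * r ^+ k.
Proof.
move=> rr; have [n [n0 hn]] := decay_gt_rho rr; have r0 : 0 < r := lt_trans rho_gt0 rr.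
have q0 : 0 <= W / r by rewrite divr_ge0 ?W_ge0 // ltW.
have b1 : 1 <= 1 + W / r by rewrite lerDl.
exists ((1 + W / r) ^+ n); split; first by rewrite exprn_gt0 // (lt_le_trans ltr01).
move=> k; elim/ltn_ind: k => k IH z z1; have [kn|nk] := ltnP k n.
  apply: (le_trans (wprod_le k _)); first by rewrite z1.
  apply: (@le_trans _ _ ((1 + W / r) ^+ k * r ^+ k)).
    rewrite -exprMn lerXn2r ?nnegrE ?W_ge0 // ?mulr_ge0 ?addr_ge0 ?(ltW r0) //.
    by rewrite mulrDl divfK ?gt_eqF // mul1r lerDr ltW.
  by rewrite ler_pM2r ?exprn_gt0 // ler_weXn2l // ltnW.
rewrite -(subnKC nk) wprod_add cabsM exprD mulrCA; apply: ler_pM; rewrite ?cabs_ge0 ?hn //.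
apply: IH; last exact: iter_circle.
by rewrite ltn_subrL n0 (leq_trans n0 nk).
Qed.

(** [T^n - lam^n] factors through [T - lam], so that a lower bound for the former gives one for the
    latter. *)
Lemma iterT_diff n lam : exists K : R, 0 <= K /\ forall F, disc_alg F ->
  supnorm (iter n T F - lam ^+ n *: F) <= K * supnorm (T F - lam *: F).
Proof.
elim: n => [|n [K [K0 IH]]].
  exists 0; split=> // F dF; rewrite expr0 scale1r /= subrr mul0r.
  by apply: supnorm_le => z _; rewrite cabs0.
exists (W ^+ n + cabs lam * K); split; first by rewrite addr_ge0 ?exprn_ge0 ?W_ge0 // mulr_ge0 // cabs_ge0.
move=> F dF; have dD : disc_alg (T F - lam *: F) by apply: disc_algB; [exact: disc_alg_T|exact: disc_algZ].
have dE : disc_alg (iter n T F - lam ^+ n *: F) by apply: disc_algB; [exact: disc_alg_iterT|exact: disc_algZ].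
have -> : iter n.+1 T F - lam ^+ n.+1 *: F = iter n T (T F - lam *: F) + lam *: (iter n T F - lam ^+ n *: F).
  have -> : T F - lam *: F = (- lam) *: F + T F by rewrite scaleNr addrC.
  rewrite iterT_lin -iterSr scalerBr scalerA -exprS scaleNr [in RHS]addrCA.
  by rewrite !addrA subrr add0r.
apply: (le_trans (supnormD (disc_alg_iterT n dD) (disc_algZ lam dE))); rewrite mulrDl; apply: lerD.
  elim: n {IH dE} => [|n IH]; first by rewrite expr0 mul1r.
  apply: (le_trans (T_bound (disc_alg_iterT n dD))); rewrite exprS -mulrA.
  by apply: ler_wpM2l; rewrite ?W_ge0.
apply: (le_trans (supnormZ_le _ dE)); rewrite -mulrA; apply: ler_wpM2l; first exact: cabs_ge0.
exact: IH.
Qed.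

(** The norm of [F] is taken on the circle, and every [u] there has a backward point [z] with
    [|wprod n z| >= r^n]; hence [T^n] expands norms by [r^n > |lam|^n]. *)
Lemma below_lt lam : cabs lam < rho -> exists k : R, 0 < k /\ forall F, disc_alg F ->
  k * supnorm F <= supnorm (T F - lam *: F).
Proof.
move=> lr; pose r := (cabs lam + rho) / 2.
have l0 := cabs_ge0 lam; have r0 : 0 < r by rewrite /r; have := rho_gt0; lra.
have lr1 : cabs lam < r by rewrite /r; lra.
have rr : r < rho by rewrite /r; lra.
(* The successor makes [n] positive; for [n = 0] the two powers would agree. *)
have [N hN] := backward_growth r0 rr; pose n := N.+1.
have [K [K0 hK]] := iterT_diff n lam.
have p0 : 0 < r ^+ n - cabs lam ^+ n by rewrite subr_gt0 ltrXn2r // ?nnegrE // ltW.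
have K1 : 0 < K + 1 by rewrite ltr_wpDl.
exists ((r ^+ n - cabs lam ^+ n) / (K + 1)); split; first by rewrite divr_gt0.
move=> F dF; have h := hK F dF.
have low : r ^+ n * supnorm F <= supnorm (iter n T F).
  have rn : 0 < r ^+ n by rewrite exprn_gt0.
  rewrite mulrC -ler_pdivlMr //; apply: supnorm_le_circle => // u u1.
  have [z [z1 zu hz]] := hN n (leqnSn N) u u1.
  rewrite ler_pdivlMr // -zu.
  have zl : cabs z <= 1 by rewrite z1.
  have := cabs_le_supnorm (disc_alg_iterT n dF) zl; rewrite iterTE // cabsM.
  apply: le_trans; rewrite mulrC; apply: ler_wpM2r => //; exact: cabs_ge0.
have tri : supnorm (iter n T F) <= supnorm (iter n T F - lam ^+ n *: F) + cabs lam ^+ n * supnorm F.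
  have -> : iter n T F = (iter n T F - lam ^+ n *: F) + lam ^+ n *: F by rewrite subrK.
  apply: (le_trans (supnormD _ _)); rewrite ?subrK.
  - by apply: disc_algB; [exact: disc_alg_iterT|exact: disc_algZ].
  - exact: disc_algZ.
  - by rewrite lerD2l -cabsX supnormZ_le.
have s0 : 0 <= supnorm (T F - lam *: F) by apply: supnorm_ge0; apply: disc_algB; [exact: disc_alg_T|exact: disc_algZ].
rewrite mulrAC ler_pdivrMr // mulrBl mulrDr mulr1 [_ * K]mulrC; lra.
Qed.

Lemma below_gt lam : rho < cabs lam -> exists k : R, 0 < k /\ forall F, disc_alg F ->
  k * supnorm F <= supnorm (T F - lam *: F).
Proof.
move=> lr; pose r := (cabs lam + rho) / 2.
have r0 : 0 < r by rewrite /r; have := rho_gt0; lra.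
have lr1 : r < cabs lam by rewrite /r; lra.
have rr : rho < r by rewrite /r; lra.
have [n [n0 hn]] := decay_gt_rho rr.
have [K [K0 hK]] := iterT_diff n lam.
have p0 : 0 < cabs lam ^+ n - r ^+ n by rewrite subr_gt0 ltrXn2r ?nnegrE ?cabs_ge0 ?(ltW r0) // -lt0n.
have K1 : 0 < K + 1 by rewrite ltr_wpDl.
exists ((cabs lam ^+ n - r ^+ n) / (K + 1)); split; first by rewrite divr_gt0.
move=> F dF; have h := hK F dF.
have up : supnorm (iter n T F) <= r ^+ n * supnorm F.
  apply: supnorm_le_circle; first exact: disc_alg_iterT.
  move=> z z1; have zl : cabs z <= 1 by rewrite z1.
  rewrite iterTE // cabsM; apply: ler_pM; rewrite ?cabs_ge0 ?hn // cabs_le_supnorm //.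
  exact: iter_disc.
have tri : cabs lam ^+ n * supnorm F <= supnorm (iter n T F - lam ^+ n *: F) + supnorm (iter n T F).
  rewrite -cabsX -supnormZ //.
  have {1}-> : lam ^+ n *: F = (-1) *: (iter n T F - lam ^+ n *: F) + iter n T F.
    by rewrite scaleN1r opprB subrK.
  have dE : disc_alg (iter n T F - lam ^+ n *: F) by apply: disc_algB; [exact: disc_alg_iterT|exact: disc_algZ].
  apply: (le_trans (supnormD (disc_algZ _ dE) (disc_alg_iterT n dF))); rewrite lerD2r.
  by rewrite supnormZ // cabsN cabs1 mul1r.
have s0 : 0 <= supnorm (T F - lam *: F) by apply: supnorm_ge0; apply: disc_algB; [exact: disc_alg_T|exact: disc_algZ].
rewrite mulrAC ler_pdivrMr // mulrBl mulrDr mulr1 [_ * K]mulrC; lra.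
Qed.

Lemma resolvent_solve lam f : rho < cabs lam -> disc_alg f -> exists F, disc_alg F /\ T F - lam *: F = f.
Proof.
move=> lr df; pose r := (cabs lam + rho) / 2.
have r0 : 0 < r by rewrite /r; have := rho_gt0; lra.
have lr1 : r < cabs lam by rewrite /r; lra.
have rr : rho < r by rewrite /r; lra.
clearbody r.
have l0 : 0 < cabs lam by lra.
have ln0 : lam != 0 by rewrite -cabs_gt0.
have [K [K0 hK]] := wprod_upper rr.
pose q := r / cabs lam.
have q01 : 0 <= q < 1 by rewrite divr_ge0 ?(ltW r0) ?(ltW l0) // ltr_pdivrMr // mul1r.
have [q0 q1] := andP q01.
have f0 := supnorm_ge0 df.
have Tk k z : cabs z <= 1 -> cabs (iter k T f z) <= K * r ^+ k * supnorm f.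
  move=> hz; apply: (disc_alg_max_modulus (disc_alg_iterT k df)) hz => y y1.
  have yl : cabs y <= 1 by rewrite y1.
  rewrite iterTE // cabsM; apply: ler_pM; rewrite ?cabs_ge0 ?hK // cabs_le_supnorm //.
  exact: iter_disc.
(* Terms of the Neumann series for the inverse of [T - lam] at [f]; by [tele] the partial sum of
   length [m] solves the equation up to [lam^-m T^m f]. *)
pose u k : C -> C := (- lam^-1 ^+ k.+1) *: iter k T f.
pose S m : C -> C := \sum_(k < m) u k.
pose M := K * supnorm f / cabs lam.
have M0 : 0 <= M by rewrite divr_ge0 ?mulr_ge0 ?(ltW K0) ?(ltW l0).
have SE m z : S m z = \sum_(k < m) u k z by rewrite /S fct_sumE.
have uk k z : cabs z <= 1 -> cabs (u k z) <= M * q ^+ k.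
  move=> hz; rewrite [u k z]/((- lam^-1 ^+ k.+1) * iter k T f z) cabsM cabsN cabsX cabsV.
  apply: (le_trans (ler_wpM2l _ (Tk k z hz))); first by rewrite exprn_ge0 // invr_ge0 ltW.
  by apply: eq_ler; rewrite /M /q expr_div_n exprVn exprS; field; rewrite expf_neq0 ?lt0r_neq0.
have dS m : disc_alg (S m) by apply: disc_alg_sum => k; apply: disc_algZ; exact: disc_alg_iterT.
pose eps m := M * q ^+ m / (1 - q).
have q1' : 0 < 1 - q by rewrite subr_gt0.
have eps_small e : 0 < e -> exists N, forall n, (N <= n)%N -> eps n < e.
  move=> e0; have M1 : 0 < M + 1 by rewrite ltr_wpDl.
  have [N hN] := exprn_small q01 (divr_gt0 (mulr_gt0 e0 q1') M1).
  exists N => n /hN h; rewrite /eps ltr_pdivrMr //.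
  apply: (@le_lt_trans _ _ ((M + 1) * q ^+ n)); first by rewrite ler_wpM2r ?exprn_ge0 // lerDl.
  by rewrite mulrC -ltr_pdivlMr.
have cauchy m n z : (m <= n)%N -> cabs z <= 1 -> cabs (S n z - S m z) <= eps m.
  move=> mn hz.
  have -> : S n z - S m z = \sum_(k < n - m) u (m + k)%N z.
    have [p ->] : exists p, n = (m + p)%N by exists (n - m)%N; rewrite subnKC.
    by rewrite addKn !SE big_split_ord addrC; apply: addKr.
  apply: (le_trans (cabs_sum _ _ _)).
  apply: (@le_trans _ _ (\sum_(k < n - m) M * q ^+ m * q ^+ k)).
    by apply: ler_sum => k _; rewrite -mulrA -exprD uk.
  rewrite -mulr_sumr; apply: ler_wpM2l; first by rewrite mulr_ge0 // exprn_ge0.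
  exact: sum_geo_le.
have [F [dF hF]] := disc_alg_complete dS eps_small cauchy.
exists F; split=> //.
have dRes : disc_alg (T F - lam *: F - f).
  by apply: disc_algB => //; apply: disc_algB; [exact: disc_alg_T|exact: disc_algZ].
apply/eqP; rewrite -subr_eq0; apply/eqP; apply: supnorm_eq0 => //.
apply/eqP; rewrite eq_le supnorm_ge0 // andbT; apply/ler_addgt0Pl => e e0; rewrite addr0.
have tele m z : cabs z <= 1 -> T (S m) z - lam * S m z = f z - lam^-1 ^+ m * iter m T f z.
  move=> hz; elim: m => [|m IH].
    rewrite expr0 mul1r /= TE // !SE !big_ord0; ring.
  have E y : S m.+1 y = S m y + u m y by rewrite !SE big_ord_recr.
  have E2 : T (S m.+1) z = T (S m) z + T (u m) z by rewrite !TE // E mulrDr.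
  rewrite E E2.
  have -> : T (u m) z = (- lam^-1 ^+ m.+1) * iter m.+1 T f z by rewrite /u T_Z.
  have -> : u m z = (- lam^-1 ^+ m.+1) * iter m T f z by [].
  have -> : T (S m) z + - lam^-1 ^+ m.+1 * iter m.+1 T f z - lam * (S m z + - lam^-1 ^+ m.+1 * iter m T f z)
     = (T (S m) z - lam * S m z) - lam^-1 ^+ m.+1 * iter m.+1 T f z + (lam * lam^-1 ^+ m.+1) * iter m T f z by ring.
  by rewrite IH [lam^-1 ^+ m.+1]exprS mulrA divff // mul1r; ring.
have L1 : 0 <= 2 * (W + cabs lam) by rewrite mulr_ge0 // addr_ge0 ?W_ge0 ?cabs_ge0.
(* [2 * (W + cabs lam)] comes from replacing [F] by [S N] at [B z] and at [z], the last [cabs lam]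
   from the remainder in [k3]. *)
pose D1 := 2 * (W + cabs lam) + cabs lam.
have D10 : 0 < D1 by rewrite /D1 ltr_wpDl.
have [N hN] := eps_small _ (divr_gt0 e0 D10).
have eN := hN N (leqnn N).
apply: supnorm_le => z hz.
have [bz1 bz2] : cabs (B z) <= 1 /\ cabs z <= 1 by split=> //; exact: blaschke_le1.
have -> : (T F - lam *: F - f) z = (w z * (F (B z) - S N (B z))) - lam * (F z - S N z) + (T (S N) z - lam * S N z - f z).
  have -> : (T F - lam *: F - f) z = T F z - lam * F z - f z by [].
  by rewrite !TE //; ring.
rewrite tele //.
have h1 := hF N _ bz1; have h2 := hF N _ bz2.
have k1 : cabs (w z * (F (B z) - S N (B z))) <= W * (2 * eps N).
  by rewrite cabsM; apply: ler_pM; rewrite ?cabs_ge0 ?w_le // cabsB.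
have k2 : cabs (- (lam * (F z - S N z))) <= cabs lam * (2 * eps N).
  by rewrite cabsN cabsM; apply: ler_wpM2l; rewrite ?cabs_ge0 // cabsB.
have k3 : cabs (f z - lam^-1 ^+ N * iter N T f z - f z) <= cabs lam * eps N.
  have -> : f z - lam^-1 ^+ N * iter N T f z - f z = - (lam^-1 ^+ N * iter N T f z) by ring.
  rewrite cabsN cabsM cabsX cabsV.
  apply: (le_trans (ler_wpM2l _ (Tk N z hz))); first by rewrite exprn_ge0 // invr_ge0 ltW.
  have -> : (cabs lam)^-1 ^+ N * (K * r ^+ N * supnorm f) = cabs lam * (M * q ^+ N).
    by rewrite /M /q expr_div_n exprVn; field; rewrite expf_neq0 ?lt0r_neq0.
  apply: ler_wpM2l; first exact: cabs_ge0.
  have Mq : 0 <= M * q ^+ N by rewrite mulr_ge0 // exprn_ge0.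
  have q2 : 1 - q <= 1 by rewrite gerBl.
  by rewrite /eps ler_pdivlMr // -[leRHS]mulr1 ler_wpM2l.
apply: (le_trans (cabsD3 _ _ _)); apply: (@le_trans _ _ (D1 * eps N)); first by rewrite /D1; lra.
by rewrite mulrC -ler_pdivlMr // ltW.
Qed.

Lemma notin_spectrum lam : rho < cabs lam -> ~ sigmaA T lam.
Proof.
move=> lr /=; apply; have [k [k0 hk]] := below_gt lr.
have dTl F : disc_alg F -> disc_alg (T F - lam *: F).
  by move=> dF; apply: disc_algB; [exact: disc_alg_T|exact: disc_algZ].
have inj F G : disc_alg F -> disc_alg G -> T F - lam *: F = T G - lam *: G -> F = G.
  move=> dF dG E; have dFG : disc_alg (F - G) by exact: disc_algB.
  apply/eqP; rewrite -subr_eq0; apply/eqP; apply: supnorm_eq0 => //.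
  have := hk _ dFG.
  have -> : T (F - G) - lam *: (F - G) = 0.
    rewrite T_B scalerBr opprB [lam *: G - _]addrC addrACA E [- T G + _]addrC -[X in _ + X]opprB.
    by rewrite subrr.
  have -> : supnorm (0 : C -> C) = 0.
    by apply/eqP; rewrite eq_le supnorm_ge0 ?andbT; [apply: supnorm_le => z _; rewrite cabs0|exact: disc_alg0].
  move=> h; apply/eqP; rewrite eq_le supnorm_ge0 // andbT.
  by rewrite -(ler_pM2l k0) mulr0.
have /choice [Si hS] : forall f : C -> C, exists F, disc_alg f -> disc_alg F /\ T F - lam *: F = f.
  move=> f; have [df|ndf] := pselect (disc_alg f); last by exists 0.
  by have [F hF] := resolvent_solve lr df; exists F.
exists Si; split.
- by move=> f /hS [].
- move=> c f g df dg; have [dF EF] := hS _ df; have [dG EG] := hS _ dg.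
  have dfg : disc_alg (c *: f + g) by apply: disc_algD => //; exact: disc_algZ.
  have [dS ES] := hS _ dfg; have dS2 : disc_alg (c *: Si f + Si g) by apply: disc_algD => //; exact: disc_algZ.
  apply: (inj _ _ dS dS2).
  rewrite ES T_lin -{1}EF -{1}EG scalerBr scalerDr !scalerA [lam * c]mulrC opprD.
  by rewrite addrACA.
- exists k^-1 => f df; have [dF EF] := hS _ df.
  by rewrite mulrC ler_pdivlMr // mulrC -{2}EF; exact: hk.
- by move=> F dF; have [dG EG] := hS _ (dTl _ dF); apply: inj.
- by move=> f df; have [] := hS _ df.
Qed.
End Operator.

(** * The adjoint and the lower semi-Fredholm spectrum *)

Section Limits.
Variable R : realType.
Implicit Types u : nat -> R.

Lemma cvg0_eps u : u @ \oo --> (0 : R) -> forall e, 0 < e -> exists N, forall n, (N <= n)%N -> u n < e.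
Proof.
move=> h e e0; have /cvgrPdist_lt /(_ e e0) [N _ hN] := h; exists N => n Nn.
by have := hN n Nn; rewrite /= sub0r normrN; apply: le_lt_trans; exact: ler_norm.
Qed.

Lemma eps_cvg0 u : (forall n, 0 <= u n) -> (forall e, 0 < e -> exists N, forall n, (N <= n)%N -> u n < e) ->
  u @ \oo --> (0 : R).
Proof.
move=> u0 h; apply/cvgrPdist_lt => e e0; have [N hN] := h e e0; exists N => // n /= Nn.
by rewrite sub0r normrN ger0_norm // hN.
Qed.
End Limits.

(** * Dual norm and functionals of finite support *)

Section Dual.
Variable R : realType.
Local Notation C := R[i].
Local Notation dual_norm := (@dual_norm R).
Implicit Types (f g : C -> C) (phi psi : (C -> C) -> C).

Lemma supnorm0 : supnorm (0 : C -> C) = 0.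
Proof.
apply/eqP; rewrite eq_le supnorm_ge0 ?andbT; last exact: disc_alg0.
by apply: supnorm_le => z _; rewrite cabs0.
Qed.

Lemma dual0 phi : dual_space phi -> phi 0 = 0.
Proof.
move=> [lin _]; have := lin 1 0 0 (@disc_alg0 R) (@disc_alg0 R).
rewrite scaler0 addr0 mul1r => /eqP; rewrite eq_sym -subr_eq0 addrK => /eqP; exact.
Qed.

Lemma dualZ phi c f : dual_space phi -> disc_alg f -> phi (c *: f) = c * phi f.
Proof.
move=> dp df; case: (dp) => lin _; have := lin c f 0 df (@disc_alg0 R).
by rewrite addr0 (dual0 dp) addr0.
Qed.

Lemma dual_norm_le phi K : (forall f, disc_alg f -> supnorm f <= 1 -> cabs (phi f) <= K) -> dual_norm phi <= K.
Proof.
move=> h; apply: ge_sup.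
  by exists (cabs (phi 0)), 0 => //; split; [exact: disc_alg0|rewrite supnorm0 ler01].
by move=> _ [f [df f1] <-]; exact: h.
Qed.

Lemma dual_norm_ge phi f : dual_space phi -> disc_alg f -> supnorm f <= 1 -> cabs (phi f) <= dual_norm phi.
Proof.
move=> [_ [M hM]] df f1; apply: ub_le_sup; last by exists f.
exists `|M| => _ [g [dg g1] <-]; apply: (le_trans (hM g dg)).
have s0 := supnorm_ge0 dg.
apply: (@le_trans _ _ (`|M| * supnorm g)); first by rewrite ler_wpM2r // ler_norm.
by rewrite -[leRHS]mulr1 ler_wpM2l.
Qed.

Lemma dual_norm_ge0 phi : dual_space phi -> 0 <= dual_norm phi.
Proof.
move=> dp; apply: le_trans (dual_norm_ge dp (@disc_alg0 R) _); first exact: cabs_ge0.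
by rewrite supnorm0 ler01.
Qed.

Lemma dual_bound phi f : dual_space phi -> disc_alg f -> cabs (phi f) <= dual_norm phi * supnorm f.
Proof.
move=> dp df; have s0 := supnorm_ge0 df; have [E|n0] := eqVneq (supnorm f) 0.
  by rewrite (supnorm_eq0 df E) (dual0 dp) cabs0 supnorm0 mulr0.
have sp : 0 < supnorm f by rewrite lt_neqAle eq_sym n0.
pose c : C := ((supnorm f)^-1)%:C.
have cc : cabs c = (supnorm f)^-1 by rewrite cabs_real ger0_norm // invr_ge0.
have := dual_norm_ge dp (disc_algZ c df); rewrite supnormZ // cc mulVf // lexx => /(_ isT).
by rewrite dualZ // cabsM cc mulrC ler_pdivrMr.
Qed.

Lemma dual_space_lin (c : C) phi psi : dual_space phi -> dual_space psi -> dual_space (c *: phi + psi).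
Proof.
move=> dp dq; split=> [k f g df dg|].
  have E h : (c *: phi + psi) h = c * phi h + psi h by [].
  by rewrite !E (proj1 dp) // (proj1 dq) //; ring.
exists (cabs c * dual_norm phi + dual_norm psi) => f df.
have -> : (c *: phi + psi) f = c * phi f + psi f by [].
apply: (le_trans (cabsD _ _)); rewrite mulrDl; apply: lerD; last exact: dual_bound.
by rewrite cabsM -mulrA ler_wpM2l ?cabs_ge0 // dual_bound.
Qed.

Lemma dual_space0 : dual_space (0 : (C -> C) -> C).
Proof.
split=> [k f g _ _|]; first by change (0 = k * 0 + 0 :> C); rewrite mulr0 addr0.
by exists 0 => f _; change (cabs (0 : C) <= 0 * supnorm f); rewrite cabs0 mul0r.
Qed.

Lemma dual_spaceZ (c : C) phi : dual_space phi -> dual_space (c *: phi).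
Proof. by move=> dp; rewrite -[c *: phi]addr0; apply: dual_space_lin => //; exact: dual_space0. Qed.

Lemma dual_spaceB phi psi : dual_space phi -> dual_space psi -> dual_space (phi - psi).
Proof. by move=> dp dq; rewrite addrC -scaleN1r; exact: dual_space_lin. Qed.

Lemma dual_normZ (c : C) phi : dual_space phi -> dual_norm (c *: phi) <= cabs c * dual_norm phi.
Proof.
move=> dp; apply: dual_norm_le => f df f1.
have -> : (c *: phi) f = c * phi f by [].
by rewrite cabsM ler_wpM2l ?cabs_ge0 // dual_norm_ge.
Qed.

Lemma dual_norm_tri phi psi chi : dual_space phi -> dual_space psi -> dual_space chi ->
  dual_norm (phi - psi) <= dual_norm (phi - chi) + dual_norm (psi - chi).
Proof.
move=> dp dq dc; apply: dual_norm_le => f df f1.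
have -> : (phi - psi) f = (phi - chi) f - (psi - chi) f.
  by have E (p q : (C -> C) -> C) : (p - q) f = p f - q f by []; rewrite !E; ring.
apply: (le_trans (cabsD _ _)); rewrite cabsN.
by apply: lerD; apply: dual_norm_ge => //; exact: dual_spaceB.
Qed.

(** A finitely supported measure, coded by a list of pairs (weight, point) so that supports can be
    compared by list membership. *)
Definition ev (L : seq (C * C)) : (C -> C) -> C := fun f => \sum_(p <- L) p.1 * f p.2.
Definition scl (c : C) (L : seq (C * C)) := [seq (c * p.1, p.2) | p <- L].
Definition circ (L : seq (C * C)) := forall p, p \in L -> cabs p.2 = 1.

Lemma ev_cons p L f : ev (p :: L) f = p.1 * f p.2 + ev L f.
Proof. by rewrite /ev big_cons. Qed.

Lemma ev_nil f : ev [::] f = 0.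
Proof. by rewrite /ev big_nil. Qed.

Lemma ev_cat L1 L2 : ev (L1 ++ L2) = ev L1 + ev L2.
Proof. by apply/funext => f; rewrite /ev big_cat. Qed.

Lemma ev_scl c L : ev (scl c L) = c *: ev L.
Proof.
apply/funext => f; have -> : (c *: ev L) f = c * ev L f by [].
rewrite /ev /scl big_map /= mulr_sumr.
by apply: eq_bigr => p _; rewrite mulrA.
Qed.

Lemma circ_cons p L : circ (p :: L) -> cabs p.2 = 1 /\ circ L.
Proof. by move=> h; split=> [|q hq]; apply: h; rewrite inE ?eqxx ?hq ?orbT. Qed.

Lemma circ_cat L1 L2 : circ L1 -> circ L2 -> circ (L1 ++ L2).
Proof. by move=> h1 h2 p; rewrite mem_cat => /orP[/h1|/h2]. Qed.

Lemma mem_scl c L p : p \in scl c L -> exists2 q, q \in L & q.2 = p.2.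
Proof. by move=> /mapP [q hq ->]; exists q. Qed.

Lemma circ_scl c L : circ L -> circ (scl c L).
Proof. by move=> h p /mem_scl [q hq <-]; exact: h. Qed.

Lemma ev_dual L : circ L -> dual_space (ev L).
Proof.
elim: L => [|p L IH] h.
  have -> : ev [::] = 0 by apply/funext => f; rewrite ev_nil.
  exact: dual_space0.
have [p1 /IH dL] := circ_cons h.
have -> : ev (p :: L) = p.1 *: (fun f => f p.2) + ev L by apply/funext => f; rewrite ev_cons.
apply: dual_space_lin => //; split=> // ; exists 1 => f df; rewrite mul1r cabs_le_supnorm //.
by rewrite p1.
Qed.

(* Maps the closed disc into the disc with diameter [0, 1], vanishes at [q], and tends to [1] elsewhere as [s -> 1]. *)
Definition damp1 (s : R) (q z : C) : C := ((1 + s)%:C * (1 - q^* * z)) / (2%:R * (1 - s%:C * (q^* * z))).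

Lemma damp1_ineq (s : R) (y : C) : 0 <= s < 1 -> cabs y <= 1 ->
  cabs ((1 + s)%:C * (1 - y)) <= cabs (2%:R * (1 - s%:C * y)).
Proof.
move=> /andP[s0 s1] y1; rewrite -(@ler_pXn2r _ 2) ?nnegrE ?cabs_ge0 //.
have y2 : cabs y ^+ 2 <= 1 by rewrite exprn_ile1 ?cabs_ge0.
move: y1 y2; case: y => u v y1; rewrite cabs_sqr /= => m1.
have u1 : -1 <= u by have := le_trans (cabs_Re (u +i* v)) y1; rewrite ler_norml /=; lra.
have -> : cabs ((1 + s)%:C * (1 - (u +i* v))) ^+ 2 = (1 + s) ^+ 2 * (1 - 2 * u + (u ^+ 2 + v ^+ 2)).
  by rewrite cabsM exprMn !cabs_sqr /=; ring.
have -> : cabs (2%:R * (1 - s%:C * (u +i* v))) ^+ 2 = 4 * (1 - 2 * s * u + s ^+ 2 * (u ^+ 2 + v ^+ 2)).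
  by rewrite cabsM exprMn !cabs_sqr /=; ring.
set m := u ^+ 2 + v ^+ 2 in m1 *; rewrite -subr_ge0.
have -> : 4 * (1 - 2 * s * u + s ^+ 2 * m) - (1 + s) ^+ 2 * (1 - 2 * u + m) =
  (1 - s) * (2 * (u + 1) * (1 - s) + (1 - m) * (3 * s + 1)) by ring.
apply: mulr_ge0; first lra.
by apply: addr_ge0; apply: mulr_ge0; lra.
Qed.

Lemma damp1_den (s : R) (y : C) : 0 <= s < 1 -> cabs y <= 1 -> 2%:R * (1 - s%:C * y) != 0.
Proof.
move=> /andP[s0 s1] y1; rewrite mulf_neq0 ?pnatr_eq0 // -cabs_gt0.
have := cabs_sub_ge 1 (s%:C * y); rewrite cabs1 cabsM cabs_real ger0_norm //.
have : s * cabs y <= s by rewrite -[leRHS]mulr1 ler_wpM2l.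
by lra.
Qed.

Lemma damp1_cabs (s : R) (q z : C) : 0 <= s < 1 -> cabs q = 1 -> cabs z <= 1 -> cabs (damp1 s q z) <= 1.
Proof.
move=> hs q1 z1; have y1 : cabs (q^* * z) <= 1 by rewrite cabsM cabs_conj q1 mul1r.
rewrite /damp1 cabsM cabsV ler_pdivrMr ?cabs_gt0 ?damp1_den // mul1r.
exact: damp1_ineq.
Qed.

Lemma damp1_self (s : R) (q : C) : cabs q = 1 -> damp1 s q q = 0.
Proof. by move=> q1; rewrite /damp1 [q^* * q]mulrC -sqr_cabsE q1 expr1n subrr mulr0 mul0r. Qed.

Lemma conj_neq (p q : C) : cabs q = 1 -> p != q -> 1 - q^* * p != 0.
Proof.
move=> q1 pq; apply/eqP => h; move/eqP: pq; apply.
have qq : q * q^* = 1 by rewrite -sqr_cabsE q1 expr1n.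
by rewrite -[p]mul1r -qq -mulrA -[q^* * p](subKr 1) h subr0 mulr1.
Qed.

Lemma damp1_near (q p : C) : cabs q = 1 -> cabs p = 1 -> p != q -> exists K : R, 0 <= K /\
  forall s : R, 0 <= s < 1 -> cabs (damp1 s q p - 1) <= K * (1 - s).
Proof.
move=> q1 p1 pq; have y1 : cabs (q^* * p) = 1 by rewrite cabsM cabs_conj q1 p1 mul1r.
have := conj_neq q1 pq; rewrite /damp1; set y := q^* * p in y1 *; rewrite -cabs_gt0 => yn.
exists (2 / cabs (1 - y)); split; first by rewrite divr_ge0 // ltW.
move=> s hs; have yl : cabs y <= 1 by rewrite y1.
have d0 := damp1_den hs yl; have dn := damp1_ineq hs yl; have [s0 s1] := andP hs.
have -> : (1 + s)%:C * (1 - y) / (2%:R * (1 - s%:C * y)) - 1 = ((s - 1)%:C * (1 + y)) / (2%:R * (1 - s%:C * y)).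
  rewrite -[X in _ - X](divff d0) -mulrBl; congr (_ / _).
  by rewrite !rmorphD rmorphN rmorph1; ring.
rewrite cabsM cabsV [leRHS]mulrAC; apply: ler_pM; rewrite ?cabs_ge0 ?invr_ge0 ?cabs_ge0 //.
  rewrite cabsM cabs_real ler0_norm ?subr_le0 ?(ltW s1) // opprB [leLHS]mulrC; apply: ler_wpM2r; first by rewrite subr_ge0 ltW.
  by apply: (le_trans (cabsD _ _)); rewrite cabs1 y1.
rewrite lef_pV2 ?posrE // ?cabs_gt0 //; apply: le_trans dn; rewrite cabsM cabs_real ger0_norm ?addr_ge0 //.
by rewrite -[leLHS]mul1r ler_wpM2r ?cabs_ge0 // lerDl.
Qed.

Fixpoint damp (s : R) (L : seq (C * C)) f : C -> C :=
  if L is q :: L' then (fun z => damp s L' f z * cut (damp1 s q.2) z) else f.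

Lemma disc_alg_damp s L f : 0 <= s < 1 -> circ L -> disc_alg f -> disc_alg (damp s L f).
Proof.
move=> hs hL df; elim: L hL => //= q L IH /circ_cons [q1 /IH dL]; apply: disc_algM => //.
apply: disc_alg_cut_deriv => z z1; have y1 : cabs (q.2^* * z) <= 1 by rewrite cabsM cabs_conj q1 mul1r.
have dy : cderiv (fun z => q.2^* * z) z (q.2^*) by have := cderivZ (q.2^*) (cderiv_id z); rewrite mulr1.
have dn := cderivZ (1 + s)%:C (cderivB (cderiv_cst 1 z) dy).
have dd := cderivZ 2%:R (cderivB (cderiv_cst 1 z) (cderivZ s%:C dy)).
by eexists; apply: cderiv_div dn dd _; exact: damp1_den.
Qed.

Lemma damp_cabs s L f z : 0 <= s < 1 -> circ L -> cabs z <= 1 -> cabs (damp s L f z) <= cabs (f z).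
Proof.
move=> hs hL z1; elim: L hL => //= q L IH /circ_cons [q1 /IH hL].
rewrite cutE // cabsM -[leRHS]mulr1; apply: ler_pM; rewrite ?cabs_ge0 //.
exact: damp1_cabs.
Qed.

Lemma damp_mem s L f q : circ L -> q \in L -> damp s L f q.2 = 0.
Proof.
elim: L => //= p L IH /circ_cons [p1 hL]; rewrite inE => /orP[/eqP ->|/(IH hL) ->]; last by rewrite mul0r.
by rewrite cutE ?p1 // damp1_self // mulr0.
Qed.

Lemma damp_near L f p : circ L -> cabs p = 1 -> (forall q, q \in L -> q.2 != p) -> exists K : R, 0 <= K /\
  forall s : R, 0 <= s < 1 -> cabs (damp s L f p - f p) <= K * (1 - s).
Proof.
move=> hL p1; elim: L hL => [|q L IH] hL hp.
  by exists 0; split=> // s _; rewrite /= subrr cabs0 mul0r.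
have [q1 hL'] := circ_cons hL.
have [K [K0 hK]] := IH hL' (fun r hr => hp r (mem_behead (s := q :: L) hr)).
have pq : p != q.2 by rewrite eq_sym hp // mem_head.
have [M [M0 hM]] := damp1_near q1 p1 pq.
exists (K + cabs (f p) * M); split; first by rewrite addr_ge0 // mulr_ge0 // cabs_ge0.
move=> s hs /=; have pl : cabs p <= 1 by rewrite p1.
rewrite cutE //.
have -> : damp s L f p * damp1 s q.2 p - f p = (damp s L f p - f p) * damp1 s q.2 p + f p * (damp1 s q.2 p - 1) by ring.
apply: (le_trans (cabsD _ _)); rewrite [leRHS]mulrDl; apply: lerD; rewrite cabsM.
  rewrite -[leRHS]mulr1; apply: ler_pM; rewrite ?cabs_ge0 ?hK //; exact: damp1_cabs.
by rewrite -mulrA ler_wpM2l ?cabs_ge0 // hM.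
Qed.

Lemma ev_damp_mem s L1 L2 f : circ L2 -> {subset L1 <= L2} -> ev L1 (damp s L2 f) = 0.
Proof.
move=> hL; elim: L1 => [|p L IH] h; first by rewrite ev_nil.
rewrite ev_cons damp_mem ?h ?mem_head // mulr0 add0r IH // => q hq.
by apply: h; rewrite inE hq orbT.
Qed.

Lemma ev_damp_near L1 L2 f : circ L1 -> circ L2 -> (forall p q, p \in L1 -> q \in L2 -> q.2 != p.2) ->
  exists K : R, 0 <= K /\ forall s : R, 0 <= s < 1 -> cabs (ev L1 (damp s L2 f) - ev L1 f) <= K * (1 - s).
Proof.
move=> h1 h2; elim: L1 h1 => [|p L IH] h1 hd.
  by exists 0; split=> // s _; rewrite !ev_nil subrr cabs0 mul0r.
have [p1 hL] := circ_cons h1.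
have [K [K0 hK]] := IH hL (fun r q hr => hd r q (mem_behead (s := p :: L) hr)).
have [M [M0 hM]] := damp_near f h2 p1 (fun q => hd p q (mem_head _ _)).
exists (cabs p.1 * M + K); split; first by rewrite addr_ge0 // mulr_ge0 // cabs_ge0.
move=> s hs; rewrite !ev_cons opprD addrACA -mulrBr; apply: (le_trans (cabsD _ _)).
rewrite mulrDl; apply: lerD; last exact: hK.
by rewrite cabsM -mulrA ler_wpM2l ?cabs_ge0 // hM.
Qed.

(** A test function multiplied by the dampers of all points of [L2] keeps norm at most 1, kills the
    masses of [L2] and, as [s] tends to 1, recovers its values on [L1]. *)
Lemma dual_norm_disjoint L1 L2 : circ L1 -> circ L2 -> (forall p q, p \in L1 -> q \in L2 -> q.2 != p.2) ->
  dual_norm (ev L1) <= dual_norm (ev (L1 ++ L2)).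
Proof.
move=> h1 h2 hd; apply: dual_norm_le => f df f1; apply/ler_addgt0Pl => e e0.
have [K [K0 hK]] := ev_damp_near f h1 h2 hd.
have K1 : 0 < K + 1 by rewrite ltr_wpDl.
(* [t] is [1 - s], small enough for [K * t <= e]; the cap at 1 keeps [s] nonnegative. *)
pose t := Num.min (1 : R) (e / (K + 1)).
have t0 : 0 < t by rewrite lt_min ltr01 divr_gt0.
have t1 : t <= 1 by rewrite ge_min lexx.
have te : t * (K + 1) <= e by rewrite -ler_pdivlMr // ge_min lexx orbT.
have hs : 0 <= 1 - t < 1 by rewrite subr_ge0 t1 gtrBl.
have h12 : circ (L1 ++ L2) by exact: circ_cat.
have dd := disc_alg_damp hs h2 df.
have dl : supnorm (damp (1 - t) L2 f) <= 1.
  apply: supnorm_le => z z1; apply: (le_trans (damp_cabs f hs h2 z1)).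
  exact: le_trans (cabs_le_supnorm df z1) f1.
have := dual_norm_ge (ev_dual h12) dd dl; rewrite ev_cat.
have -> : (ev L1 + ev L2) (damp (1 - t) L2 f) = ev L1 (damp (1 - t) L2 f) + ev L2 (damp (1 - t) L2 f) by [].
rewrite (@ev_damp_mem _ L2 L2) // addr0 -ev_cat => hn.
have := hK _ hs; rewrite subKr => kn.
have := cabs_subl (ev L1 f) (ev L1 (damp (1 - t) L2 f)) 0; rewrite !subr0 [X in _ <= X + _ -> _]cabsB.
have : K * t <= e by apply: le_trans te; rewrite mulrC ler_wpM2l ?(ltW t0) // lerDl.
by lra.
Qed.
End Dual.

(** * Approximate eigenvectors of the adjoint *)

Section LowerSemiFredholm.
Variables (R : realType) (d : nat) (theta : R) (a : 'I_d -> R[i]) (w : R[i] -> R[i]).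
Hypothesis d2 : (2 <= d)%N.
Hypothesis ha : forall j, cabs (a j) < 1.
Hypothesis wA : disc_alg w.
Hypothesis wT : forall z, cabs z = 1 -> w z != 0.
Local Notation C := R[i].
Local Notation B := (blaschke theta a).
Local Notation T := (wcomp w B).
Local Notation wprod := (wprod theta a w).
Local Notation rho := (rho theta a w).
Local Notation dual_norm := (@dual_norm R).
Hypothesis sh : circle_shadowing theta a w.
Implicit Types (f g : C -> C) (z lam : C).

Lemma adjoint_dual phi : dual_space phi -> dual_space (adjoint T phi).
Proof.
move=> dp; split=> [c f g df dg|].
  by rewrite /adjoint T_lin (proj1 dp) //; exact: disc_alg_T.
exists (dual_norm phi * supnorm w) => f df; apply: (le_trans (dual_bound dp (disc_alg_T theta d2 ha wA df))).
by rewrite -mulrA ler_wpM2l ?dual_norm_ge0 // T_bound.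
Qed.

Lemma adjoint_sub_dual phi lam : dual_space phi -> dual_space (adjoint T phi - lam *: phi).
Proof. by move=> dp; apply: dual_spaceB; [exact: adjoint_dual|exact: dual_spaceZ]. Qed.

(** If [Si] inverts [T - lam], then [x N f] is the residual functional [psi] at [Si f]; a residual
    tending to 0 at norm 1 contradicts the bound on [Si]. *)
Lemma lsf_sub_spectrum lam : sigma_lsf T lam -> sigmaA T lam.
Proof.
move=> [x [[xd x1 xc] _]] [Si [Si1 _ [M hM] _ Si4]].
have M1 : 0 < `|M| + 1 by rewrite ltr_wpDl.
have [N hN] := cvg0_eps xc (divr_gt0 ltr01 M1); have := hN N (leqnn N).
apply/negP; rewrite -leNgt ler_pdivrMr // -[leLHS](x1 N).
have dp := xd N; have dq := adjoint_sub_dual lam dp.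
set psi := adjoint T (x N) - lam *: x N in dq *.
have q0 := dual_norm_ge0 dq.
apply: dual_norm_le => f df f1; have dS := Si1 f df; have f0 := supnorm_ge0 df.
have -> : x N f = psi (Si f).
  rewrite -{1}(Si4 f df) addrC -scaleNr (proj1 dp) //; last exact: disc_alg_T.
  have -> : psi (Si f) = x N (T (Si f)) - lam * x N (Si f) by [].
  by rewrite mulNr addrC.
apply: (le_trans (dual_bound dq dS)); apply: ler_wpM2l => //.
apply: (le_trans (hM f df)); apply: (@le_trans _ _ (`|M| * supnorm f)).
  by rewrite ler_wpM2r // ler_norm.
by apply: (@le_trans _ _ (`|M| * 1)); rewrite ?ler_wpM2l // mulr1 lerDl.
Qed.

Definition nonperiodic (y : C) := forall n, (0 < n)%N -> iter n B y != y.

(** Two distinct preimages of one point cannot both be periodic: over a common period each would be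
    recovered from the same image. *)
Lemma ex_nonperiodic : exists y, cabs y = 1 /\ nonperiodic y.
Proof.
have [u [v [u1 v1 uv Bu Bv]]] := two_preimages theta d2 ha (@cabs1 R).
have [hu|hu] := pselect (nonperiodic u); first by exists u.
have [hv|hv] := pselect (nonperiodic v); first by exists v.
have ex y : ~ nonperiodic y -> exists2 n, (0 < n)%N & iter n B y = y.
  move=> h; apply: contrapT => H; apply: h => n n0; apply/eqP => E; apply: H; by exists n.
have [p p0 hp] := ex u hu; have [q q0 hq] := ex v hv.
have mul k n y : iter n B y = y -> iter (k * n) B y = y.
  by move=> h; elim: k => [//|k IH]; rewrite mulSn iterD IH.
have Eu : iter (q * p) B u = u by exact: mul.
have Ev : iter (q * p) B v = v by rewrite mulnC; exact: mul.
move/eqP: uv; case; rewrite -Eu -Ev.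
have : (0 < q * p)%N by rewrite muln_gt0 q0.
by case: (q * p)%N => // n _; rewrite !iterSr Bu Bv.
Qed.

Variable y0 : C.
Hypothesis y01 : cabs y0 = 1.
Hypothesis y0np : nonperiodic y0.

(** As [y0] is not periodic, a point has at most one depth, so different depths separate
    supports. *)
Definition at_depth (D : nat) (y : C) := cabs y = 1 /\ iter D B y = y0.

Lemma depth_uniq D E y : at_depth D y -> at_depth E y -> D = E.
Proof.
wlog DE : D E / (D <= E)%N.
  by move=> H h1 h2; have [/H|/ltnW /H H'] := leqP D E; [apply|apply/esym/H'].
move=> [_ h1] [_ h2]; apply/eqP; rewrite eqn_leq DE /= leqNgt; apply/negP => lt.
have p0 : (0 < E - D)%N by rewrite subn_gt0.
by have /eqP := y0np p0; apply; rewrite -{1}h1 -iterD subnK.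
Qed.

Lemma depth_neq D E y z : at_depth D y -> at_depth E z -> D != E -> y != z.
Proof. by move=> h1 h2 DE; apply/eqP => yz; move/eqP: DE; apply; apply: depth_uniq h1 _; rewrite yz. Qed.

Lemma ex_depth D : exists y, at_depth D y.
Proof.
elim: D => [|D [y [y1 hy]]]; first by exists y0.
have [u [v [u1 _ _ Bu _]]] := two_preimages theta d2 ha y1.
by exists u; split=> //; rewrite iterSr Bu.
Qed.

Lemma depth_iter D j z : at_depth (D + j) z -> at_depth D (iter j B z).
Proof. by move=> [z1 h]; split; [exact: iter_circle|rewrite -iterD]. Qed.

Section Chain.
Variable mu : C.

(** The point [x_j] that lies [j] steps before the end of the orbit carries [mu^j / w_j(x_j)]. With
    this weight the adjoint moves the mass at [x_j] to [mu] times the mass at [x_(j-1) = B x_j]. *)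
Fixpoint chain_tail (K : nat) (z : C) : seq (C * C) :=
  if K is K'.+1 then (mu ^+ K / wprod K z, z) :: chain_tail K' (B z) else [::].

Definition chain K z := (1, iter K B z) :: chain_tail K z.

Lemma chain_tail_depth D K z p : at_depth (D + K) z -> p \in chain_tail K z ->
  exists e, [/\ (D < e)%N, (e <= D + K)%N & at_depth e p.2].
Proof.
elim: K z => //= K IH z hz; rewrite inE => /orP[/eqP ->|hp].
  by exists (D + K.+1)%N; split=> //; rewrite -[X in (X < _)%N]addn0 ltn_add2l.
have hz' : at_depth (D + K) (B z) by apply: (@depth_iter _ 1); rewrite -addnA addn1.
have [e [e1 e2 e3]] := IH _ hz' hp; exists e; split=> //.
by apply: (leq_trans e2); rewrite leq_add2l.
Qed.

Lemma ev_chainS K z g : ev (chain K.+1 z) g = ev (chain K (B z)) g + mu ^+ K.+1 / wprod K.+1 z * g z.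
Proof. by rewrite /chain [chain_tail _ _]/= iterSr !ev_cons /=; ring. Qed.

(** The shift by one step telescopes and leaves a term at each end: the image of the last point, and
    the farthest preimage [z], which is negligible once [|mu|] is below the growth rate along the
    orbit. *)
Lemma ev_chain_T K z f : cabs z = 1 -> ev (chain K z) (T f) =
  w (iter K B z) * f (B (iter K B z)) + mu * ev (chain K z) f - mu ^+ K.+1 / wprod K z * f z.
Proof.
elim: K z => [|K IH] z z1; have zl : cabs z <= 1 by rewrite z1.
  by rewrite /chain !ev_cons !ev_nil /= TE // expr1 invr1; ring.
have Bz1 := blaschke_circle theta ha z1.
rewrite !ev_chainS IH // TE // iterSr.
have n0 := wprod_neq0 theta ha wT K Bz1; have w0 := wT z1.
rewrite [wprod K.+1 z]/= [mu ^+ K.+2]exprS; field.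
by rewrite n0.
Qed.
End Chain.

Lemma ex_approx_functional lam (e : R) (D : nat) : cabs lam <= rho -> 0 < e ->
  exists (L : seq (C * C)) (E : nat), [/\ forall p, p \in L -> exists k, [/\ (D < k)%N, (k <= E)%N & at_depth k p.2],
    dual_norm (ev L) = 1 & dual_norm (adjoint T (ev L) - lam *: ev L) < e].
Proof.
move=> lr e0; have rho0 : 0 < rho := rho_gt0 theta ha wA wT.
have e2 : 0 < e / 2 by rewrite divr_gt0.
(* [mu = (1 - t) * lam] lies strictly inside the disc of radius [rho], so the far terms
   [mu^K / wprod K z] decay even if [|lam| = rho]; [t] is small enough for [|mu - lam| <= e / 2]. *)
pose t := Num.min (1 / 2 : R) (e / 2 / (rho + 1)).
have t0 : 0 < t by rewrite lt_min !divr_gt0 // ltr_wpDl // ltW.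
have t2 : t <= 1 / 2 by rewrite ge_min lexx.
have tr : t * (rho + 1) <= e / 2 by rewrite -ler_pdivlMr ?ltr_wpDl ?(ltW rho0) // ge_min lexx orbT.
pose mu := (1 - t)%:C * lam.
have mE : cabs mu = (1 - t) * cabs lam by rewrite cabsM cabs_real ger0_norm //; lra.
pose r := (1 - t / 2) * rho.
have r0 : 0 < r by rewrite mulr_gt0 //; lra.
have rr : r < rho by rewrite -[ltRHS]mul1r ltr_pM2r //; lra.
have mr : cabs mu < r.
  rewrite mE; apply: (@le_lt_trans _ _ ((1 - t) * rho)); first by rewrite ler_wpM2l //; lra.
  by rewrite ltr_pM2r //; lra.
have [N hN] := backward_growth ha wA wT sh r0 rr.
have [m [m0 hm]] := w_low wA wT.
pose W := supnorm w + 1; have W0 : 0 < W by rewrite ltr_wpDl // supnorm_ge0.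
have wW z : cabs z = 1 -> cabs (w z) <= W.
  by move=> z1; apply: (@le_trans _ _ (supnorm w)); rewrite ?lerDl // cabs_le_supnorm // z1.
pose q := cabs mu / r.
have q01 : 0 <= q < 1 by rewrite divr_ge0 ?cabs_ge0 ?(ltW r0) // ltr_pdivrMr // mul1r.
(* [rho + 1] bounds [|mu|], [2 / m] the two far terms divided by [w u] and [w v], and [W] the
   normalisation, since the functional has norm at least [1 / W]. *)
pose A := (rho + 1) * (2 / m) * W.
have A0 : 0 < A by rewrite !mulr_gt0 ?invr_gt0 // ltr_wpDl // ltW.
have [N2 hN2] := exprn_small q01 (divr_gt0 e2 A0).
pose K := maxn N N2.
have [y [y1 yD]] := ex_depth D.
have [u [v [u1 v1 uv Bu Bv]]] := two_preimages theta d2 ha y1.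
have du : at_depth D.+1 u by split=> //; rewrite iterSr Bu.
have dv : at_depth D.+1 v by split=> //; rewrite iterSr Bv.
have [zu [zu1 zuE zuW]] := hN K (leq_maxl _ _) u u1.
have [zv [zv1 zvE zvW]] := hN K (leq_maxl _ _) v v1.
have dzu : at_depth (D.+1 + K) zu by split=> //; rewrite iterD zuE; case: du.
have dzv : at_depth (D.+1 + K) zv by split=> //; rewrite iterD zvE; case: dv.
(* The mass at [u] is kept out of [L2]: it alone bounds the norm from below in [lowL]. *)
pose L2 := scl (w u)^-1 (chain_tail mu K zu) ++ scl (- (w v)^-1) (chain mu K zv).
pose L := [:: ((w u)^-1, u)] ++ L2.
pose E := (D.+1 + K)%N.
have dL2 p : p \in L2 -> (exists k, [/\ (D < k)%N, (k <= E)%N & at_depth k p.2]) /\ p.2 != u.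
  rewrite mem_cat => /orP[] /mem_scl [s hs <-].
    have [k [k1 k2 k3]] := chain_tail_depth dzu hs.
    by split; [exists k; split=> //; exact: ltnW|apply: (depth_neq k3 du); rewrite gtn_eqF].
  move: hs; rewrite /chain inE zvE => /orP[/eqP ->|hs] /=.
    by split; [exists D.+1; split=> //; exact: leq_addr|rewrite eq_sym].
  have [k [k1 k2 k3]] := chain_tail_depth dzv hs.
  by split; [exists k; split=> //; exact: ltnW|apply: (depth_neq k3 du); rewrite gtn_eqF].
have dL p : p \in L -> exists k, [/\ (D < k)%N, (k <= E)%N & at_depth k p.2].
  rewrite mem_cat inE => /orP[/eqP -> /=|/dL2 []//].
  by exists D.+1; split=> //; exact: leq_addr.
have cL : circ L by move=> p /dL [k [_ _ []]].
have cL2 : circ L2 by move=> p /dL2 [[k [_ _ []]]].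
have lowL : W^-1 <= dual_norm (ev L).
  have c1 : circ [:: ((w u)^-1, u)] by move=> p; rewrite inE => /eqP ->.
  apply: (@le_trans _ _ (dual_norm (ev [:: ((w u)^-1, u)]))); last first.
    by apply: dual_norm_disjoint => // p s; rewrite inE => /eqP -> /= /dL2 [].
  pose one := cut (fun=> (1 : C)).
  have d1 : disc_alg one by apply: disc_alg_cut_deriv => z _; exists 0; exact: cderiv_cst.
  have s1 : supnorm one <= 1 by apply: supnorm_le => z z1; rewrite /one cutE // cabs1.
  have := dual_norm_ge (ev_dual c1) d1 s1; rewrite ev_cons ev_nil /one cutE ?u1 // mulr1 addr0 cabsV.
  apply: le_trans; rewrite lef_pV2 ?posrE ?cabs_gt0 ?wT //; exact: wW.
have nL : 0 < dual_norm (ev L) by apply: lt_le_trans lowL; rewrite invr_gt0.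
have evL f : ev L f = (w u)^-1 * ev (chain mu K zu) f - (w v)^-1 * ev (chain mu K zv) f.
  have -> : ev L f = (w u)^-1 * f u + ev L2 f by exact: ev_cons.
  have -> : ev L2 f = (w u)^-1 * ev (chain_tail mu K zu) f + - (w v)^-1 * ev (chain mu K zv) f.
    by rewrite /L2 ev_cat !ev_scl.
  have -> : ev (chain mu K zu) f = f u + ev (chain_tail mu K zu) f by rewrite /chain ev_cons zuE mul1r.
  by ring.
have evT f : ev L (T f) - mu * ev L f = mu ^+ K.+1 * ((w v)^-1 * (wprod K zv)^-1 * f zv - (w u)^-1 * (wprod K zu)^-1 * f zu).
  rewrite !evL !ev_chain_T // zuE zvE Bu Bv.
  have wu := wT u1; have wv := wT v1.
  have pu := wprod_neq0 theta ha wT K zu1; have pv := wprod_neq0 theta ha wT K zv1.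
  by field; rewrite wu wv pu pv.
have small : dual_norm (adjoint T (ev L) - mu *: ev L) <= (rho + 1) * (2 / m) * q ^+ K.
  apply: dual_norm_le => f df f1.
  have -> : (adjoint T (ev L) - mu *: ev L) f = ev L (T f) - mu * ev L f by [].
  rewrite evT exprS -mulrA cabsM -[leRHS]mulrA; apply: ler_pM; rewrite ?cabs_ge0 //.
    by apply: (@le_trans _ _ rho); [exact: ltW (lt_trans mr rr)|rewrite lerDl].
  have one_term z v' : cabs z = 1 -> cabs v' = 1 -> r ^+ K <= cabs (wprod K z) ->
      cabs (mu ^+ K) * cabs ((w v')^-1 * (wprod K z)^-1 * f z) <= m^-1 * q ^+ K.
    move=> z1 v1' hz; rewrite !cabsM !cabsV cabsX.
    have fz : cabs (f z) <= 1 by apply: le_trans f1; apply: cabs_le_supnorm; rewrite ?z1.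
    have rK : 0 < r ^+ K by rewrite exprn_gt0.
    have -> : m^-1 * q ^+ K = cabs mu ^+ K * (m^-1 * (r ^+ K)^-1 * 1).
      by rewrite /q expr_div_n; ring.
    apply: ler_wpM2l; first by rewrite exprn_ge0 // cabs_ge0.
    have i1 : (cabs (w v'))^-1 <= m^-1 by rewrite lef_pV2 ?posrE ?cabs_gt0 ?wT ?hm.
    have i2 : (cabs (wprod K z))^-1 <= (r ^+ K)^-1 by rewrite lef_pV2 ?posrE // (lt_le_trans rK).
    apply: ler_pM; rewrite ?cabs_ge0 ?mulr_ge0 ?invr_ge0 ?cabs_ge0 //.
    by apply: ler_pM; rewrite ?invr_ge0 ?cabs_ge0.
  have t1 := one_term _ _ zv1 v1 zvW; have t3 := one_term _ _ zu1 u1 zuW.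
  rewrite cabsM; apply: (le_trans (ler_wpM2l (cabs_ge0 _) (cabsD _ _))); rewrite cabsN mulrDr.
  have -> : 2 / m * q ^+ K = m^-1 * q ^+ K + m^-1 * q ^+ K by ring.
  exact: lerD.
have sm2 : (rho + 1) * (2 / m) * q ^+ K < e / 2 / W.
  have := hN2 K (leq_maxr _ _); rewrite /A ltr_pdivlMr // => h.
  by rewrite ltr_pdivlMr //; move: h; rewrite mulrC -!mulrA [W * _]mulrC !mulrA.
pose n := dual_norm (ev L).
pose L' := scl (n^-1)%:C L.
have cn : cabs (n^-1)%:C = n^-1 by rewrite cabs_real ger0_norm // invr_ge0 ltW.
have nn0 : n%:C * (n^-1)%:C = 1 :> C by rewrite -rmorphM mulfV ?gt_eqF.
have dE := ev_dual cL.
exists L', E; split.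
- by move=> p /mem_scl [s /dL hs <-].
- rewrite /L' ev_scl; apply/eqP; rewrite eq_le; apply/andP; split.
    by apply: (le_trans (dual_normZ _ dE)); rewrite cn mulVf // gt_eqF.
  have := dual_normZ n%:C (dual_spaceZ (n^-1)%:C dE).
  rewrite scalerA nn0 scale1r cabs_real ger0_norm ?(ltW nL) // -/n.
  by rewrite -[X in X <= _ -> _]mulr1 ler_pM2l.
- have dS := adjoint_sub_dual mu dE.
  apply: (@le_lt_trans _ _ (n^-1 * dual_norm (adjoint T (ev L) - mu *: ev L) + cabs (mu - lam))).
    apply: dual_norm_le => f df f1; rewrite /L' ev_scl.
    have -> : (adjoint T ((n^-1)%:C *: ev L) - lam *: ((n^-1)%:C *: ev L)) f =
       (n^-1)%:C * (ev L (T f) - mu * ev L f) + (mu - lam) * ((n^-1)%:C * ev L f).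
      have -> : (adjoint T ((n^-1)%:C *: ev L) - lam *: ((n^-1)%:C *: ev L)) f =
        (n^-1)%:C * ev L (T f) - lam * ((n^-1)%:C * ev L f) by [].
      by ring.
    apply: (le_trans (cabsD _ _)); rewrite 3!cabsM cn; apply: lerD.
      apply: ler_wpM2l; first by rewrite invr_ge0 ltW.
      exact: (dual_norm_ge dS df f1).
    rewrite -[leRHS]mulr1; apply: ler_wpM2l; first exact: cabs_ge0.
    by rewrite mulrC ler_pdivrMr // mul1r; apply: dual_norm_ge.
  have k1 : n^-1 * dual_norm (adjoint T (ev L) - mu *: ev L) < e / 2.
    rewrite mulrC ltr_pdivrMr //; apply: (le_lt_trans small); apply: (lt_le_trans sm2).
    by apply: ler_wpM2l => //; exact: ltW.
  have k2 : cabs (mu - lam) <= e / 2.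
    have -> : mu - lam = (- t)%:C * lam.
      by rewrite /mu !rmorphD !rmorphN rmorph1; ring.
    rewrite cabsM cabs_real normrN ger0_norm ?(ltW t0) //; apply: le_trans tr; apply: ler_wpM2l; first exact: ltW.
    by apply: (le_trans lr); rewrite lerDl.
  by move: k1 k2; lra.
Qed.

Lemma lsf_disc lam : cabs lam <= rho -> sigma_lsf T lam.
Proof.
move=> lr.
have /choice [G hG] : forall Dn : nat * nat, exists LE : seq (C * C) * nat,
   [/\ forall p, p \in LE.1 -> exists k, [/\ (Dn.1 < k)%N, (k <= LE.2)%N & at_depth k p.2],
    dual_norm (ev LE.1) = 1 & dual_norm (adjoint T (ev LE.1) - lam *: ev LE.1) < Dn.2.+1%:R^-1].
  move=> [D n] /=; have e0 : (0 : R) < n.+1%:R^-1 by rewrite invr_gt0 ltr0n.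
  by have [L [E [h1 h2 h3]]] := ex_approx_functional D lr e0; exists (L, E).
(* Each functional starts beyond the greatest depth reached by its predecessor. *)
pose fix Dn n : nat := if n is m.+1 then (G (Dn m, m)).2 else 0%N.
pose L n := (G (Dn n, n)).1.
have hL n p : p \in L n -> exists k, [/\ (Dn n < k)%N, (k <= Dn n.+1)%N & at_depth k p.2].
  by have [h _ _] := hG (Dn n, n); exact: h.
have L1 n : dual_norm (ev (L n)) = 1 by have [_ h _] := hG (Dn n, n).
have Ls n : dual_norm (adjoint T (ev (L n)) - lam *: ev (L n)) < n.+1%:R^-1 by have [_ _ h] := hG (Dn n, n).
have cL n : circ (L n) by move=> p /hL [k [_ _ []]].
have Lne n : exists p, p \in L n.
  apply: contrapT => H; have := L1 n; have -> : L n = [::].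
    by case E : (L n) => [//|p l]; case: H; exists p; rewrite E mem_head.
  move=> h; have : (1 : R) <= 0.
    by rewrite -{1}h; apply: dual_norm_le => f _ _; rewrite ev_nil cabs0.
  by rewrite ler10.
have Dinc n : (Dn n <= Dn n.+1)%N by have [p /hL [k [k1 k2 _]]] := Lne n; exact: leq_trans (ltnW k1) k2.
have Dmono m n : (m <= n)%N -> (Dn m <= Dn n)%N.
  elim: n => [|n IH]; first by rewrite leqn0 => /eqP ->.
  rewrite leq_eqVlt => /orP[/eqP -> //|]; rewrite ltnS => /IH h; exact: leq_trans h (Dinc n).
have sep m n : (m < n)%N -> 1 <= dual_norm (ev (L n) - ev (L m)).
  move=> mn; rewrite -(L1 n).
  have -> : ev (L n) - ev (L m) = ev (L n ++ scl (-1) (L m)) by rewrite ev_cat ev_scl scaleN1r.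
  apply: dual_norm_disjoint => //; first exact: circ_scl.
  move=> p q /hL [k [k1 _ k3]] /mem_scl [s /hL [l [_ l2 l3]] <-]; apply: depth_neq l3 k3 _.
  by rewrite ltn_eqF // (leq_ltn_trans l2) // (leq_ltn_trans (Dmono _ _ mn)).
exists (fun n => ev (L n)); split.
  split=> //; first by move=> n; exact: ev_dual.
  apply: eps_cvg0 => [n|e e0].
    by apply: dual_norm_ge0; apply: adjoint_sub_dual; exact: ev_dual.
  have [N hN] := eventually_eps 1 e0; exists N => n /hN h; apply: lt_trans (Ls n) _.
  rewrite invf_plt ?posrE ?ltr0n // -[e^-1]mul1r ltr_pdivrMr //; apply: (le_lt_trans h).
  by rewrite ltr_pM2r // ltr_nat.
move=> [phi [y [phi_mono dy yc]]].
have h2 : (0 : R) < 1 / 2 by rewrite divr_gt0.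
have [N hN] := cvg0_eps yc h2.
have b1 := hN N (leqnn N); have b2 := hN N.+1 (leqnSn N).
have := sep _ _ (phi_mono _ _ (ltnSn N)).
have := dual_norm_tri (ev_dual (cL (phi N.+1))) (ev_dual (cL (phi N))) dy.
by move: b1 b2; lra.
Qed.
End LowerSemiFredholm.

(** * The upper semi-Fredholm spectrum *)

Section Dini.
Variable R : realType.
Implicit Types (A Q : nat -> R -> R) (t : R).

(** A locally uniform upper limit: an upper bound is what survives where the pointwise limit of
    [A * Q^n] jumps. *)
Definition locally_dominated (u : nat -> R -> R) t (c : R) := forall e, 0 < e -> exists r N, 0 < r /\
  forall n y, (N <= n)%N -> `|y - t| < r -> u n y <= c + e.

Lemma locally_dominated_sum M (u : nat -> nat -> R -> R) t (c : nat -> R) :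
  (forall k, (k < M)%N -> locally_dominated (u k) t (c k)) ->
  locally_dominated (fun n y => \sum_(k < M) u k n y) t (\sum_(k < M) c k).
Proof.
elim: M => [|M IH] h e e0.
  by exists 1, 0%N; split=> // n y _ _; rewrite !big_ord0 add0r ltW.
have e2 : 0 < e / 2 by rewrite divr_gt0.
have [r1 [N1 [r10 h1]]] := IH (fun k kM => h k (leqW kM)) _ e2.
have [r2 [N2 [r20 h2]]] := h M (ltnSn M) _ e2.
exists (Num.min r1 r2), (maxn N1 N2); split; first by rewrite lt_min r10.
move=> n y; rewrite geq_max lt_min => /andP[n1 n2] /andP[y1 y2].
rewrite !big_ord_recr /=; have := h1 n y n1 y1; have := h2 n y n2 y2; lra.
Qed.

Lemma locally_dominated_pow (A Q : R -> R) t : rcont A -> rcont Q -> (forall y, 0 <= A y) -> (forall y, 0 <= Q y <= 1) ->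
  locally_dominated (fun n y => A y * Q y ^+ n) t (if Q t < 1 then 0 else A t).
Proof.
move=> cA cQ A0 Q01 e e0; case: ifPn => [Qt|_].
  have [r1 [r10 h1]] := cA t 1 ltr01.
  have d0 : 0 < (1 - Q t) / 2 by rewrite divr_gt0 // subr_gt0.
  have [r2 [r20 h2]] := cQ t _ d0.
  pose q := (1 + Q t) / 2; have [Qt0 Qt1] := andP (Q01 t).
  have q01 : 0 <= q < 1 by rewrite /q; lra.
  have M0 : 0 < A t + 1 by rewrite ltr_wpDl.
  have [N hN] := exprn_small q01 (divr_gt0 e0 M0).
  exists (Num.min r1 r2), N; split; first by rewrite lt_min r10.
  move=> n y Nn; rewrite lt_min => /andP[y1 y2]; rewrite add0r.
  have a1 : A y <= A t + 1 by have := h1 y y1; rewrite ltr_norml; lra.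
  have b1 : Q y <= q by have := h2 y y2; rewrite ltr_norml /q; lra.
  have [Qy0 _] := andP (Q01 y); have [q0 _] := andP q01.
  have b2 : Q y ^+ n <= q ^+ n by rewrite lerXn2r ?nnegrE.
  apply: (@le_trans _ _ ((A t + 1) * q ^+ n)); first by apply: ler_pM; rewrite ?exprn_ge0.
  by rewrite mulrC -ler_pdivlMr // ltW // hN.
have [r [r0 h]] := cA t e e0; exists r, 0%N; split=> // n y _ hy.
have [Qy0 Qy1] := andP (Q01 y).
apply: (@le_trans _ _ (A y)); first by rewrite -[leRHS]mulr1 ler_wpM2l // exprn_ile1.
by have := h y hy; rewrite ltr_norml; lra.
Qed.

(** The powers [Q k t ^+ n] decrease, so a bound on the pointwise limit, where only the terms with
    [Q k t = 1] remain, holds up to [e] near each point and, by bisection, uniformly. *)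
Lemma dini M A Q (b a1 a2 : R) : a1 <= a2 -> (forall k, rcont (A k)) -> (forall k, rcont (Q k)) ->
  (forall k y, 0 <= A k y) -> (forall k y, 0 <= Q k y <= 1) ->
  (forall t, \sum_(k < M) (if Q k t < 1 then 0 else A k t) <= b) ->
  forall e, 0 < e -> exists N, forall n t, (N <= n)%N -> a1 <= t <= a2 ->
    \sum_(k < M) A k t * Q k t ^+ n <= b + e.
Proof.
move=> a12 cA cQ A0 Q01 hb e e0.
apply: (@itv_bisection R (fun x y => exists N, forall n t, (N <= n)%N -> x <= t <= y ->
    \sum_(k < M) A k t * Q k t ^+ n <= b + e)) => //.
  move=> x y xy [N1 h1] [N2 h2]; exists (maxn N1 N2) => n t; rewrite geq_max => /andP[n1 n2] /andP[t1 t2].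
  have [le|lt] := leP t ((x + y) / 2); first by apply: h1; rewrite ?t1.
  by apply: h2; rewrite ?t2 ?(ltW lt).
move=> t _.
have [r [N [r0 h]]] := locally_dominated_sum (u := fun k n y => A k y * Q k y ^+ n) (M := M)
  (fun k _ => locally_dominated_pow t (cA k) (cQ k) (A0 k) (Q01 k)) e0.
exists r; split=> // x y _ _ /andP[xt ty] xy; exists N => n s Nn /andP[xs sy].
apply: (@le_trans _ _ (\sum_(k < M) (if Q k t < 1 then 0 else A k t) + e)); last by rewrite lerD2r.
by apply: h => //; rewrite ltr_norml; lra.
Qed.

Lemma sum_at_most_one M (P : nat -> bool) (v : nat -> R) (b : R) : 0 <= b ->
  (forall i j, P i -> P j -> i = j) -> (forall i, (i < M)%N -> P i -> v i <= b) ->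
  \sum_(k < M) (if P k then v k else 0) <= b.
Proof.
move=> b0 uniq hv; have [[k Pk]|H] := pselect (exists k : 'I_M, P k).
  rewrite (bigD1 k) //= Pk big1 ?addr0 ?hv // => j jk; case: ifPn => // Pj.
  by move/eqP: jk; case; apply: val_inj; exact: uniq.
rewrite big1 // => k _; case: ifPn => // Pk; by case: H; exists k.
Qed.

Lemma rcont_cst (c : R) : rcont (fun=> c).
Proof. by move=> x e e0; exists 1; split=> // y _; rewrite subrr normr0. Qed.

Lemma sum_pow_small M (A q : nat -> R) e : (forall k, 0 <= A k) -> (forall k, 0 <= q k <= 1) ->
  (forall k, (k < M)%N -> A k = 0 \/ q k < 1) -> 0 < e -> exists N, forall n, (N <= n)%N -> \sum_(k < M) A k * q k ^+ n <= e.
Proof.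
move=> A0 q01 h e0.
have [N hN] := @dini M (fun k _ => A k) (fun k _ => q k) 0 0 0 (lexx 0) (fun k => rcont_cst (A k)) (fun k => rcont_cst (q k))
  (fun k _ => A0 k) (fun k _ => q01 k) (fun=> ltac:(by rewrite big1 // => k _; case: (h k (ltn_ord k)) => [->|->] //; case: ifP)) e e0.
by exists N => n Nn; have := hN n 0 Nn; rewrite lexx add0r; apply.
Qed.
End Dini.

(** * Peaking functions *)

Section Peak.
Variable R : realType.
Local Notation C := R[i].

(** Maps the closed disc into the disc with diameter [[0, 1]]; the modulus is 1 at [p] only, so high
    powers concentrate at [p]. *)
Definition peak (p z : C) : C := (1 + p^* * z) / 2%:R.

Lemma cabs2 : cabs (2%:R : C) = 2.
Proof.
have -> : (2%:R : C) = (2%:R : R)%:C by rewrite rmorph_nat.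
by rewrite cabs_real ger0_norm.
Qed.

Lemma peak_le (p z : C) : cabs p = 1 -> cabs (peak p z) <= (1 + cabs z) / 2.
Proof.
move=> p1; rewrite /peak cabsM cabsV cabs2 ler_pM2r ?invr_gt0 //.
by apply: (le_trans (cabsD _ _)); rewrite cabs1 cabsM cabs_conj p1 mul1r.
Qed.

Lemma peak_le1 (p z : C) : cabs p = 1 -> cabs z <= 1 -> cabs (peak p z) <= 1.
Proof. by move=> p1 z1; apply: (le_trans (peak_le _ p1)); lra. Qed.

Lemma peak_self (p : C) : cabs p = 1 -> peak p p = 1.
Proof. by move=> p1; rewrite /peak [p^* * p]mulrC -sqr_cabsE p1 expr1n -[1 + _]/(2%:R) divff // pnatr_eq0. Qed.

Lemma peak_eq1 (p z : C) : cabs p = 1 -> cabs z = 1 -> 1 <= cabs (peak p z) -> z = p.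
Proof.
move=> p1 z1; have y1 : cabs (p^* * z) = 1 by rewrite cabsM cabs_conj p1 z1 mul1r.
rewrite /peak cabsM cabsV cabs2 ler_pdivlMr // mul1r => h.
suff yE : p^* * z = 1.
  apply/eqP; apply/negPn/negP => zp; have := conj_neq p1 zp; by rewrite yE subrr eqxx.
have h2 : 4 <= cabs (1 + p^* * z) ^+ 2.
  have -> : (4 : R) = 2 ^+ 2 by ring.
  by rewrite lerXn2r ?nnegrE ?cabs_ge0.
have y2 : cabs (p^* * z) ^+ 2 = 1 by rewrite y1 expr1n.
move: h2 y2; case: (p^* * z) => u v; rewrite !cabs_sqr /= add0r => h2 y2.
have u1 : 1 <= u.
  have E : (1 + u) ^+ 2 + v ^+ 2 = 1 + 2 * u + (u ^+ 2 + v ^+ 2) by ring.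
  by move: h2; rewrite E y2; lra.
have u2 : 1 <= u ^+ 2 by rewrite -(expr1n _ 2) lerXn2r ?nnegrE //; lra.
have v2 : v ^+ 2 <= 0 by lra.
have v0 : v = 0 by apply/eqP; rewrite -sqrf_eq0 eq_le v2 sqr_ge0.
rewrite v0 expr0n addr0 in y2.
have -> : u = 1 by apply/eqP; rewrite -(eqrXn2 (n := 2)) // ?expr1n ?y2 //; lra.
by rewrite v0.
Qed.

Lemma disc_alg_peak (p : C) n : disc_alg (cut (fun z => peak p z ^+ n)).
Proof.
apply: disc_alg_cut_deriv => z z1.
have dy : cderiv (fun z => p^* * z) z (p^*) by have := cderivZ (p^*) (cderiv_id z); rewrite mulr1.
have dp := cderivM (cderivD (cderiv_cst 1 z) dy) (cderiv_cst (2%:R^-1) z).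
elim: n => [|n [L hL]]; first by exists 0; apply: cderiv_ext (cderiv_cst 1 z) => y; rewrite expr0.
by eexists; apply: cderiv_ext (cderivM dp hL) => y; rewrite exprS.
Qed.

Lemma expi_surj_itv (z : C) : cabs z = 1 -> exists t, 0 <= t <= (@pi R *+ 2) /\ expi t = z.
Proof.
move=> /expi_surj [t <-]; have [k /andP[k1 k2]] := repr_period t.
exists (t - k%:~R * (@pi R *+ 2)); split.
  by move: k2; rewrite rmorphD /= mulrDl mul1r; lra.
by apply: expi_cong; exists (- k); rewrite rmorphN /= mulNr.
Qed.

Lemma peak_rcont (p : C) : cabs p = 1 -> rcont (fun t : R => cabs (peak p (expi t))).
Proof.
move=> p1 x e e0; exists e; split=> // y hy; apply: le_lt_trans hy.
have h u v : cabs (peak p (expi u)) - cabs (peak p (expi v)) <= `|u - v|.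
  apply: (le_trans (cabs_sub_ge _ _)).
  have -> : peak p (expi u) - peak p (expi v) = p^* * (expi u - expi v) / 2%:R by rewrite /peak; ring.
  rewrite cabsM cabsV cabs2 cabsM cabs_conj p1 mul1r.
  by have := expi_lip u v; have := cabs_ge0 (expi u - expi v); lra.
rewrite ler_norml; have := h y x; have := h x y; rewrite [`|x - y|]distrC; lra.
Qed.
End Peak.

(** * Approximate eigenfunctions of the operator *)

Section UpperSemiFredholm.
Variables (R : realType) (d : nat) (theta : R) (a : 'I_d -> R[i]) (w : R[i] -> R[i]).
Hypothesis d2 : (2 <= d)%N.
Hypothesis ha : forall j, cabs (a j) < 1.
Hypothesis wA : disc_alg w.
Hypothesis wT : forall z, cabs z = 1 -> w z != 0.
Local Notation C := R[i].
Local Notation B := (blaschke theta a).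
Local Notation T := (wcomp w B).
Local Notation wprod := (wprod theta a w).
Local Notation rho := (rho theta a w).
Local Notation b := (blasch_lift theta a).
Hypothesis sh : circle_shadowing theta a w.
Implicit Types (f g : C -> C) (z lam : C).

Lemma iter_expi k t : iter k B (expi t) = expi (iter k b t).
Proof. by elim: k => //= k ->; rewrite expi_blasch_lift. Qed.

Lemma iter_b_cont k : rcont (iter k b).
Proof.
elim: k => [|k IH] /=; first by move=> x e e0; exists e.
exact: rcont_comp (blasch_lift_cont theta ha) IH.
Qed.

Lemma wprod_rcont k : rcont (fun t : R => cabs (wprod k (expi t))).
Proof.
elim: k => [|k IH]; first by move=> x e e0; exists 1; split=> // y _ /=; rewrite subrr normr0.
have h := rcontM (cabs_w_cont wA 0) (rcont_comp IH (blasch_lift_cont theta ha)).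
move=> x e e0; have [r [r0 hr]] := h x e e0; exists r; split=> // y /hr.
by rewrite /= !add0r !cabsM !expi_blasch_lift.
Qed.

Lemma peak_iter_rcont p k : cabs p = 1 -> rcont (fun t : R => cabs (peak p (iter k B (expi t)))).
Proof.
move=> p1; have h := rcont_comp (peak_rcont p1) (iter_b_cont k).
by move=> x e e0; have [r [r0 hr]] := h x e e0; exists r; split=> // y /hr; rewrite !iter_expi.
Qed.

(** By [blaschke_defect], [B] maps a smaller closed disc into one of radius below 1;
    [x <= (1 + x^2) / 2] avoids a square root. *)
Lemma iter_interior k (s : R) : s < 1 -> exists s' : R, 0 <= s' < 1 /\ forall z, cabs z <= s -> cabs (iter k B z) <= s'.
Proof.
move=> s1; have [k0 [kp hk]] := blaschke_defect theta d2 ha.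
elim: k => [|k [s' [/andP[s0' s1'] IH]]].
  have [s0|s0] := leP 0 s; first by exists s; rewrite s0.
  exists 0; rewrite lexx ltr01; split=> // z /= /le_lt_trans /(_ s0); by rewrite ltNge cabs_ge0.
pose t := 1 - k0 * (1 - s' ^+ 2).
have p0 : 0 < 1 - s' ^+ 2 by rewrite subr_gt0 expr_lt1.
have t1 : t < 1 by rewrite gtrBl mulr_gt0.
exists (Num.max 0 ((1 + t) / 2)); split; first by rewrite le_max lexx gt_max ltr01; lra.
move=> z /IH hz; have zl : cabs (iter k B z) <= 1 by exact: le_trans hz (ltW s1').
have := hk _ zl; rewrite iterS le_max; set x := cabs (B _) => h; apply/orP; right.
have c1 : k0 * (1 - s' ^+ 2) <= k0 * (1 - cabs (iter k B z) ^+ 2).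
  by rewrite ler_pM2l // lerD2l lerN2 lerXn2r ?nnegrE ?cabs_ge0.
have c2 : x ^+ 2 <= t by rewrite /t; lra.
have := sqr_ge0 (1 - x); have -> : (1 - x) ^+ 2 = 1 - 2 * x + x ^+ 2 by ring.
by lra.
Qed.

(** Truncated subtraction makes the exponent [|k - m|]. *)
Definition tent (th : R) (m k : nat) : R := th ^+ ((k - m) + (m - k)).

(** Neighbouring values have ratio [th] or its inverse, so they differ by at most [(1 - th) / th]
    times the one at [k.+1], and that factor is [e / rh]. *)
Lemma tent_step (th e rh : R) m k : 0 < th -> th < 1 -> (1 - th) * rh = e * th -> 0 < rh ->
  `|tent th m k - tent th m k.+1| * rh <= e * tent th m k.+1.
Proof.
move=> t0 t1 E r0; rewrite /tent; have [km|mk] := ltnP k m.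
  have -> : ((k - m) + (m - k) = ((k.+1 - m) + (m - k.+1)).+1)%N by lia.
  set n := ((k.+1 - m) + _)%N; have p0 : 0 < th ^+ n by rewrite exprn_gt0.
  rewrite exprS; have -> : th * th ^+ n - th ^+ n = - ((1 - th) * th ^+ n) by ring.
  rewrite normrN ger0_norm; last by rewrite mulr_ge0 ?subr_ge0 ?ltW.
  rewrite mulrAC E -mulrA; have e0 : 0 <= e.
    have : 0 < e * th by rewrite -E mulr_gt0 // subr_gt0.
    by rewrite pmulr_lgt0 // => /ltW.
  by rewrite ler_wpM2l // -[leRHS]mul1r ler_pM2r // ltW.
have -> : ((k.+1 - m) + (m - k.+1) = ((k - m) + (m - k)).+1)%N by lia.
set n := ((k - m) + _)%N; have p0 : 0 < th ^+ n by rewrite exprn_gt0.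
rewrite exprS; have -> : th ^+ n - th * th ^+ n = (1 - th) * th ^+ n by ring.
rewrite ger0_norm; last by rewrite mulr_ge0 ?subr_ge0 ?ltW.
by rewrite mulrAC E mulrA.
Qed.

(** Coefficients of [T - lam] applied to the sum of the [al k T^k f]: an index shift minus [lam]. *)
Definition twist (lam : C) (al : nat -> C) (k : nat) : C := (if k is j.+1 then al j else 0) - lam * al k.

(** Everything is measured against [S], the supremum of [|al k wprod k x|] over the preimages [x] of
    [p]. In the interior the tent varies slowly; at both ends of the range it must have decayed
    below [e * S], which its centre [m] and the length [K] ensure. *)
Lemma ex_weights lam p (e : R) : cabs lam = rho -> cabs p = 1 -> 0 < e -> exists (K : nat) (al : nat -> C) (S : R),
  [/\ 0 < S, al K.+1 = 0,
   exists k x, [/\ (k <= K)%N, cabs x = 1, iter k B x = p & S / 2 <= cabs (al k * wprod k x)] &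
   forall k x, (k <= K.+1)%N -> cabs x = 1 -> iter k B x = p -> cabs (twist lam al k * wprod k x) <= e * S].
Proof.
move=> lr p1 e0; have rho0 : 0 < rho := rho_gt0 theta ha wA wT.
have l0 : 0 < cabs lam by rewrite lr.
have ln0 : lam != 0 by rewrite -cabs_gt0.
pose th := rho / (rho + e).
have re0 : 0 < rho + e by rewrite addr_gt0.
have th0 : 0 < th by rewrite divr_gt0.
have th1 : th < 1 by rewrite ltr_pdivrMr // mul1r ltrDl.
have thE : (1 - th) * rho = e * th by rewrite /th; field; rewrite gt_eqF.
clearbody th.
(* As [r > th * rho], the value [s0 = (r / rho)^m] reached at index [m] dominates the end value
   [th^m] at index 0. *)
pose r := (th * rho + rho) / 2.
have thr : th * rho < rho by rewrite -[ltRHS]mul1r ltr_pM2r.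
have thr0 : 0 < th * rho by rewrite mulr_gt0.
have r0 : 0 < r by rewrite /r; lra.
have rr : r < rho by rewrite /r; lra.
have tr : th * rho < r by rewrite /r; lra.
clearbody r.
have [N hN] := backward_growth ha wA wT sh r0 rr.
pose q1 := th * rho / r.
have q101 : 0 <= q1 < 1 by rewrite divr_ge0 ?ltW // ltr_pdivrMr // mul1r.
have [N1 hN1] := exprn_small q101 (divr_gt0 e0 rho0).
pose m := maxn N N1.
have [xm [xm1 xmE xmW]] := hN m (leq_maxl _ _) p p1.
pose s0 := (r / rho) ^+ m.
have s00 : 0 < s0 by rewrite exprn_gt0 // divr_gt0.
(* As [th * r' < rho], the decay of the tent beats the growth bound [K' * r'^k] and makes the end at
   [K.+1] small. *)
pose r' := (rho + rho / th) / 2.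
have rth : rho < rho / th by rewrite ltr_pdivlMr // mulrC.
have rr' : rho < r' by rewrite /r'; lra.
have tr' : th * r' < rho.
  have : rho / th * th = rho by rewrite divfK // gt_eqF.
  have : r' < rho / th by rewrite /r'; lra.
  by rewrite -(ltr_pM2r th0) => h1 h2; rewrite mulrC -[ltRHS]h2.
have r0' : 0 < r' := lt_trans rho0 rr'.
clearbody r'.
have [K' [K0' hK']] := wprod_upper ha wA wT rr'.
pose q2 := th * r' / rho.
have q201 : 0 <= q2 < 1 by rewrite divr_ge0 ?mulr_ge0 ?ltW // ltr_pdivrMr // mul1r.
pose c0 := K' * r' / th ^+ m.
have c00 : 0 < c0 by rewrite divr_gt0 ?mulr_gt0 ?exprn_gt0.
have [N2 hN2] := exprn_small q201 (divr_gt0 (mulr_gt0 e0 s00) c00).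
pose K := maxn m N2.
have mK : (m <= K)%N by exact: leq_maxl.
pose al k : C := if (k <= K)%N then (tent th m k)%:C * lam^-1 ^+ k else 0.
have alE k : (k <= K)%N -> cabs (al k) = tent th m k / rho ^+ k.
  move=> kK; rewrite /al kK cabsM cabs_real cabsX cabsV lr exprVn ger0_norm //.
  by rewrite exprn_ge0 // ltW.
pose V := [set v : R | exists k x, [/\ (k <= K)%N, cabs x = 1, iter k B x = p & v = cabs (al k * wprod k x)]].
have Vub : has_ubound V.
  exists (\sum_(k < K.+1) cabs (al k) * supnorm w ^+ k) => _ [k [x [kK x1 _ ->]]].
  have w0 : 0 <= supnorm w by exact: supnorm_ge0.
  have kK' : (k < K.+1)%N by rewrite ltnS.
  rewrite (bigD1 (Ordinal kK')) //= -[leLHS]addr0; apply: lerD.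
    rewrite cabsM ler_wpM2l ?cabs_ge0 // wprod_le // x1 //.
  by apply: sumr_ge0 => j _; rewrite mulr_ge0 ?cabs_ge0 ?exprn_ge0.
have Vm : V (cabs (al m * wprod m xm)) by exists m, xm.
have Vs : has_sup V by split=> //; exists (cabs (al m * wprod m xm)).
pose S := sup V.
have SV k x : (k <= K)%N -> cabs x = 1 -> iter k B x = p -> cabs (al k * wprod k x) <= S.
  by move=> kK x1 xE; apply: ub_le_sup => //; exists k, x.
have s0S : s0 <= S.
  apply: le_trans (SV m xm mK xm1 xmE); rewrite cabsM alE // /tent subnn expr0 mul1r /s0 expr_div_n mulrC.
  by rewrite ler_wpM2l // invr_ge0 exprn_ge0 // ltW.
have S0 : 0 < S := lt_le_trans s00 s0S.
exists K, al, S; split=> //.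
- by rewrite /al ltnn.
- have S2 : 0 < S / 2 by rewrite divr_gt0.
  have [_ [k [x [kK x1 xE ->]]] h] := sup_adherent S2 Vs.
  by exists k, x; split=> //; move: h; rewrite -/S; lra.
(* Three ranges: index 0, where only [lam * al 0] remains; index [K.+1], where only [al K] remains;
   the interior, governed by [tent_step]. *)
move=> [|k] x kK x1 xE.
  rewrite /twist sub0r /= mulr1 cabsN cabsM lr alE // /tent sub0n subn0 add0n expr0 divr1.
  apply: (@le_trans _ _ (e * s0)); last by rewrite ler_pM2l.
  have := hN1 m (leq_maxr _ _); rewrite ltr_pdivlMr // => h.
  have -> : rho * th ^+ m = q1 ^+ m * rho * s0.
    rewrite /q1 /s0 !expr_div_n !exprMn; field; rewrite !expf_neq0 ?gt_eqF //.
  by rewrite ler_pM2r // ltW.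
rewrite ltnS in kK; move: kK; rewrite leq_eqVlt => /orP[/eqP kK|kK].
  rewrite /twist kK {2}/al ltnn mulr0 subr0 cabsM alE //.
  apply: (@le_trans _ _ (e * s0)); last by rewrite ler_pM2l.
  have := hN2 K (leq_maxr _ _); rewrite ltr_pdivlMr // => h.
  apply: (@le_trans _ _ (q2 ^+ K * c0)); last exact: ltW.
  apply: (@le_trans _ _ (tent th m K / rho ^+ K * (K' * r' ^+ K.+1))).
    apply: ler_wpM2l; last by rewrite -kK; exact: hK'.
    by rewrite divr_ge0 // exprn_ge0 // ltW.
  apply: eq_ler; rewrite /tent; have -> : (m - K = 0)%N by apply/eqP.
  have tE : th ^+ K = th ^+ (K - m) * th ^+ m by rewrite -exprD subnK.
  rewrite addn0 /q2 /c0 expr_div_n exprMn tE exprS; field.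
  by rewrite !expf_neq0 ?gt_eqF.
have kK1 : (k <= K)%N := ltnW kK.
rewrite cabsM; apply: (@le_trans _ _ (e * cabs (al k.+1) * cabs (wprod k.+1 x))); last first.
  by rewrite -mulrA ler_pM2l // -cabsM SV.
apply: ler_wpM2r; first exact: cabs_ge0.
rewrite alE // /twist /al kK kK1.
have -> : (tent th m k)%:C * lam^-1 ^+ k - lam * ((tent th m k.+1)%:C * lam^-1 ^+ k.+1) =
   (tent th m k - tent th m k.+1)%:C * lam^-1 ^+ k.
  by rewrite rmorphB exprS; field.
rewrite cabsM cabs_real cabsX cabsV lr exprVn.
have rk : 0 < rho ^+ k by rewrite exprn_gt0.
rewrite mulrA ler_pdivlMr ?exprn_gt0 // exprS.
have -> : `|tent th m k - tent th m k.+1| / rho ^+ k * (rho * rho ^+ k) = `|tent th m k - tent th m k.+1| * rho.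
  by field; rewrite gt_eqF.
exact: tent_step.
Qed.

Variable p : C.
Hypothesis p1 : cabs p = 1.
Hypothesis p_np : nonperiodic theta a p.

Lemma ex_approx_eigenfunction lam (e s : R) : cabs lam = rho -> 0 < e -> s < 1 -> exists F,
  [/\ disc_alg F, supnorm F = 1, supnorm (T F - lam *: F) < e & forall z, cabs z <= s -> cabs (F z) <= e].
Proof.
(* The residual will be at most [e / 8 * S] and the norm at least [S / 4], so that their quotient is
   at most [e / 2]. *)
move=> lr e0 s1; have e16 : 0 < e / 16 by rewrite divr_gt0.
have [K [al [S [S0 alK [k0 [x0 [k0K x01 x0E x0S]]] hg]]]] := ex_weights lr p1 e16.
pose f n := cut (fun z => peak p z ^+ n).
have df n : disc_alg (f n) by exact: disc_alg_peak.
pose F n : C -> C := \sum_(k < K.+1) al k *: iter k T (f n).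
have dF n : disc_alg (F n).
  by apply: disc_alg_sum => k; apply: disc_algZ; exact: disc_alg_iterT.
have fE n k z : cabs z <= 1 -> iter k T (f n) z = wprod k z * peak p (iter k B z) ^+ n.
  by move=> z1; rewrite iterTE // /f cutE // iter_disc.
have FE n z : cabs z <= 1 -> F n z = \sum_(k < K.+1) al k * (wprod k z * peak p (iter k B z) ^+ n).
  by move=> z1; rewrite /F fct_sumE; apply: eq_bigr => k _; rewrite fct_scaleE fE.
have GE n z : cabs z <= 1 -> (T (F n) - lam *: F n) z =
    \sum_(k < K.+2) twist lam al k * (wprod k z * peak p (iter k B z) ^+ n).
  move=> z1; have -> : (T (F n) - lam *: F n) z = T (F n) z - lam * F n z by [].
  pose g k := wprod k z * peak p (iter k B z) ^+ n.
  have -> : T (F n) z = \sum_(k < K.+1) al k * g k.+1.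
    rewrite TE // FE ?blaschke_le1 // mulr_sumr; apply: eq_bigr => k _.
    by rewrite /g iterSr [wprod k.+1 z]/= mulrCA !mulrA.
  have -> : F n z = \sum_(k < K.+2) al k * g k.
    by rewrite FE // [RHS]big_ord_recr /= alK mul0r addr0.
  rewrite /twist; under [RHS]eq_bigr do rewrite mulrBl -mulrA -/(g _).
  rewrite sumrB -mulr_sumr; congr (_ - _).
  by rewrite [RHS]big_ord_recl /= mul0r add0r.
pose A k t := cabs (twist lam al k) * cabs (wprod k (expi t)).
pose Q k t := cabs (peak p (iter k B (expi t))).
have cA k : rcont (A k) by apply: (rcontM (rcont_cst _)); exact: wprod_rcont.
have cQ k : rcont (Q k) by exact: peak_iter_rcont.
have it1 k t : cabs (iter k B (expi t)) = 1 by apply: iter_circle => //; exact: cabs_expi.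
have A0 k t : 0 <= A k t by rewrite mulr_ge0 ?cabs_ge0.
have Q01 k t : 0 <= Q k t <= 1 by rewrite cabs_ge0 peak_le1 // it1.
have eS : 0 < e / 16 * S by rewrite mulr_gt0.
have uniq i j x : cabs x = 1 -> iter i B x = p -> iter j B x = p -> i = j.
  by move=> x1 h1 h2; apply: (depth_uniq p_np (y := x)); split.
(* [p] is not periodic, so at most one [k] leads from the given point to [p]; the limit sum has at
   most one term, bounded by [ex_weights]. *)
have hb t : \sum_(k < K.+2) (if Q k t < 1 then 0 else A k t) <= e / 16 * S.
  under eq_bigr do rewrite ltNge if_neg.
  have Qp k : 1 <= Q k t -> iter k B (expi t) = p by apply: peak_eq1.
  apply: (@sum_at_most_one R K.+2 (fun k => 1 <= Q k t) (fun k => A k t)); first exact: ltW.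
    by move=> i j /Qp h1 /Qp h2; apply: uniq h1 h2; exact: cabs_expi.
  by move=> k kK /Qp h; rewrite /A -cabsM; apply: hg => //; exact: cabs_expi.
have [N1 hN1] := dini (ltW (@tau_gt0 R)) cA cQ A0 Q01 hb eS.
have up n : (N1 <= n)%N -> supnorm (T (F n) - lam *: F n) <= e / 16 * S + e / 16 * S.
  move=> nN; apply: supnorm_le_circle.
    by apply: disc_algB; [exact: disc_alg_T|exact: disc_algZ].
  move=> z z1; have [t [t01 tz]] := expi_surj_itv z1; rewrite GE ?z1 //.
  apply: (le_trans (cabs_sum _ _ _)); apply: le_trans (hN1 n t nN t01).
  by apply: ler_sum => k _; rewrite /A /Q tz mulrA cabsM [cabs (twist _ _ _ * _)]cabsM cabsX.
have S4 : 0 < S / 4 by rewrite divr_gt0.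
(* Index [k0] carries the main term at [x0] and is removed; the other terms tend to 0 because [x0]
   reaches [p] at time [k0] only. *)
pose A' k := if k == k0 then 0 else cabs (al k * wprod k x0).
pose q' k := cabs (peak p (iter k B x0)).
have A0' k : 0 <= A' k by rewrite /A'; case: ifP => // _; exact: cabs_ge0.
have q01' k : 0 <= q' k <= 1 by rewrite cabs_ge0 peak_le1 // iter_circle.
have [|N2 hN2] := @sum_pow_small R K.+1 A' q' (S / 4) A0' q01' _ S4.
  move=> k _; rewrite /A'; case: eqP => [_|kk]; [by left|right].
  rewrite ltNge; apply/negP => /(peak_eq1 p1 (iter_circle theta ha k x01)) h.
  by apply: kk; exact: uniq x01 h x0E.
have low n : (N2 <= n)%N -> S / 4 <= supnorm (F n).
  move=> /hN2 h; have x0l : cabs x0 <= 1 by rewrite x01.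
  apply: le_trans (cabs_le_supnorm (dF n) x0l); rewrite FE //.
  have k0K' : (k0 < K.+1)%N by rewrite ltnS.
  rewrite (bigD1 (Ordinal k0K')) //= x0E peak_self // expr1n mulr1.
  set rest := \sum_(i < K.+1 | _) _.
  have hr : cabs rest <= S / 4.
    apply: (le_trans (cabs_sum _ _ _)); apply: le_trans h.
    rewrite [leRHS](bigD1 (Ordinal k0K')) //= {1}/A' eqxx mul0r add0r; apply: ler_sum => k kk.
    have kk' : (k == k0 :> nat) = false.
      by apply/negbTE; apply: contra kk => /eqP h2; apply/eqP; apply: val_inj.
    by rewrite /A' kk' /q' mulrA cabsM cabsX.
  have := cabs_sub_ge (al k0 * wprod k0 x0) (- rest); rewrite opprK cabsN.
  by move: x0S hr; lra.
have eS4 : 0 < e * (S / 4) by rewrite mulr_gt0.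
have /choice [sk hsk] : forall k : nat, exists s' : R, 0 <= s' < 1 /\ forall z, cabs z <= s -> cabs (iter k B z) <= s'.
  by move=> k; exact: iter_interior.
(* By [peak_le], a bound below 1 for the peak factor after [k] steps from the disc of radius [s]. *)
pose q'' k := (1 + sk k) / 2.
have q01'' k : 0 <= q'' k < 1 by have [/andP[h1 h2] _] := hsk k; rewrite /q''; lra.
have q01l k : 0 <= q'' k <= 1 by have /andP[h1 /ltW h2] := q01'' k; rewrite h1.
have w0 : 0 <= supnorm w by exact: supnorm_ge0.
pose A'' k := cabs (al k) * supnorm w ^+ k.
have A0'' k : 0 <= A'' k by rewrite mulr_ge0 ?cabs_ge0 ?exprn_ge0.
have [|N3 hN3] := @sum_pow_small R K.+1 A'' q'' (e * (S / 4)) A0'' q01l _ eS4.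
  by move=> k _; right; have /andP[_] := q01'' k.
have int n z : (N3 <= n)%N -> cabs z <= s -> cabs (F n z) <= e * (S / 4).
  move=> /hN3 h zs; have z1 : cabs z <= 1 by exact: le_trans zs (ltW s1).
  rewrite FE //; apply: (le_trans (cabs_sum _ _ _)); apply: le_trans h.
  apply: ler_sum => k _; rewrite /A'' mulrA cabsM [cabs (al _ * _)]cabsM cabsX.
  apply: ler_pM; rewrite ?mulr_ge0 ?exprn_ge0 ?cabs_ge0 //.
    by apply: ler_wpM2l; rewrite ?cabs_ge0 // wprod_le.
  rewrite lerXn2r ?nnegrE ?cabs_ge0 //; first by case/andP: (q01l k).
  apply: (le_trans (peak_le _ p1)); rewrite /q'' ler_pM2r ?invr_gt0 // lerD2l.
  by have [_] := hsk k; apply.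
pose n := maxn N1 (maxn N2 N3).
have n1 : (N1 <= n)%N by exact: leq_maxl.
have n2 : (N2 <= n)%N by rewrite /n !leq_max leqnn !orbT.
have n3 : (N3 <= n)%N by rewrite /n !leq_max leqnn !orbT.
pose c := supnorm (F n).
have c4 : S / 4 <= c := low n n2.
have c0 : 0 < c := lt_le_trans S4 c4.
have cn : cabs (c^-1)%:C = c^-1 by rewrite cabs_real ger0_norm // invr_ge0 ltW.
exists ((c^-1)%:C *: F n); split.
- exact: disc_algZ.
- by rewrite supnormZ // cn mulVf // gt_eqF.
- have -> : T ((c^-1)%:C *: F n) - lam *: ((c^-1)%:C *: F n) = (c^-1)%:C *: (T (F n) - lam *: F n).
    by rewrite T_Z scalerBr !scalerA mulrC.
  rewrite supnormZ; last by apply: disc_algB; [exact: disc_alg_T|exact: disc_algZ].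
  rewrite cn mulrC ltr_pdivrMr //; apply: (le_lt_trans (up n n1)).
  have : e * (S / 4) <= e * c by rewrite ler_pM2l.
  by move: eS; lra.
- move=> z zs; rewrite fct_scaleE cabsM cn mulrC ler_pdivrMr //; apply: (le_trans (int n z n3 zs)).
  by rewrite ler_pM2l.
Qed.

Lemma disc_alg_vanish y : disc_alg y -> (forall z, cabs z < 1 -> y z = 0) -> y = 0.
Proof.
move=> dy y0; have [_ yc yo] := iffLR (disc_algP y) dy.
apply/funext => z; have [z1|z1] := leP (cabs z) 1; last exact: yo.
apply: cabs_eq0; apply/eqP; rewrite eq_le cabs_ge0 andbT; apply/ler_addgt0Pl => e e0; rewrite addr0.
have [r [r0 hr]] := yc z z1 e e0.
pose t := Num.min (1 / 2 : R) (r / 2).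
have t0 : 0 < t by rewrite lt_min !divr_gt0.
have t2 : t <= 1 / 2 by rewrite ge_min lexx.
have tr : t <= r / 2 by rewrite ge_min lexx orbT.
pose x := (1 - t)%:C * z.
have x1 : cabs x < 1.
  rewrite cabsM cabs_real ger0_norm; last by lra.
  by apply: (@le_lt_trans _ _ ((1 - t) * 1)); [rewrite ler_wpM2l //; lra|lra].
have xz : cabs (x - z) < r.
  have -> : x - z = (- t)%:C * z by rewrite /x !rmorphD !rmorphN rmorph1; ring.
  rewrite cabsM cabs_real normrN ger0_norm ?(ltW t0) //.
  by apply: (@le_lt_trans _ _ (t * 1)); [rewrite ler_wpM2l // ltW|lra].
by have := hr x xz (ltW x1); rewrite y0 // sub0r cabsN => /ltW.
Qed.

Lemma usf_circle lam : cabs lam = rho -> sigma_usf T lam.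
Proof.
move=> lr; pose e n : R := n.+1%:R^-1.
have e0 n : 0 < e n by rewrite invr_gt0 ltr0n.
have e_small r : 0 < r -> exists N, forall n, (N <= n)%N -> e n < r.
  move=> r0; have [N hN] := eventually_eps 1 r0; exists N => n /hN h.
  rewrite invf_plt ?posrE ?ltr0n // -[r^-1]mul1r ltr_pdivrMr //; apply: (le_lt_trans h).
  by rewrite ltr_pM2r // ltr_nat.
have /choice [F hF] : forall n, exists F, [/\ disc_alg F, supnorm F = 1, supnorm (T F - lam *: F) < e n &
    forall z, cabs z <= 1 - e n -> cabs (F z) <= e n].
  by move=> n; apply: ex_approx_eigenfunction => //; rewrite gtrBl.
have dF n : disc_alg (F n) by have [] := hF n.
exists F; split.
  split=> //; first by move=> n; have [] := hF n.
  apply: eps_cvg0 => [n|r r0].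
    by apply: supnorm_ge0; apply: disc_algB; [exact: disc_alg_T|exact: disc_algZ].
  have [N hN] := e_small r r0; exists N => n /hN; have [_ _ h _] := hF n; exact: lt_trans h.
move=> [phi [y [phi_mono dy yc]]].
have phi_ge n : (n <= phi n)%N.
  by elim: n => // n IH; exact: leq_ltn_trans IH (phi_mono _ _ (ltnSn n)).
(* Each interior point eventually satisfies [cabs z <= 1 - e n], so the limit vanishes there, hence
   everywhere, against norm 1. *)
have y0 : y = 0.
  apply: disc_alg_vanish => // z z1; apply: cabs_eq0; apply/eqP; rewrite eq_le cabs_ge0 andbT.
  apply/ler_addgt0Pl => r r0; rewrite addr0; have r2 : 0 < r / 2 by rewrite divr_gt0.
  have [N1 h1] := cvg0_eps yc r2; have [N2 h2] := e_small _ r2.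
  have z2 : 0 < 1 - cabs z by rewrite subr_gt0.
  have [N3 h3] := e_small _ z2.
  pose n := maxn N1 (maxn N2 N3).
  have n1 : (N1 <= n)%N by exact: leq_maxl.
  have n2 : (N2 <= phi n)%N by apply: leq_trans (phi_ge n); rewrite /n !leq_max leqnn !orbT.
  have n3 : (N3 <= phi n)%N by apply: leq_trans (phi_ge n); rewrite /n !leq_max leqnn !orbT.
  have [_ _ _ hi] := hF (phi n).
  have k1 : cabs (F (phi n) z) <= e (phi n) by apply: hi; have := h3 _ n3; lra.
  have dFy : disc_alg (F (phi n) - y) by exact: disc_algB.
  have k2 := cabs_le_supnorm dFy (ltW z1).
  have k3 := h1 n n1; have k4 := h2 _ n2.
  have := cabs_sub_ge (y z) (F (phi n) z); rewrite cabsB.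
  have -> : F (phi n) z - y z = (F (phi n) - y) z by [].
  by lra.
have h2 : (0 : R) < 1 by [].
have [N hN] := cvg0_eps yc h2; have := hN N (leqnn N); rewrite y0 subr0.
by have [_ -> _ _] := hF (phi N); rewrite ltxx.
Qed.

Lemma usf_sub_circle lam : sigma_usf T lam -> cabs lam = rho.
Proof.
move=> [F [[dF F1 Fc] _]].
have bad k : 0 < k -> (forall G, disc_alg G -> k * supnorm G <= supnorm (T G - lam *: G)) -> False.
  move=> k0 hk; have [N hN] := cvg0_eps Fc k0; have := hN N (leqnn N).
  have := hk _ (dF N); rewrite F1 mulr1 => h1 h2.
  by have := le_lt_trans h1 h2; rewrite ltxx.
have [lt|gt|//] := ltgtP (cabs lam) rho.
  by have [k [k0 hk]] := below_lt d2 ha wA wT sh lt; case: (bad k k0 hk).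
by have [k [k0 hk]] := below_gt d2 ha wA wT gt; case: (bad k k0 hk).
Qed.
End UpperSemiFredholm.

Theorem theorem6 (R : realType) (d : nat) (theta : R) (a : 'I_d -> R[i])
  (w : R[i] -> R[i]) :
  (2 <= d)%N ->
  (forall j, cabs (a j) < 1) ->
  disc_alg w ->
  (exists z, cD z /\ w z != 0) ->
  (elliptic (blaschke theta a) \/ doubly_parabolic (blaschke theta a)) ->
  (forall z, cT z -> w z != 0) ->
  let T := wcomp w (blaschke theta a) in
  [/\ 0 < rhoA T,
      sigmaA T = [set lam | cabs lam <= rhoA T],
      sigma_lsf T = [set lam | cabs lam <= rhoA T] &
      sigma_usf T = [set lam | cabs lam = rhoA T]].
Proof.
move=> d2 ha wA _ types wT T.
have sh : circle_shadowing theta a w.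
  by case: types; [exact: elliptic_circle_shadowing|exact: parabolic_circle_shadowing].
have [p [p1 pnp]] := ex_nonperiodic theta d2 ha.
pose r := rho theta a w; have r0 : 0 < r := rho_gt0 theta ha wA wT.
have lsf lam : cabs lam <= r -> sigma_lsf T lam := fun h => lsf_disc d2 ha wA wT sh p1 pnp h.
have spec_le lam : sigmaA T lam -> cabs lam <= r.
  by move=> h; rewrite leNgt; apply/negP => /(notin_spectrum d2 ha wA wT).
have sub lam : sigma_lsf T lam -> sigmaA T lam := fun h => lsf_sub_spectrum d2 ha wA h.
have specE : sigmaA T = [set lam | cabs lam <= r].
  by apply/seteqP; split=> lam /= h; [exact: spec_le|apply: sub; exact: lsf].
(* The supremum defining [rhoA] is attained: the real number [r] itself lies in the spectrum. *)
have rE : rhoA T = r.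
  have cr : cabs (r%:C) = r by rewrite cabs_real ger0_norm // ltW.
  apply/eqP; rewrite eq_le; apply/andP; split.
    apply: ge_sup; last by move=> _ [lam /spec_le h <-].
    by exists (cabs r%:C), r%:C => //; apply: sub; apply: lsf; rewrite cr.
  apply: ub_le_sup; first by exists r => _ [lam /spec_le h <-].
  by exists r%:C => //; apply: sub; apply: lsf; rewrite cr.
rewrite rE; split=> //; apply/seteqP; split=> lam /= h.
- exact: spec_le (sub _ h).
- exact: lsf.
- exact: (usf_sub_circle d2 ha wA wT sh).
- exact: (usf_circle d2 ha wA wT sh p1 pnp).
Qed.
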